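(* Let $d\ge1$. If $\{g_n\}_{n\in\mathbb{N}}$ is an (infinite) orthonormal sequence in $L^2(\mathbb{R}^d)$ with $g_n,\hat g_n\in L^1(\mathbb{R}^d)\cap L^2(\mathbb{R}^d)$ for all $n\in\mathbb{N}$, then the function $(x,\omega)\mapsto\sup_{n\in\mathbb{N}}|Wg_n(x,\omega)|$ does not belong to $L^2(\mathbb{R}^{2d})$.
   Context: Functions are complex-valued. The Fourier transform on $\mathbb{R}^d$ is $\hat f(\omega)=\int_{\mathbb{R}^d}f(x)e^{-2\pi i x\cdot\omega}\,dx$ (extended to $L^2(\mathbb{R}^d)$ as a unitary operator). The Wigner distribution of $f\in L^2(\mathbb{R}^d)$ is $$Wf(x,\omega)=\int_{\mathbb{R}^d}f\left(x+\tfrac t2\right)\overline{f\left(x-\tfrac t2\right)}e^{-2\pi i t\cdot\omega}\,dt,\qquad x,\omega\in\mathbb{R}^d.$$ *)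

(* Defs.v *)
From HB Require Import structures.
From mathcomp Require Import all_boot all_order all_algebra.
From mathcomp Require Import complex.
From mathcomp Require Import all_classical all_reals all_analysis.
From mathcomp Require Import measurable_realfun.
Set Implicit Arguments.
Unset Strict Implicit.
Unset Printing Implicit Defensive.
Import Order.TTheory GRing.Theory Num.Theory.
Import numFieldNormedType.Exports.
Local Open Scope classical_set_scope.
Local Open Scope ring_scope.

Fact rV_display : measure_display.
Proof. exact: default_measure_display. Qed.

(* R^n is 'rV[R]_n; its sigma-algebra is the one generated by the coordinate
   maps, i.e., the Borel sigma-algebra. *)
Section measurable_rV.
Context {R : realType}.
Variable n : nat.

Let coors : 'I_n -> 'rV[R]_n -> measurableTypeR R := fun i x => x ord0 i.

Let rV_set0 : g_sigma_preimage coors set0.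
Proof. exact: sigma_algebra0. Qed.

Let rV_setC A : g_sigma_preimage coors A -> g_sigma_preimage coors (~` A).
Proof. exact: sigma_algebraC. Qed.

Let rV_bigcup (F : _^nat) : (forall i, g_sigma_preimage coors (F i)) ->
  g_sigma_preimage coors (\bigcup_i (F i)).
Proof. exact: sigma_algebra_bigcup. Qed.

HB.instance Definition _ := @isMeasurable.Build rV_display
  'rV[R]_n (g_sigma_preimage coors) rV_set0 rV_setC rV_bigcup.

End measurable_rV.

Lemma measurable_coord_rV (R : realType) n (i : 'I_n) :
  measurable_fun [set: 'rV[R]_n] (fun x => x ord0 i : measurableTypeR R).
Proof.
move=> _ Y mY; rewrite setTI; apply: sub_sigma_algebra => /=.
rewrite -bigcup_seq/=; exists i => /=; first by rewrite mem_index_enum.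
by exists Y => //; rewrite setTI.
Qed.

Lemma measurable_fun_rVP (R : realType) d (T : measurableType d) n
    (f : T -> 'rV[R]_n) :
  (forall i, measurable_fun [set: T] (fun x => f x ord0 i : measurableTypeR R)) ->
  measurable_fun [set: T] f.
Proof.
move=> mf.
suff : preimage_set_system [set: T] f measurable `<=` measurable.
  by move=> h _ A mA; apply: h; exists A.
rewrite /measurable/= -g_sigma_preimage_comp.
apply: smallest_sub; first exact: sigma_algebra_measurable.
rewrite -bigcup_seq; apply: bigcup_sub => i _.
by move=> A [B mB <-]; exact: mf.
Qed.

Lemma sigma_finite_product_measure1 (R : realType) d1 d2
    (T1 : measurableType d1) (T2 : measurableType d2)
    (m1 : {sigma_finite_measure set T1 -> \bar R})
    (m2 : {sigma_finite_measure set T2 -> \bar R}) :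
  sigma_finite setT (m1 \x m2)%E.
Proof.
have /sigma_finiteP[F [TF ndF Foo]] := sigma_finiteT m1.
have /sigma_finiteP[G [TG ndG Goo]] := sigma_finiteT m2.
exists (fun n => F n `*` G n).
  rewrite -setXTT TF TG predeqE => -[x y]; split.
    move=> [/= [n _ Fnx] [k _ Gky]]; exists (maxn n k) => //; split.
    - by move: x Fnx; exact/subsetPset/ndF/leq_maxl.
    - by move: y Gky; exact/subsetPset/ndG/leq_maxr.
  by move=> [n _ []/= ? ?]; split; exists n.
move=> k; have [? ?] := Foo k; have [? ?] := Goo k.
split; first exact: measurableX.
by rewrite product_measure1E// lte_mul_pinfty// ge0_fin_numE.
Qed.

Section lebesgue_rV.
Context {R : realType}.
Local Open Scope ereal_scope.

(* (x, y) |-> (x, y_0, ..., y_(n-1)) *)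
Definition cons_rV n (p : measurableTypeR R * 'rV[R]_n) : 'rV[R]_n.+1 :=
  row_mx (p.1)%:M p.2.

Lemma cons_rV0 n p : @cons_rV n p ord0 ord0 = p.1.
Proof.
have -> : ord0 = lshift n ord0 :> 'I_(1 + n) by exact/val_inj.
by rewrite /cons_rV (row_mxEl (p.1)%:M p.2) mxE eqxx mulr1n.
Qed.

Lemma cons_rVS n p (i : 'I_n) : @cons_rV n p ord0 (lift ord0 i) = p.2 ord0 i.
Proof.
have -> : lift ord0 i = rshift 1 i :> 'I_(1 + n) by exact/val_inj.
by rewrite /cons_rV (row_mxEr (p.1)%:M p.2).
Qed.

Lemma measurable_cons_rV n : measurable_fun setT (@cons_rV n).
Proof.
apply: measurable_fun_rVP => i; case: (unliftP ord0 i) => [j|] ->.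
  under eq_fun do rewrite cons_rVS.
  exact: measurableT_comp (measurable_coord_rV j) measurable_snd.
under eq_fun do rewrite cons_rV0.
exact: measurable_fst.
Qed.

Definition uncons_rV n (x : 'rV[R]_n.+1) : measurableTypeR R * 'rV[R]_n :=
  (x ord0 ord0, \row_i x ord0 (lift ord0 i)).

Lemma measurable_uncons_rV n : measurable_fun setT (@uncons_rV n).
Proof.
apply/measurable_fun_pairP; split; first exact: measurable_coord_rV.
apply: measurable_fun_rVP => i.
under eq_fun do rewrite /= mxE.
exact: measurable_coord_rV.
Qed.

Lemma cons_rVK n : cancel (@cons_rV n) (@uncons_rV n).
Proof.
move=> [x y]; rewrite /uncons_rV cons_rV0; congr pair.
by apply/rowP => i; rewrite mxE cons_rVS.
Qed.

Lemma uncons_rVK n : cancel (@uncons_rV n) (@cons_rV n).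
Proof.
move=> x; apply/rowP => i; case: (unliftP ord0 i) => [j|] ->.
  by rewrite cons_rVS mxE.
by rewrite cons_rV0.
Qed.

Section step.
Context n (mu : {sigma_finite_measure set 'rV[R]_n -> \bar R}).

Definition lebesgue_rVS : set 'rV[R]_n.+1 -> \bar R :=
  pushforward (@lebesgue_measure R \x mu) (@cons_rV n).

Let mcons A : measurable A -> measurable (@cons_rV n @^-1` A).
Proof. by move=> mA; rewrite -[X in measurable X]setTI; exact: measurable_cons_rV. Qed.

Let lebesgue_rVS0 : lebesgue_rVS set0 = 0.
Proof. by rewrite /lebesgue_rVS /pushforward preimage_set0 measure0. Qed.

Let lebesgue_rVS_ge0 A : 0 <= lebesgue_rVS A.
Proof. by apply: integral_ge0 => // x _; exact: measure_ge0. Qed.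

Let lebesgue_rVS_sigma_additive : semi_sigma_additive lebesgue_rVS.
Proof.
move=> F mF tF mUF; rewrite /lebesgue_rVS /pushforward preimage_bigcup.
apply: measure_semi_sigma_additive.
- by move=> k; exact: mcons.
- apply/trivIsetP => /= i j _ _ ij; rewrite -preimage_setI.
  by move/trivIsetP : tF => /(_ _ _ _ _ ij) ->//; rewrite preimage_set0.
- by rewrite -preimage_bigcup; exact: mcons.
Qed.

HB.instance Definition _ := isMeasure.Build _ _ _ lebesgue_rVS
  lebesgue_rVS0 lebesgue_rVS_ge0 lebesgue_rVS_sigma_additive.

Let lebesgue_rVS_sigma_finite : sigma_finite setT lebesgue_rVS.
Proof.
have [F TF Foo] :=
  sigma_finite_product_measure1 (@lebesgue_measure R) mu.
exists (fun k => @uncons_rV n @^-1` F k).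
  by rewrite -preimage_bigcup -TF preimage_setT.
move=> k; have [mFk Fkoo] := Foo k; split.
  by rewrite -[X in measurable X]setTI; exact: measurable_uncons_rV.
rewrite /lebesgue_rVS /pushforward -comp_preimage.
by rewrite (_ : _ \o _ = id)//; apply/funext => p /=; rewrite cons_rVK.
Qed.

HB.instance Definition _ := Measure_isSigmaFinite.Build _ _ _ lebesgue_rVS
  lebesgue_rVS_sigma_finite.

End step.

(* n-fold product of the Lebesgue measure on R; see lebesgue_rV_box. *)
Fixpoint lebesgue_rV n : {sigma_finite_measure set 'rV[R]_n -> \bar R} :=
  match n with
  | 0%N => \d_(0%R : 'rV[R]_0)
  | n'.+1 => lebesgue_rVS (lebesgue_rV n')
  end.

End lebesgue_rV.

Lemma lebesgue_rV_box (R : realType) n (a b : 'rV[R]_n) :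
  (forall i, a ord0 i <= b ord0 i) ->
  lebesgue_rV n [set x : 'rV[R]_n | forall i, a ord0 i <= x ord0 i <= b ord0 i] =
  (\prod_(i < n) (b ord0 i - a ord0 i))%:E.
Proof.
elim: n a b => [|n IHn] a b ab.
  rewrite big_ord0 /= diracE mem_set//= => i; by case: i.
rewrite -[LHS]/((@lebesgue_measure R \x lebesgue_rV n)%E (@cons_rV R n @^-1` _)).
pose a' := (uncons_rV a).2; pose b' := (uncons_rV b).2.
rewrite [X in product_measure1 _ _ X](_ : _ = `[a ord0 ord0, b ord0 ord0]%classic `*`
    [set y : 'rV[R]_n | forall i, a' ord0 i <= y ord0 i <= b' ord0 i]).
  have mB : measurable
      [set y : 'rV[R]_n | forall i, a' ord0 i <= y ord0 i <= b' ord0 i].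
    rewrite [X in measurable X](_ : _ =
      \bigcap_(i in [set: 'I_n]) ((fun y : 'rV[R]_n => y ord0 i) @^-1`
        `[a' ord0 i, b' ord0 i]%classic)); last first.
      apply/seteqP; split => y /= h.
        by move=> i _ /=; rewrite in_itv/=; exact: h.
      by move=> i; have := h i I; rewrite /= in_itv.
    apply: fin_bigcap_measurable => // i _.
    have /(_ _ i measurableT _ (measurable_itv `[a' ord0 i, b' ord0 i])) :=
      @measurable_coord_rV R.
    by rewrite setTI.
  rewrite product_measure1E//.
  rewrite [X in (X * _)%E](lebesgue_measure_itv `[a ord0 ord0, b ord0 ord0])/=.
  rewrite IHn => [|i]; last by rewrite !mxE.
  rewrite big_ord_recl EFinM; congr (_ * _)%E.
    rewrite lte_fin lt_neqAle ab andbT; case: eqP => [->|_] //=.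
    by rewrite subrr.
  by congr EFin; apply: eq_bigr => i _; rewrite !mxE.
apply/seteqP; split => [[x y]/= h|[x y]/= [+ h] i].
  split=> [|i]; first by have := h ord0; rewrite cons_rV0 in_itv.
  by have := h (lift ord0 i); rewrite cons_rVS !mxE.
rewrite in_itv/=; case: (unliftP ord0 i) => [j|] -> h0.
  by have := h j; rewrite cons_rVS !mxE.
by rewrite cons_rV0.
Qed.

Section complex_functions.
Context {R : realType} d {T : measurableType d}.
Variable mu : {measure set T -> \bar R}.

Definition cintegral (f : T -> R[i]) : R[i] :=
  Complex (\int[mu]_x complex.Re (f x)) (\int[mu]_x complex.Im (f x)).

Definition cLfun (p : \bar R) (f : T -> R[i]) :=
  [/\ measurable_fun [set: T] (fun x => complex.Re (f x)),
      measurable_fun [set: T] (fun x => complex.Im (f x)) &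
      finite_norm mu p (fun x => Normc.normc (f x))].

(* Lfun for extended-real-valued functions, such as suprema. *)
Definition eLfun (p : \bar R) (f : T -> \bar R) :=
  measurable_fun [set: T] f /\ ('N[mu]_p[f] < +oo)%E.

Definition cinner (f h : T -> R[i]) : R[i] :=
  cintegral (fun x => f x * conjc (h x)).

Definition orthonormal_seq (g : nat -> T -> R[i]) :=
  (forall n, cLfun 2%:E (g n)) /\
  (forall m n, cinner (g m) (g n) = (m == n)%:R).

End complex_functions.

Section fourier_wigner.
Context {R : realType} {d : nat}.
Implicit Types (x w t : 'rV[R]_d) (f : 'rV[R]_d -> R[i]).

Definition dotr x w : R := \sum_(i < d) x ord0 i * w ord0 i.

Definition expi (s : R) : R[i] := Complex (cos s) (sin s).

(* The integral formula, hence the Fourier transform of f in L^1; on the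
   intersection of L^1 and L^2 it coincides with the unitary extension to L^2. *)
Definition fourier f w : R[i] :=
  cintegral (lebesgue_rV d) (fun x => f x * expi (- (2 * pi * dotr x w))).

Definition wigner f (z : 'rV[R]_d * 'rV[R]_d) : R[i] :=
  cintegral (lebesgue_rV d) (fun t =>
    f (z.1 + 2^-1 *: t) * conjc (f (z.1 - 2^-1 *: t)) *
    expi (- (2 * pi * dotr t z.2))).

End fourier_wigner.

(* Main.v *)
From HB Require Import structures.
Require Import Defs.
From mathcomp Require Import all_boot all_order all_algebra.
From mathcomp Require Import complex.
From mathcomp Require Import all_classical all_reals all_analysis.
From mathcomp Require Import measurable_realfun.
From mathcomp Require Import ring lra.

(** If the supremum is square integrable, its square [P] is an integrable
    function with [|wigner (g m)|^2 <= P] for all [m].  The contradiction comes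
    from the numbers, for [W = wigner f],
      J_f(c, e) = \iint W(u) W(v) phi(c (u + v)) kappa(e (u - v)) du dv
    ([cutoff_form]), where [phi] and [kappa] are even cutoffs with value 1 at 0,
    products of tents and, in some of the variables, of Fejer kernels, the
    Fourier transforms of tents.  For small [c] and [e] this regularises
    (\int W)^2, which is formally |f|^4 for the L2 norm |f|.

    Expanding both Wigner distributions and integrating over the frequencies
    turns J_f(c, e) into the integral of
      f(a) f(b)^* f(a') f(b')^*
    against an explicit bounded integrable kernel ([wigner_quadratic],
    [wigner_form_quartic]).  Three facts follow.
    - Along an orthonormal sequence, J_{g m}(c, e) tends to 0 for fixed [c] and
      [e]: the integrands are the fourfold tensor powers of [g m], which are
      again orthonormal, so Bessel's inequality applies ([quartic_cvg0]).
    - Exchanging [b] and [b'] gives J_f(c, e) = e^(-2d) J_f(c, 1/e)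
      ([quartic_swap], [cutoff_form_swap]).  On the right the second cutoff
      concentrates on the diagonal [u = v], so J_f also regularises
      \int W^2; this is a regularised form of Moyal's identity.
    - If |f| = 1, then J_f(e, e) tends to a positive constant independent of
      [f] as [e] tends to 0 ([wigner_form_diagonal_cvg]).  After the exchange
      and a rescaling, the integrand converges by continuity of translations
      in L2.

    Domination by [P] makes the passage from fixed parameters to the diagonal
    uniform in [m].  Replacing [e] by a smaller parameter at fixed [c] costs at
    most
      \iint phi(c (u + v)) (1 - kappa(e (u - v))) P(u) du dv
    for each of the two parameters, which is small with [e]
    ([cutoff_form_diff], [tail_diff_cvg0]).  Replacing [c] is expensive in this
    form, because [v] ranges over distances of order 1 / e from [u], but after
    the exchange it costs at most
      e^(-2d) \iint (1 - phi(c (u + v))) kappa((u - v) / e) P(u) du dv,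
    where [v] stays close to [u]; this is small as soon as [c] and [e] both are
    ([cutoff_form_sum], [tail_sum_uniform]).  With [c], then [e], then [m]
    chosen suitably, J_{g m}(c, e) is close to 0 and also close to the positive
    limit of J_{g m}(e', e') as [e'] tends to 0. *)

Set Implicit Arguments.
Unset Strict Implicit.
Unset Printing Implicit Defensive.
Import Order.TTheory GRing.Theory Num.Theory.
Import numFieldNormedType.Exports.
Local Open Scope classical_set_scope.
Local Open Scope ring_scope.

Local Notation normc := Normc.normc.

(** * Product measures and maps that scale a measure *)

Reserved Notation "m1 \X m2" (at level 40, left associativity).

Section product_measure.
Context {R : realType} d1 d2 (T1 : measurableType d1) (T2 : measurableType d2)
  (m1 : {sigma_finite_measure set T1 -> \bar R})
  (m2 : {sigma_finite_measure set T2 -> \bar R}).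
Local Open Scope ereal_scope.

(** A copy of the product measure that carries the sigma-finite structure
    required to iterate products. *)
Definition prodm : set (T1 * T2) -> \bar R := (m1 \x m2).

HB.instance Definition _ := Measure.on prodm.
HB.instance Definition _ := @Measure_isSigmaFinite.Build _ _ _ prodm
  (sigma_finite_product_measure1 m1 m2).

Lemma prodmE A : prodm A = \int[m1]_x (m2 \o xsection A) x.
Proof. by []. Qed.

Lemma tonelli1 (f : T1 * T2 -> \bar R) : measurable_fun setT f ->
  (forall z, 0 <= f z) ->
  \int[prodm]_z f z = \int[m1]_x \int[m2]_y f (x, y).
Proof. by move=> mf f0; exact: fubini_tonelli1. Qed.

Lemma tonelli2 (f : T1 * T2 -> \bar R) : measurable_fun setT f ->
  (forall z, 0 <= f z) ->
  \int[prodm]_z f z = \int[m2]_y \int[m1]_x f (x, y).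
Proof. by move=> mf f0; exact: fubini_tonelli2. Qed.

Lemma measurable_tonelli1 (f : T1 * T2 -> \bar R) : measurable_fun setT f ->
  (forall z, 0 <= f z) ->
  measurable_fun setT (fun x => \int[m2]_y f (x, y)).
Proof. by move=> mf f0; exact: measurable_fun_fubini_tonelli_F. Qed.

Lemma measurable_tonelli2 (f : T1 * T2 -> \bar R) : measurable_fun setT f ->
  (forall z, 0 <= f z) ->
  measurable_fun setT (fun y => \int[m1]_x f (x, y)).
Proof. by move=> mf f0; exact: measurable_fun_fubini_tonelli_G. Qed.

End product_measure.
Notation "m1 \X m2" := (prodm m1 m2) : ereal_scope.
Arguments tonelli1 {R d1 d2 T1 T2} m1 m2 f.
Arguments tonelli2 {R d1 d2 T1 T2} m1 m2 f.
Arguments measurable_tonelli1 {R d1 d2 T1 T2} m2 f.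
Arguments measurable_tonelli2 {R d1 d2 T1 T2} m1 f.

Lemma measure_integral_indic {R : realType} d (T : measurableType d)
    (m : {measure set T -> \bar R}) (A : set T) :
  measurable A -> m A = (\int[m]_z (\1_A z)%:E)%E.
Proof. by move=> mA; rewrite integral_indic// setIT. Qed.

Section scaling_map.
Context {R : realType} d1 d2 (T1 : measurableType d1) (T2 : measurableType d2).

(** [m2] is, up to the factor [k], the image of [m1] under [f]; for an
    invertible linear map between Lebesgue measures [k] is the inverse of the
    absolute Jacobian. *)
Definition scales_measure (k : R) m1 m2 (f : T1 -> T2) :=
  [/\ (0 < k)%R, measurable_fun setT f &
      forall A, measurable A -> m1 (f @^-1` A) = (k%:E * m2 A)%E].

End scaling_map.

Section scaling_map_theory.
Context {R : realType}.
Local Open Scope ereal_scope.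

Lemma scales_comp d1 d2 d3 (T1 : measurableType d1) (T2 : measurableType d2)
    (T3 : measurableType d3) (m1 : {measure set T1 -> \bar R})
    (m2 : {measure set T2 -> \bar R}) (m3 : {measure set T3 -> \bar R})
    (k l : R) (f : T1 -> T2) (g : T2 -> T3) :
  scales_measure k m1 m2 f -> scales_measure l m2 m3 g ->
  scales_measure (k * l)%R m1 m3 (g \o f).
Proof.
move=> [k0 mf fE] [l0 mg gE]; split; first exact: mulr_gt0.
  exact: measurableT_comp.
move=> A mA; rewrite comp_preimage fE ?gE ?EFinM ?muleA//.
by rewrite -[X in measurable X]setTI; exact: mg.
Qed.

Lemma scales_id d1 (T1 : measurableType d1) (m1 : {measure set T1 -> \bar R}) :
  scales_measure 1%R m1 m1 id.
Proof. by split => // A mA; rewrite mul1e. Qed.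

Section integrals.
Context d1 d2 (T1 : measurableType d1) (T2 : measurableType d2)
  (m1 : {measure set T1 -> \bar R}) (m2 : {measure set T2 -> \bar R})
  (k : R) (f : T1 -> T2) (kf : scales_measure k m1 m2 f).

Lemma ge0_integral_scales (F : T2 -> \bar R) :
  measurable_fun setT F -> (forall y, 0 <= F y) ->
  \int[m1]_x F (f x) = k%:E * \int[m2]_y F y.
Proof.
case: kf => k0 mf fE mF F0.
have := @ge0_integral_pushforward _ _ _ _ R f mf m1 setT F measurableT mF
  (fun y _ => F0 y).
rewrite preimage_setT /= /comp => <-.
have k0' : (0 <= k)%R by exact: ltW.
rewrite -[k in RHS]/((NngNum k0')%:num).
rewrite -ge0_integral_mscale//.
by apply: eq_measure_integral => A mA _; exact: fE.
Qed.

Lemma integrable_scales (F : T2 -> \bar R) : measurable_fun setT F ->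
  m1.-integrable setT (F \o f) <-> m2.-integrable setT F.
Proof.
move=> mF; have mf : measurable_fun setT f by case: kf.
have mFf : measurable_fun setT (F \o f) by exact: measurableT_comp.
have E : \int[m1]_x `|F (f x)| = k%:E * \int[m2]_y `|F y|.
  apply: (@ge0_integral_scales (abse \o F)) => [|y]; last exact: abse_ge0.
  exact: measurableT_comp.
have k0 : (0 < k)%R by case: kf.
have I0 : 0 <= \int[m2]_y `|F y| by apply: integral_ge0.
split=> /integrableP[_ h]; apply/integrableP; split => //.
  move: I0 h; rewrite /= E; case: (\int[m2]_y `|F y|) => //=.
    by move=> r _ _; rewrite ltry.
  by move=> _; rewrite gt0_muley ?lte_fin// ltxx.
rewrite [X in X < _]E; move: I0 h.
by case: (\int[m2]_y `|F y|) => //= r _ _; rewrite -EFinM ltry.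
Qed.

Lemma integral_scales (F : T2 -> \bar R) :
  m2.-integrable setT F ->
  \int[m1]_x F (f x) = k%:E * \int[m2]_y F y.
Proof.
move=> iF; have mF := measurable_int _ iF.
rewrite integralE [in RHS]integralE.
under eq_integral do rewrite funepos_comp/=.
under [X in _ - X = _]eq_integral do rewrite funeneg_comp/=.
rewrite (@ge0_integral_scales F^\+)//; last exact: measurable_funepos.
rewrite (@ge0_integral_scales F^\-)//; last exact: measurable_funeneg.
rewrite [RHS]muleBr//; apply: fin_num_adde_defr.
by apply: integrable_fin_num => //; exact: integrable_funepos.
Qed.

End integrals.

Section products.
Context d1 d2 d3 (T1 : measurableType d1) (T2 : measurableType d2)
  (T3 : measurableType d3)
  (m1 : {sigma_finite_measure set T1 -> \bar R})
  (m2 : {sigma_finite_measure set T2 -> \bar R})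
  (m3 : {sigma_finite_measure set T3 -> \bar R}).

(** Tonelli: a map that acts fibrewise and scales the measure of each fibre by
    the same factor scales the product measure.  All changes of variables below
    are composed of such maps and permutations of factors. *)
Lemma scales_fibre2 (k : R) (S : T1 * T2 -> T3) :
  measurable_fun setT S ->
  (forall x, scales_measure k m2 m3 (fun y => S (x, y))) ->
  scales_measure k (m1 \X m2) (m1 \X m3) (fun z => (z.1, S z)).
Proof.
move=> mS kS.
have mf : measurable_fun setT (fun z : T1 * T2 => (z.1, S z)).
  apply/measurable_fun_pairP; split; first exact: measurable_fst.
  by under eq_fun do rewrite /=.
have k0 : (0 < k)%R by case: (kS point).
split => // A mA.
have k0' : (0 <= k)%R by exact: ltW.
rewrite !prodmE -ge0_integralZl//; last exact: measurable_fun_xsection.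
apply: eq_integral => x _.
by case: (kS x) => _ _ <- //; exact: measurable_xsection.
Qed.

Definition prod_swap (z : T1 * T2) : T2 * T1 := (z.2, z.1).

Lemma measurable_prod_swap : measurable_fun setT prod_swap.
Proof.
apply/measurable_fun_pairP.
by split; [exact: measurable_snd|exact: measurable_fst].
Qed.

Lemma scales_swap : scales_measure 1%R (m1 \X m2) (m2 \X m1) prod_swap.
Proof.
have ms := measurable_prod_swap.
split => // A mA; rewrite mul1e.
have mA' : measurable (prod_swap @^-1` A).
  by rewrite -[X in measurable X]setTI; exact: ms.
pose h (z : T1 * T2) : \bar R := (\1_(prod_swap @^-1` A) z)%:E.
pose h' (z : T2 * T1) : \bar R := (\1_A z)%:E.
have mh : measurable_fun setT h by exact/measurable_EFinP.
have mh' : measurable_fun setT h' by exact/measurable_EFinP.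
rewrite !measure_integral_indic// (tonelli2 _ _ h)//.
  by rewrite (tonelli1 _ _ h')// => z; rewrite lee_fin.
by move=> z; rewrite lee_fin.
Qed.

End products.

Lemma scales_fibre1 d1 d2 d3 (T1 : measurableType d1) (T2 : measurableType d2)
  (T3 : measurableType d3)
  (m1 : {sigma_finite_measure set T1 -> \bar R})
  (m2 : {sigma_finite_measure set T2 -> \bar R})
  (m3 : {sigma_finite_measure set T3 -> \bar R})
  (k : R) (S : T1 * T2 -> T3) :
  measurable_fun setT S ->
  (forall y, scales_measure k m1 m3 (fun x => S (x, y))) ->
  scales_measure k (m1 \X m2) (m3 \X m2) (fun z => (S z, z.2)).
Proof.
move=> mS kS.
have mSs : measurable_fun setT (S \o @prod_swap _ _ T2 T1).
  by apply: measurableT_comp => //; exact: measurable_prod_swap.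
have H2 := @scales_fibre2 _ _ _ _ _ _ m2 m1 m3 k _ mSs kS.
have := scales_comp (scales_comp (scales_swap m1 m2) H2) (scales_swap m2 m3).
rewrite mul1r mulr1; congr (scales_measure _ _ _ _).
by apply/funext => -[x y].
Qed.

Lemma scales_prod d1 d2 d3 d4 (T1 : measurableType d1) (T2 : measurableType d2)
  (T3 : measurableType d3) (T4 : measurableType d4)
  (m1 : {sigma_finite_measure set T1 -> \bar R})
  (m2 : {sigma_finite_measure set T2 -> \bar R})
  (m3 : {sigma_finite_measure set T3 -> \bar R})
  (m4 : {sigma_finite_measure set T4 -> \bar R})
  (k l : R) (f : T1 -> T3) (g : T2 -> T4) :
  scales_measure k m1 m3 f -> scales_measure l m2 m4 g ->
  scales_measure (k * l)%R (m1 \X m2) (m3 \X m4) (fun z => (f z.1, g z.2)).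
Proof.
move=> kf lg; case: (kf) (lg) => _ mf _ [_ mg _].
have H1 := @scales_fibre1 _ _ _ _ _ _ m1 m2 m3 k (f \o fst)
  (measurableT_comp mf measurable_fst) (fun=> kf).
have H2 := @scales_fibre2 _ _ _ _ _ _ m3 m2 m4 l (g \o snd)
  (measurableT_comp mg measurable_snd) (fun=> lg).
exact: scales_comp H1 H2.
Qed.

Section assoc.
Context d1 d2 d3 (T1 : measurableType d1) (T2 : measurableType d2)
  (T3 : measurableType d3)
  (m1 : {sigma_finite_measure set T1 -> \bar R})
  (m2 : {sigma_finite_measure set T2 -> \bar R})
  (m3 : {sigma_finite_measure set T3 -> \bar R}).

Definition prod_assoc (z : T1 * T2 * T3) : T1 * (T2 * T3) :=
  (z.1.1, (z.1.2, z.2)).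

Lemma measurable_prod_assoc : measurable_fun setT prod_assoc.
Proof.
apply/measurable_fun_pairP; split.
  exact: measurableT_comp measurable_fst measurable_fst.
apply/measurable_fun_pairP; split; last exact: measurable_snd.
exact: measurableT_comp measurable_snd measurable_fst.
Qed.

Lemma scales_assoc :
  scales_measure 1%R (m1 \X m2 \X m3) (m1 \X (m2 \X m3)) prod_assoc.
Proof.
split; [by []|exact: measurable_prod_assoc|move=> A mA; rewrite mul1e].
have mA' : measurable (prod_assoc @^-1` A).
  by rewrite -[X in measurable X]setTI; exact: measurable_prod_assoc.
pose h (z : T1 * T2 * T3) : \bar R := (\1_(prod_assoc @^-1` A) z)%:E.
pose h' (z : T1 * (T2 * T3)) : \bar R := (\1_A z)%:E.
have mh : measurable_fun setT h by exact/measurable_EFinP.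
have mh' : measurable_fun setT h' by exact/measurable_EFinP.
have h0 z : 0 <= h z by rewrite lee_fin.
have h'0 z : 0 <= h' z by rewrite lee_fin.
rewrite !measure_integral_indic// (tonelli1 _ _ h mh h0).
have mF := measurable_tonelli1 m3 h mh h0.
have F0 z : 0 <= \int[m3]_y h (z, y) by apply: integral_ge0.
rewrite (tonelli1 _ _ _ mF F0) (tonelli1 _ _ h' mh' h'0).
apply: eq_integral => x _.
rewrite (tonelli1 _ _ (fun z => h' (x, z)))//.
exact: measurableT_comp mh' (pair1_measurable x).
Qed.

End assoc.

End scaling_map_theory.

(** * Modulus and measurability of complex functions *)

Section complex_modulus.
Context {R : realType}.
Implicit Types (z w : R[i]) (r s : R).

Lemma normc_ge0 z : 0 <= normc z.
Proof. by case: z => a b; exact: sqrtr_ge0. Qed.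

Lemma normc_sqr z : normc z ^+ 2 = complex.Re z ^+ 2 + complex.Im z ^+ 2.
Proof. by case: z => a b /=; rewrite sqr_sqrtr// addr_ge0 ?sqr_ge0. Qed.

Lemma normr_Re_le z : `|complex.Re z| <= normc z.
Proof.
case: z => a b /=; rewrite -sqrtr_sqr ler_wsqrtr//.
by rewrite lerDl sqr_ge0.
Qed.

Lemma normr_Im_le z : `|complex.Im z| <= normc z.
Proof.
case: z => a b /=; rewrite -[`|b|]sqrtr_sqr ler_wsqrtr//.
by rewrite lerDr sqr_ge0.
Qed.

Lemma normc_le_ReIm z : normc z <= `|complex.Re z| + `|complex.Im z|.
Proof.
rewrite -[leRHS]ger0_norm ?addr_ge0// -[leRHS]sqrtr_sqr.
case: z => a b /=; rewrite ler_wsqrtr// sqrrD !real_normK ?num_real//.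
by rewrite lerD2r lerDl mulrn_wge0// mulr_ge0.
Qed.

Lemma normc_real r : normc r%:C%C = `|r|.
Proof. by rewrite /= expr0n/= addr0 sqrtr_sqr. Qed.

Lemma normc_conj z : normc (conjc z) = normc z.
Proof. by case: z => a b /=; rewrite sqrrN. Qed.

Lemma normcB_sym z w : normc (z - w) = normc (w - z).
Proof. by rewrite -normcN opprB. Qed.

Lemma normc_expi s : normc (expi s) = 1.
Proof. by rewrite /= cos2Dsin2 sqrtr1. Qed.

Lemma expiD s r : expi (s + r) = expi s * expi r.
Proof.
rewrite /expi cosD sinD; apply/eqP; rewrite eq_complex/= eqxx/=.
by rewrite addrC (mulrC (sin s)) eqxx.
Qed.

Lemma expi0 : expi (0 : R) = 1.
Proof. by rewrite /expi cos0 sin0. Qed.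

Lemma ReM z w : complex.Re (z * w) =
  complex.Re z * complex.Re w - complex.Im z * complex.Im w.
Proof. by case: z => a b; case: w. Qed.

Lemma ImM z w : complex.Im (z * w) =
  complex.Re z * complex.Im w + complex.Im z * complex.Re w.
Proof. by case: z => a b; case: w => c d /=. Qed.

Lemma ReB z w : complex.Re (z - w) = complex.Re z - complex.Re w.
Proof. by case: z => a b; case: w. Qed.

Lemma ImB z w : complex.Im (z - w) = complex.Im z - complex.Im w.
Proof. by case: z => a b; case: w. Qed.

Lemma mulc_conj z : z * conjc z = (normc z ^+ 2)%:C%C.
Proof.
rewrite normc_sqr; case: z => a b; apply/eqP; rewrite eq_complex/= !expr2.
by rewrite mulrN opprK eqxx/= mulrN mulrC addNr.
Qed.

Lemma conjcM z w : conjc (z * w) = conjc z * conjc w.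
Proof. exact: rmorphM. Qed.

Lemma conjcB z w : conjc (z - w) = conjc z - conjc w.
Proof. exact: rmorphB. Qed.

End complex_modulus.

Section complex_measurability.
Context {R : realType} d (T : measurableType d).
Implicit Types (f g : T -> R[i]) (r : T -> R).

Definition cmeasurable f :=
  measurable_fun setT (fun x => complex.Re (f x)) /\
  measurable_fun setT (fun x => complex.Im (f x)).

Lemma cmeasurableM f g : cmeasurable f -> cmeasurable g ->
  cmeasurable (fun x => f x * g x).
Proof.
move=> [rf jf] [rg jg]; split.
  under eq_fun do rewrite ReM.
  by apply: measurable_funB; exact: measurable_funM.
under eq_fun do rewrite ImM.
by apply: measurable_funD; exact: measurable_funM.
Qed.

Lemma cmeasurableB f g : cmeasurable f -> cmeasurable g ->
  cmeasurable (fun x => f x - g x).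
Proof.
move=> [rf jf] [rg jg]; split.
  by under eq_fun do rewrite ReB; exact: measurable_funB.
by under eq_fun do rewrite ImB; exact: measurable_funB.
Qed.

Lemma cmeasurable_conj f : cmeasurable f -> cmeasurable (fun x => conjc (f x)).
Proof.
move=> [rf jf]; split.
  by rewrite [X in measurable_fun _ X](_ : _ = fun x => complex.Re (f x))//;
    apply/funext => x; case: (f x).
rewrite [X in measurable_fun _ X](_ : _ = fun x => - complex.Im (f x)).
  exact: measurableT_comp.
by apply/funext => x; case: (f x).
Qed.

Lemma cmeasurable_cst (c : R[i]) : cmeasurable (fun=> c).
Proof. by split. Qed.

Lemma cmeasurable_real r : measurable_fun setT r ->
  cmeasurable (fun x => (r x)%:C%C).
Proof. by move=> mr; split. Qed.

Lemma cmeasurable_expi r : measurable_fun setT r ->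
  cmeasurable (fun x => expi (r x)).
Proof.
move=> mr; split => /=.
  exact: measurableT_comp (continuous_measurable_fun (@continuous_cos R)) mr.
exact: measurableT_comp (continuous_measurable_fun (@continuous_sin R)) mr.
Qed.

Lemma measurable_normc f : cmeasurable f ->
  measurable_fun setT (fun x => normc (f x)).
Proof.
move=> [rf jf].
rewrite (_ : (fun x => _) = fun x =>
  Num.sqrt (complex.Re (f x) ^+ 2 + complex.Im (f x) ^+ 2)).
  apply: measurableT_comp => //.
    exact: (continuous_measurable_fun (@sqrt_continuous R)).
  by apply: measurable_funD; exact: measurable_funX.
by apply/funext => x; case: (f x).
Qed.

End complex_measurability.

Lemma cmeasurable_comp {R : realType} d d' (T : measurableType d)
    (T' : measurableType d') (f : T' -> R[i]) (h : T -> T') :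
  cmeasurable f -> measurable_fun setT h -> cmeasurable (fun x => f (h x)).
Proof.
by move=> [rf jf] mh; split; [exact: measurableT_comp rf mh|
  exact: measurableT_comp jf mh].
Qed.

(** * Integrable real functions *)

Section real_integrals.
Context {R : realType} d (T : measurableType d) (mu : {measure set T -> \bar R}).
Implicit Types (f g : T -> R).

Definition rintegrable f := mu.-integrable setT (EFin \o f).

Lemma rintegrable_measurable f : rintegrable f -> measurable_fun setT f.
Proof. by move=> /integrableP[/measurable_EFinP]. Qed.

Lemma rintegral_EFin f : rintegrable f ->
  (\int[mu]_x (f x)%:E)%E = (\int[mu]_x f x)%:E.
Proof. by move=> fi; rewrite /Rintegral fineK//; exact: integrable_fin_num. Qed.

Lemma rintegrable_le f g : measurable_fun setT f -> rintegrable g ->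
  (forall x, `|f x| <= g x) -> rintegrable f.
Proof.
move=> mf gi fg.
have mf' : measurable_fun setT (EFin \o f) by exact/measurable_EFinP.
apply: (le_integrable measurableT mf' _ gi) => x _ /=.
by rewrite lee_fin (le_trans (fg x))// ler_norm.
Qed.

Lemma rintegrableD f g : rintegrable f -> rintegrable g ->
  rintegrable (fun x => f x + g x).
Proof.
move=> fi gi; rewrite /rintegrable (_ : _ \o _ = (EFin \o f) \+ (EFin \o g))%E.
  exact: integrableD.
by apply/funext => x.
Qed.

Lemma rintegrableZ (k : R) f : rintegrable f -> rintegrable (fun x => k * f x).
Proof.
move=> fi; rewrite /rintegrable.
rewrite (_ : _ \o _ = (fun x => k%:E * (EFin \o f) x)%E).
  exact: integrableZl.
by apply/funext => x.
Qed.

Lemma rintegrable_abs f : rintegrable f -> rintegrable (fun x => `|f x|).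
Proof.
by move=> fi; exact: (integrable_abse fi).
Qed.

Lemma rintegrableP f : measurable_fun setT f -> (forall x, 0 <= f x) ->
  (\int[mu]_x (f x)%:E < +oo)%E -> rintegrable f.
Proof.
move=> mf f0 h; apply/integrableP; split; first exact/measurable_EFinP.
rewrite (eq_integral (fun x => (f x)%:E))// => x _.
by rewrite /= ger0_norm.
Qed.

Lemma le_rintegral f g : rintegrable f -> rintegrable g ->
  (forall x, f x <= g x) -> \int[mu]_x f x <= \int[mu]_x g x.
Proof. by move=> fi gi fg; apply: le_Rintegral. Qed.

Lemma rintegralD f g : rintegrable f -> rintegrable g ->
  \int[mu]_x (f x + g x) = \int[mu]_x f x + \int[mu]_x g x.
Proof. by move=> fi gi; rewrite RintegralD. Qed.

Lemma rintegralZ (k : R) f : rintegrable f ->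
  \int[mu]_x (k * f x) = k * \int[mu]_x f x.
Proof. by move=> fi; rewrite RintegralZl. Qed.

Lemma rintegral_cvg0_ae (f_ : nat -> T -> R) (g : T -> R) :
  (forall k, measurable_fun setT (f_ k)) -> rintegrable g ->
  {ae mu, forall x, forall k, `|f_ k x| <= g x} ->
  {ae mu, forall x, f_ k x @[k --> \oo] --> (0 : R)} ->
  \int[mu]_x f_ k x @[k --> \oo] --> (0 : R).
Proof.
move=> mf gi fg f0.
have mf' k : measurable_fun setT (EFin \o f_ k).
  by apply/measurable_EFinP; exact: mf.
have m0 : measurable_fun setT (fun _ : T => 0%:E : \bar R) by [].
have cf : {ae mu, forall x, setT x -> (EFin \o f_ k) x @[k --> \oo] --> 0%:E}.
  by apply: filterS f0 => x fx _; apply: cvg_EFin; [exact: nearW|exact: fx].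
have bf : {ae mu, forall x k, setT x -> (`|(EFin \o f_ k) x| <= (EFin \o g) x)%E}.
  by apply: filterS fg => x fx k _; rewrite lee_fin; exact: fx.
have [_ _] := dominated_convergence measurableT mf' m0 cf gi bf.
by rewrite integral0 => /fine_cvgP[_].
Qed.

Lemma rintegral_cvg0 (f_ : nat -> T -> R) (g : T -> R) :
  (forall k, measurable_fun setT (f_ k)) -> rintegrable g ->
  (forall k x, `|f_ k x| <= g x) ->
  (forall x, f_ k x @[k --> \oo] --> (0 : R)) ->
  \int[mu]_x f_ k x @[k --> \oo] --> (0 : R).
Proof.
move=> mf gi fg f0; apply: (rintegral_cvg0_ae mf gi).
  by apply: aeW => x k; exact: fg.
by apply: aeW => x; exact: f0.
Qed.

End real_integrals.

(** * Integrable complex functions *)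

Section complex_integrals.
Context {R : realType} d (T : measurableType d) (mu : {measure set T -> \bar R}).
Implicit Types (f g : T -> R[i]).

Definition cintegrable f :=
  cmeasurable f /\ rintegrable mu (fun x => normc (f x)).

Lemma cintegrable_Re f : cintegrable f ->
  rintegrable mu (fun x => complex.Re (f x)).
Proof.
move=> [[rf _] fi]; apply: (rintegrable_le rf fi) => x; exact: normr_Re_le.
Qed.

Lemma cintegrable_Im f : cintegrable f ->
  rintegrable mu (fun x => complex.Im (f x)).
Proof.
move=> [[_ jf] fi]; apply: (rintegrable_le jf fi) => x; exact: normr_Im_le.
Qed.

Lemma cintegrable_le f (g : T -> R) : cmeasurable f -> rintegrable mu g ->
  (forall x, normc (f x) <= g x) -> cintegrable f.
Proof.
move=> mf gi fg; split => //; apply: rintegrable_le gi _ => //.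
  exact: measurable_normc.
by move=> x; rewrite ger0_norm ?normc_ge0.
Qed.

Lemma cintegrable_ReIm f :
  rintegrable mu (fun x => complex.Re (f x)) ->
  rintegrable mu (fun x => complex.Im (f x)) -> cintegrable f.
Proof.
move=> rf jf; apply: (cintegrable_le (g := fun x =>
    `|complex.Re (f x)| + `|complex.Im (f x)|)).
- by split; [exact: rintegrable_measurable rf|exact: rintegrable_measurable jf].
- by apply: rintegrableD; exact: rintegrable_abs.
- by move=> x; exact: normc_le_ReIm.
Qed.

Lemma cintegrable_real (r : T -> R) : rintegrable mu r ->
  cintegrable (fun x => (r x)%:C%C).
Proof.
move=> ri; apply: (cintegrable_le _ (rintegrable_abs ri)).
  by apply: cmeasurable_real; exact: rintegrable_measurable ri.
by move=> x; rewrite normc_real.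
Qed.

Lemma cintegrableZ (c : R[i]) f : cintegrable f ->
  cintegrable (fun x => c * f x).
Proof.
move=> [mf fi]; apply: (cintegrable_le _ (rintegrableZ (normc c) fi)).
  by apply: cmeasurableM => //; exact: cmeasurable_cst.
by move=> x; rewrite Normc.normcM.
Qed.

Lemma cintegrableB f g : cintegrable f -> cintegrable g ->
  cintegrable (fun x => f x - g x).
Proof.
move=> [mf fi] [mg gi]; apply: (cintegrable_le _ (rintegrableD fi gi)).
  exact: cmeasurableB.
by move=> x; rewrite (le_trans (le_normcD _ _))// normcN.
Qed.

Lemma cintegralB f g : cintegrable f -> cintegrable g ->
  cintegral mu (fun x => f x - g x) = cintegral mu f - cintegral mu g.
Proof.
move=> fi gi; apply/eqP; rewrite eq_complex/=; apply/andP; split; apply/eqP.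
  under eq_Rintegral do rewrite ReB.
  by rewrite RintegralB//; exact: cintegrable_Re.
under eq_Rintegral do rewrite ImB.
by rewrite RintegralB//; exact: cintegrable_Im.
Qed.

Lemma cintegralZ (c : R[i]) f : cintegrable f ->
  cintegral mu (fun x => c * f x) = c * cintegral mu f.
Proof.
move=> fi; have rf := cintegrable_Re fi; have jf := cintegrable_Im fi.
apply/eqP; rewrite eq_complex; apply/andP; split; apply/eqP.
  rewrite ReM/=; under eq_Rintegral do rewrite ReM.
  rewrite RintegralB//; last 2 first.
  - exact: rintegrableZ.
  - exact: rintegrableZ.
  by rewrite !rintegralZ.
rewrite ImM/=; under eq_Rintegral do rewrite ImM.
rewrite RintegralD//; last 2 first.
- exact: rintegrableZ.
- exact: rintegrableZ.
by rewrite !rintegralZ.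
Qed.

Lemma cintegral_real (r : T -> R) :
  cintegral mu (fun x => (r x)%:C%C) = (\int[mu]_x r x)%:C%C.
Proof.
apply/eqP; rewrite eq_complex/= eqxx/=; apply/eqP.
by rewrite Rintegral_cst// mul0r.
Qed.

Lemma cintegral_conj f : cintegrable f ->
  cintegral mu (fun x => conjc (f x)) = conjc (cintegral mu f).
Proof.
move=> fi; rewrite /cintegral/=; congr Complex.
  by apply: eq_Rintegral => x _; case: (f x).
rewrite -mulN1r -rintegralZ; last exact: cintegrable_Im.
by apply: eq_Rintegral => x _; rewrite mulN1r; case: (f x).
Qed.

Lemma eq_cintegral f g : (forall x, f x = g x) ->
  cintegral mu f = cintegral mu g.
Proof. by move=> /funext ->. Qed.

(** Rotating the integral to the positive real axis reduces the complex
    triangle inequality to the real one. *)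
Lemma le_normc_cintegral f : cintegrable f ->
  normc (cintegral mu f) <= \int[mu]_x normc (f x).
Proof.
move=> fi; set z := cintegral mu f.
have := normc_ge0 z; rewrite le_eqVlt => /predU1P[<-|z0].
  by apply: Rintegral_ge0 => x _; exact: normc_ge0.
rewrite -(ler_pM2l z0) -rintegralZ; last by case: fi.
have -> : normc z * normc z = complex.Re (cintegral mu (fun x => conjc z * f x)).
  by rewrite cintegralZ// -/z (mulrC (conjc z)) mulc_conj [RHS]/= expr2.
have zi := cintegrableZ (conjc z) fi.
apply: le_rintegral; first exact: cintegrable_Re.
  by apply: rintegrableZ; case: fi.
move=> x; rewrite -(normc_conj z) -Normc.normcM.
by rewrite (le_trans (ler_norm _))// normr_Re_le.
Qed.

End complex_integrals.

Section complex_limits.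
Context {R : realType}.

Definition ccvg (u : nat -> R[i]) (l : R[i]) :=
  normc (u k - l) @[k --> \oo] --> (0 : R).

(** Dominated convergence, reduced to the real case through the modulus of the
    difference. *)
Lemma cintegral_cvg d (T : measurableType d) (mu : {measure set T -> \bar R})
    (f_ : nat -> T -> R[i]) (f : T -> R[i]) (g : T -> R) :
  (forall k, cmeasurable (f_ k)) -> cmeasurable f -> rintegrable mu g ->
  (forall k x, normc (f_ k x) <= g x) -> (forall x, normc (f x) <= g x) ->
  (forall x, ccvg (f_ ^~ x) (f x)) ->
  ccvg (fun k => cintegral mu (f_ k)) (cintegral mu f).
Proof.
move=> mf_ mf gi fg_ fg fc.
have fi := cintegrable_le mf gi fg.
have fi_ k := cintegrable_le (mf_ k) gi (fg_ k).
apply: (@squeeze_cvgr _ _ _ _ (cst 0) (fun k => \int[mu]_x normc (f_ k x - f x))).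
- apply: nearW => k; apply/andP; split; first exact: normc_ge0.
  rewrite -cintegralB//.
  by apply: le_normc_cintegral; exact: cintegrableB.
- exact: cvg_cst.
apply: (rintegral_cvg0 (g := fun x => g x + g x)).
- by move=> k; apply: measurable_normc; exact: cmeasurableB.
- exact: rintegrableD.
- move=> k x; rewrite ger0_norm ?normc_ge0// (le_trans (le_normcD _ _))//.
  by rewrite normcN lerD.
- exact: fc.
Qed.

End complex_limits.

(** * Change of variables and Fubini's theorem *)

Section change_of_variables.
Context {R : realType} d1 d2 (T1 : measurableType d1) (T2 : measurableType d2)
  (m1 : {measure set T1 -> \bar R}) (m2 : {measure set T2 -> \bar R})
  (k : R) (h : T1 -> T2) (kh : scales_measure k m1 m2 h).

Lemma rintegrable_scales (F : T2 -> R) : measurable_fun setT F ->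
  rintegrable m1 (fun x => F (h x)) <-> rintegrable m2 F.
Proof.
move=> mF; apply: (integrable_scales kh (F := EFin \o F)).
exact/measurable_EFinP.
Qed.

Lemma rintegral_scales (F : T2 -> R) : rintegrable m2 F ->
  \int[m1]_x F (h x) = k * \int[m2]_y F y.
Proof.
move=> Fi; apply: EFin_inj; rewrite EFinM -!rintegral_EFin//.
  exact: (integral_scales kh (F := EFin \o F)).
exact/(rintegrable_scales (rintegrable_measurable Fi)).
Qed.

Lemma cintegrable_scales (F : T2 -> R[i]) : cmeasurable F ->
  cintegrable m1 (fun x => F (h x)) <-> cintegrable m2 F.
Proof.
move=> mF; have mh : measurable_fun setT h by case: kh.
split=> -[_ i]; split => //.
- by apply/rintegrable_scales => //; exact: measurable_normc.
- exact: cmeasurable_comp.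
- by apply/(rintegrable_scales (F := fun y => normc (F y))) => //; exact: measurable_normc.
Qed.

Lemma cintegral_scales (F : T2 -> R[i]) : cintegrable m2 F ->
  cintegral m1 (fun x => F (h x)) = k%:C%C * cintegral m2 F.
Proof.
move=> Fi; have rF := cintegrable_Re Fi; have jF := cintegrable_Im Fi.
apply/eqP; rewrite eq_complex ReM ImM/= !mul0r subr0 addr0.
by rewrite (rintegral_scales rF) (rintegral_scales jF) !eqxx.
Qed.

End change_of_variables.

(** An integrable extended real function is finite almost everywhere, so that
    partial integrals, which are extended real a priori, may be replaced by real
    ones. *)
Lemma rintegrable_fine {R : realType} d (T : measurableType d) (m : {measure set T -> \bar R})
    (F : T -> \bar R) : m.-integrable setT F ->
  rintegrable m (fine \o F) /\ (\int[m]_x F x)%E = (\int[m]_x fine (F x))%:E.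
Proof.
move=> iF; have mF := measurable_int _ iF.
have mfF : measurable_fun setT (fine \o F) by exact: measurableT_comp.
have ifF : rintegrable m (fine \o F).
  apply: (le_integrable measurableT _ _ iF); first exact/measurable_EFinP.
  by move=> x _ /=; case: (F x) => [r||] //=; exact: leey.
split => //; rewrite -rintegral_EFin//.
apply: ae_eq_integral => //; first exact/measurable_EFinP.
have := integrable_ae measurableT iF; apply: filterS => x h xT.
by rewrite /= fineK//; exact: h.
Qed.

Lemma rintegral_fubini1 {R : realType} d1 d2 (T1 : measurableType d1)
  (T2 : measurableType d2) (m1 : {sigma_finite_measure set T1 -> \bar R})
  (m2 : {sigma_finite_measure set T2 -> \bar R}) (f : T1 * T2 -> R) : rintegrable (m1 \X m2)%E f ->
  rintegrable m1 (fun x => \int[m2]_y f (x, y)) /\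
  \int[m1]_x \int[m2]_y f (x, y) = \int[(m1 \X m2)%E]_z f z.
Proof.
move=> fi; have iF := integrable_fubini_F fi.
have [h1 h2] := rintegrable_fine iF; split; first exact: h1.
have E := integral12_prod_meas1 fi.
by apply: EFin_inj; rewrite -[LHS]h2 E -rintegral_EFin.
Qed.

Section fubini.
Context {R : realType} d1 d2 (T1 : measurableType d1) (T2 : measurableType d2)
  (m1 : {sigma_finite_measure set T1 -> \bar R})
  (m2 : {sigma_finite_measure set T2 -> \bar R}).

Local Notation m12 := (m1 \X m2)%E.

Lemma rintegral_fubini2 (f : T1 * T2 -> R) : rintegrable m12 f ->
  rintegrable m2 (fun y => \int[m1]_x f (x, y)) /\
  \int[m2]_y \int[m1]_x f (x, y) = \int[(m1 \X m2)%E]_z f z.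
Proof.
move=> fi; have mf := rintegrable_measurable fi.
have sw := scales_swap m2 m1.
have fsi : rintegrable (m2 \X m1)%E (fun z => f (prod_swap z)).
  exact/(rintegrable_scales sw).
have := rintegral_fubini1 fsi.
by rewrite (rintegral_scales sw fi) mul1r.
Qed.

Lemma cintegral_fubini1 (f : T1 * T2 -> R[i]) : cintegrable m12 f ->
  cintegrable m1 (fun x => cintegral m2 (fun y => f (x, y))) /\
  cintegral m1 (fun x => cintegral m2 (fun y => f (x, y))) = cintegral m12 f.
Proof.
move=> fi; have [ri re] := rintegral_fubini1 (cintegrable_Re fi).
have [ji je] := rintegral_fubini1 (cintegrable_Im fi).
by split; [exact: cintegrable_ReIm|rewrite /cintegral/= re je].
Qed.

Lemma rintegrable_prod_le (f : T1 * T2 -> R) (g : T1 -> R) :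
  measurable_fun setT f -> (forall z, 0 <= f z) -> rintegrable m1 g ->
  (forall x, (\int[m2]_y (f (x, y))%:E <= (g x)%:E)%E) ->
  rintegrable m12 f.
Proof.
move=> mf f0 gi fg; apply: rintegrableP => //.
have mf' : measurable_fun setT (EFin \o f) by exact/measurable_EFinP.
rewrite (tonelli1 m1 m2 (EFin \o f))//.
apply: (@le_lt_trans _ _ (\int[m1]_x (g x)%:E)%E); last first.
  by rewrite rintegral_EFin// ltry.
apply: ge0_le_integral => //.
- by move=> x _; apply: integral_ge0 => y _; rewrite lee_fin.
- exact: (measurable_tonelli1 m2 (EFin \o f)).
- by apply/measurable_EFinP; exact: rintegrable_measurable gi.
- by move=> x _; exact: fg.
Qed.

Lemma rintegrable_tensor (f : T1 -> R) (g : T2 -> R) :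
  rintegrable m1 f -> rintegrable m2 g ->
  rintegrable m12 (fun z => f z.1 * g z.2).
Proof.
move=> fi gi.
have mf := rintegrable_measurable fi; have mg := rintegrable_measurable gi.
have mfg : measurable_fun setT (fun z : T1 * T2 => f z.1 * g z.2).
  by apply: measurable_funM; apply: measurableT_comp.
apply: (rintegrable_le (g := fun z => `|f z.1| * `|g z.2|)) => //; last first.
  by move=> z; rewrite normrM.
apply: (rintegrable_prod_le (g := fun x => (\int[m2]_y `|g y|) * `|f x|)).
- by apply: measurable_funM; apply: measurableT_comp => //;
    apply: measurableT_comp.
- by move=> z; rewrite mulr_ge0.
- by apply: rintegrableZ; exact: rintegrable_abs.
- move=> x; have gi' := rintegrable_abs gi.
  rewrite [leLHS]/= (rintegral_EFin (rintegrableZ `|f x| gi')).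
  by rewrite (rintegralZ _ gi') mulrC lexx.
Qed.

Lemma rintegral_tensor (f : T1 -> R) (g : T2 -> R) :
  rintegrable m1 f -> rintegrable m2 g ->
  \int[(m1 \X m2)%E]_z (f z.1 * g z.2) = \int[m1]_x f x * \int[m2]_y g y.
Proof.
move=> fi gi.
have [_ <-] := rintegral_fubini1 (rintegrable_tensor fi gi).
rewrite mulrC -rintegralZ//; apply: eq_Rintegral => x _.
by rewrite [LHS](rintegralZ (f x) gi) mulrC.
Qed.

Lemma cintegrable_tensor (f : T1 -> R[i]) (g : T2 -> R[i]) :
  cintegrable m1 f -> cintegrable m2 g ->
  cintegrable m12 (fun z => f z.1 * g z.2).
Proof.
move=> [mf fi] [mg gi]; apply: (cintegrable_le _ (rintegrable_tensor fi gi)).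
  apply: cmeasurableM.
    exact: cmeasurable_comp mf measurable_fst.
  exact: cmeasurable_comp mg measurable_snd.
by move=> z; rewrite Normc.normcM.
Qed.

Lemma cintegral_tensor (f : T1 -> R[i]) (g : T2 -> R[i]) :
  cintegrable m1 f -> cintegrable m2 g ->
  cintegral m12 (fun z => f z.1 * g z.2) = cintegral m1 f * cintegral m2 g.
Proof.
move=> fi gi.
have [_ <-] := cintegral_fubini1 (cintegrable_tensor fi gi).
rewrite mulrC -cintegralZ//; apply: eq_cintegral => x.
by rewrite [LHS](cintegralZ (f x) gi) mulrC.
Qed.

End fubini.

(** * Affine maps of Euclidean space *)

Section affine_line.
Context {R : realType}.
Local Notation leb := (@lebesgue_measure R).

Lemma measurable_affine_line (c h : R) :
  measurable_fun setT (fun x : measurableTypeR R => c * x + h : measurableTypeR R).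
Proof. by apply: measurable_funD => //; exact: measurable_funM. Qed.

Lemma affine_preimage_pos (c h a b : R) : 0 < c ->
  (fun x => c * x + h) @^-1` `]a, b] = `](a - h) / c, (b - h) / c]%classic.
Proof.
move=> c0; apply/seteqP; split => x /=; rewrite !in_itv/= => /andP[ax xb].
  by rewrite ltr_pdivrMr// ler_pdivlMr// ltrBlDr lerBrDr mulrC ax.
move: ax xb; rewrite ltr_pdivrMr// ler_pdivlMr// ltrBlDr lerBrDr mulrC.
by move=> -> ->.
Qed.

Lemma affine_preimage_neg (c h a b : R) : c < 0 ->
  (fun x => c * x + h) @^-1` `]a, b] = `[(b - h) / c, (a - h) / c[%classic.
Proof.
move=> c0; apply/seteqP; split => x /=; rewrite !in_itv/= => /andP[ax xb].
  by rewrite ltr_ndivlMr// ler_ndivrMr// ltrBlDr lerBrDr mulrC ax xb.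
move: ax xb; rewrite ltr_ndivlMr// ler_ndivrMr// ltrBlDr lerBrDr mulrC.
by move=> -> ->.
Qed.

Lemma scales_affine_line (c h : R) : c != 0 ->
  scales_measure `|c|^-1 leb leb
    (fun x : measurableTypeR R => c * x + h : measurableTypeR R).
Proof.
move=> c0; have mf := measurable_affine_line c h.
have c'0 : 0 < `|c| by rewrite normr_gt0.
split; [by rewrite invr_gt0|exact: mf|move=> A mA].
pose f (x : measurableTypeR R) : measurableTypeR R := c * x + h.
pose nu := mscale (NngNum (normr_ge0 c)) (pushforward leb f).
have E : leb A = nu mf A.
  apply: lebesgue_measure_unique => //= _ [[a b] _ <-].
  rewrite /nu /mscale/= /pushforward/=.
  move: c0; rewrite neq_lt => /orP[c0|c0].
    have -> : f @^-1` `]a, b] = _ := affine_preimage_neg h a b c0.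
    rewrite !lebesgue_measure_itv/= !lte_fin.
    rewrite (ltr_ndivrMr _ _ c0) divfK ?lt_eqF// ltrD2r.
    case: ifPn => ab; last by rewrite mule0.
    rewrite -!EFinD -EFinM ltr0_norm//; congr EFin.
    by field; rewrite lt_eqF.
  have -> : f @^-1` `]a, b] = _ := affine_preimage_pos h a b c0.
  rewrite !lebesgue_measure_itv/= !lte_fin.
  rewrite (ltr_pdivrMr _ _ c0) divfK ?gt_eqF// ltrD2r.
  case: ifPn => ab; last by rewrite mule0.
  rewrite -!EFinD -EFinM gtr0_norm//; congr EFin.
  by field; rewrite gt_eqF.
by rewrite E /nu /mscale/= /pushforward/= muleA -EFinM mulVf ?mul1e// gt_eqF.
Qed.

End affine_line.

Section rV_measurability.
Context {R : realType} d (T : measurableType d) (n : nat).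
Implicit Types f g : T -> 'rV[R]_n.

Lemma measurable_rV_coord f i : measurable_fun setT f ->
  measurable_fun setT (fun x => f x ord0 i : measurableTypeR R).
Proof. by move=> mf; exact: measurableT_comp (measurable_coord_rV i) mf. Qed.

Lemma measurable_rVD f g : measurable_fun setT f -> measurable_fun setT g ->
  measurable_fun setT (fun x => f x + g x).
Proof.
move=> mf mg; apply: measurable_fun_rVP => i; under eq_fun do rewrite mxE.
by apply: measurable_funD; exact: measurable_rV_coord.
Qed.

Lemma measurable_rVZ (c : R) f : measurable_fun setT f ->
  measurable_fun setT (fun x => c *: f x).
Proof.
move=> mf; apply: measurable_fun_rVP => i; under eq_fun do rewrite mxE.
by apply: measurable_funM => //; exact: measurable_rV_coord.
Qed.

Lemma measurable_rVN f : measurable_fun setT f ->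
  measurable_fun setT (fun x => - f x).
Proof.
move=> mf; apply: measurable_fun_rVP => i; under eq_fun do rewrite mxE.
by apply: measurableT_comp => //; exact: measurable_rV_coord.
Qed.

Lemma measurable_rVB f g : measurable_fun setT f -> measurable_fun setT g ->
  measurable_fun setT (fun x => f x - g x).
Proof. by move=> mf mg; apply: measurable_rVD => //; exact: measurable_rVN. Qed.

Lemma measurable_dotr f g : measurable_fun setT f -> measurable_fun setT g ->
  measurable_fun setT (fun x => dotr (f x) (g x)).
Proof.
move=> mf mg; apply: measurable_sum => i.
by apply: measurable_funM; exact: measurable_rV_coord.
Qed.

End rV_measurability.

Section affine_space.
Context {R : realType}.
Local Notation leb := (@lebesgue_measure R).
Local Notation lebn := (@lebesgue_rV R).

Lemma scales_cons_rV n :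
  scales_measure 1 (leb \X lebn n)%E (lebn n.+1) (@cons_rV R n).
Proof. by split => //; [exact: measurable_cons_rV|move=> A mA; rewrite mul1e]. Qed.

Lemma scales_uncons_rV n :
  scales_measure 1 (lebn n.+1) (leb \X lebn n)%E (@uncons_rV R n).
Proof.
split => //; first exact: measurable_uncons_rV.
move=> A mA; rewrite mul1e.
rewrite -[LHS]/((leb \X lebn n)%E (@cons_rV R n @^-1` (@uncons_rV R n @^-1` A))).
by congr (_ _); apply/funext => z; rewrite /preimage/= cons_rVK.
Qed.

(** Induction on the dimension: in the coordinates [cons_rV] the map is the
    product of an affine map of the line and one of lower dimension. *)
Lemma scales_affine n (c : R) (h : 'rV[R]_n) : c != 0 ->
  scales_measure (`|c|^-1 ^+ n) (lebn n) (lebn n) (fun x => c *: x + h).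
Proof.
move=> c0; elim: n h => [|n IH] h.
  rewrite expr0 (_ : (fun x => _) = id); first exact: scales_id.
  by apply/funext => x; apply/rowP => -[].
have H := scales_comp (scales_comp (scales_uncons_rV n)
  (scales_prod (scales_affine_line (h ord0 ord0) c0) (IH (uncons_rV h).2)))
  (scales_cons_rV n).
move: H; rewrite mul1r mulr1 -exprS; congr (scales_measure _ _ _ _).
apply/funext => x; apply/rowP => i; rewrite /comp.
case: (unliftP ord0 i) => [j|] ->.
  by rewrite cons_rVS !mxE.
by rewrite cons_rV0 /= !mxE.
Qed.

Lemma scales_translation n (h : 'rV[R]_n) :
  scales_measure 1 (lebn n) (lebn n) (fun x => x + h).
Proof.
have := scales_affine h (oner_neq0 R); rewrite normr1 invr1 expr1n.
by congr (scales_measure _ _ _ _); apply/funext => x; rewrite scale1r.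
Qed.

Lemma scales_opp n (h : 'rV[R]_n) :
  scales_measure 1 (lebn n) (lebn n) (fun x => h - x).
Proof.
have := scales_affine h (ltr0_neq0 (ltrN10 R)).
rewrite normrN1 invr1 expr1n.
by congr (scales_measure _ _ _ _); apply/funext => x; rewrite scaleN1r addrC.
Qed.

Lemma scales_homothety n (c : R) : 0 < c ->
  scales_measure (c^-1 ^+ n) (lebn n) (lebn n) (fun x => c *: x).
Proof.
move=> c0; have := scales_affine (0 : 'rV[R]_n) (lt0r_neq0 c0).
rewrite gtr0_norm//.
by congr (scales_measure _ _ _ _); apply/funext => x; rewrite addr0.
Qed.

End affine_space.

(** * The tent function and the Fejer kernel *)

Section tent.
Context {R : realType}.
Local Notation leb := (@lebesgue_measure R).
Implicit Types (a x xi : R).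

Lemma rintegral_segment (f F : R -> R) (p q : R) : p < q -> continuous f ->
  (forall x, is_derive x 1 F (f x)) ->
  rintegrable leb (fun x => f x * \1_`[p, q] x) /\
  \int[leb]_x (f x * \1_`[p, q] x) = F q - F p.
Proof.
move=> pq cf dF.
have E : (fun x => f x * \1_`[p, q] x) = f \_ `[p, q].
  apply/funext => x; rewrite patchE indicE.
  by case: ifP => _; rewrite ?mulr1 ?mulr0.
have cF : continuous F.
  by move=> x; apply/differentiable_continuous/derivable1_diffP/(@ex_derive _ _ _ _ _ _ _ (dF x)).
rewrite E; split.
  rewrite /rintegrable -restrict_EFin; apply/integrable_restrict => //.
  rewrite setTI; apply: continuous_compact_integrable; first exact: segment_compact.
  exact: continuous_subspaceT.
rewrite -Rintegral_mkcond /Rintegral (@continuous_FTC2 _ _ F)//.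
- exact: continuous_subspaceT.
- split.
  + by move=> x _; exact: (@ex_derive _ _ _ _ _ _ _ (dF x)).
  + by apply: cvg_at_right_filter; exact: cF.
  + by apply: cvg_at_left_filter; exact: cF.
- by move=> x _; rewrite derive1E; exact: (@derive_val _ _ _ _ _ _ _ (dF x)).
Qed.

(** A cutoff with compact support and values between 0 and 1 whose Fourier
    transform is nonnegative and integrable. *)
Definition tent x : R := Num.max 0 (1 - `|x|).

Lemma tent_ge0 x : 0 <= tent x.
Proof. by rewrite /tent le_max lexx. Qed.

Lemma tent_le1 x : tent x <= 1.
Proof. by rewrite /tent ge_max ler01/= gerBl. Qed.

Lemma tentN x : tent (- x) = tent x.
Proof. by rewrite /tent normrN. Qed.

Lemma tent0 : tent 0 = 1.
Proof. by rewrite /tent normr0 subr0 max_r. Qed.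

Lemma continuous_tent : continuous tent.
Proof.
have -> : tent = (fun x => (0 + (1 - `|x|) + `|0 - (1 - `|x|)|) / 2).
  by apply/funext => x; rewrite /tent maxr_absE.
have c1 : continuous (fun x : R => 1 - `|x|).
  by move=> x; apply: cvgB; [exact: cvg_cst|exact: norm_continuous].
have c2 : continuous (fun x : R => 0 - (1 - `|x|)).
  by move=> x; apply: cvgB; [exact: cvg_cst|exact: c1].
move=> x; apply: cvgM; last exact: cvg_cst.
apply: cvgD; first by apply: cvgD; [exact: cvg_cst|exact: c1].
exact: (continuous_comp (c2 x) (@norm_continuous _ _ _)).
Qed.

Lemma measurable_tent : measurable_fun setT (tent : measurableTypeR R -> measurableTypeR R).
Proof. exact: continuous_measurable_fun continuous_tent. Qed.

(* The two pieces overlap at 0, so [tent] is only almost everywhere their sum. *)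
Lemma tentE x : tent x = (1 - x) * \1_`[0, 1] x + (1 + x) * \1_`[-1, 0] x - \1_[set 0] x.
Proof.
rewrite /tent !indicE !mem_setE !in_itv/= in_set1.
have [x0|x0|->] := ltgtP x 0.
- rewrite ltr0_norm// opprK /= andbT; have [h|h] := leP (-1) x.
    rewrite max_r; last lra.
    by rewrite /= mulr0 mulr1 add0r subr0.
  rewrite max_l; last lra.
  by rewrite /= !mulr0 addr0 subr0.
- rewrite gtr0_norm//= andbF mulr0 addr0 subr0; have [h|h] := leP x 1.
    by rewrite max_r ?mulr1//; lra.
  by rewrite max_l ?mulr0//; lra.
- rewrite normr0 ler01 lerN10 /= subr0 max_r//.
  lra.
Qed.

Lemma rintegral_tent (h F G : R -> R) : continuous h ->
  (forall x, is_derive x 1 F ((1 - x) * h x)) ->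
  (forall x, is_derive x 1 G ((1 + x) * h x)) ->
  rintegrable leb (fun x => tent x * h x) /\
  \int[leb]_x (tent x * h x) = F 1 - F 0 + (G 0 - G (- 1)).
Proof.
move=> ch dF dG.
have c1 : continuous (fun x : R => (1 - x) * h x).
  move=> x; apply: cvgM; last exact: ch.
  by apply: cvgB; [exact: cvg_cst|exact: cvg_id].
have c2 : continuous (fun x : R => (1 + x) * h x).
  move=> x; apply: cvgM; last exact: ch.
  by apply: cvgD; [exact: cvg_cst|exact: cvg_id].
have [i1 e1] := rintegral_segment ltr01 c1 dF.
have [i2 e2] := rintegral_segment (ltrN10 R) c2 dG.
have E x : tent x * h x = ((1 - x) * h x * \1_`[0, 1] x + (1 + x) * h x * \1_`[-1, 0] x)
   - h x * \1_[set 0] x.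
  by rewrite tentE; ring.
have i3 : rintegrable leb (fun x => h x * \1_[set (0 : R)] x).
  rewrite /rintegrable (_ : (_ \o _) = (EFin \o (fun x => h x)) \_ [set (0:R)]); last first.
    apply/funext => x; rewrite patchE/= indicE.
    by case: ifP => _; rewrite ?mulr1 ?mulr0.
  apply/integrable_restrict => //; rewrite setTI.
  apply: continuous_compact_integrable; first exact: compact_set1.
  exact: continuous_subspaceT.
have e3 : \int[leb]_x (h x * \1_[set (0 : R)] x) = 0.
  rewrite (_ : (fun x => _) = h \_ [set (0:R)]); last first.
    apply/funext => x; rewrite patchE/= indicE.
    by case: ifP => _; rewrite ?mulr1 ?mulr0.
  by rewrite -Rintegral_mkcond Rintegral_set1.
split.
  rewrite (_ : (fun x => _) = fun x => ((1 - x) * h x * \1_`[0, 1] x +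
      (1 + x) * h x * \1_`[-1, 0] x) + -1 * (h x * \1_[set 0] x)).
    by apply: rintegrableD; [exact: rintegrableD|exact: rintegrableZ].
  by apply/funext => x; rewrite E mulN1r.
under eq_Rintegral do rewrite E.
by rewrite RintegralB// ?RintegralD// ?e1 ?e2 ?e3 ?subr0//; exact: rintegrableD.
Qed.

Lemma rintegrable_tent : rintegrable leb tent /\ \int[leb]_x tent x = 1.
Proof.
have dF x : is_derive x 1 (fun x : R => x - x ^+ 2 / 2) ((1 - x) * (cst 1 x)).
  apply: is_derive_eq; rewrite /cst /GRing.scale/=; lra.
have dG x : is_derive x 1 (fun x : R => x + x ^+ 2 / 2) ((1 + x) * (cst 1 x)).
  apply: is_derive_eq; rewrite /cst /GRing.scale/=; lra.
have c1 : continuous (cst 1 : R -> R) by move=> x; exact: cvg_cst.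
have [] := rintegral_tent c1 dF dG.
rewrite (_ : (fun x => _) = tent); last first.
  by apply/funext => x; rewrite /cst mulr1.
by move=> ? ->; split => //; lra.
Qed.

Lemma measurable_cosM a : measurable_fun setT
  (fun x : measurableTypeR R => cos (a * x) : measurableTypeR R).
Proof.
apply: measurableT_comp (continuous_measurable_fun (@continuous_cos R)) _.
exact: measurable_funM.
Qed.

Lemma measurable_sinM a : measurable_fun setT
  (fun x : measurableTypeR R => sin (a * x) : measurableTypeR R).
Proof.
apply: measurableT_comp (continuous_measurable_fun (@continuous_sin R)) _.
exact: measurable_funM.
Qed.

Lemma rintegrable_tentM (h : R -> R) :
  measurable_fun setT (h : measurableTypeR R -> measurableTypeR R) ->
  (forall x, `|h x| <= 1) -> rintegrable leb (fun x => tent x * h x).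
Proof.
move=> mh h1; have [ti _] := rintegrable_tent.
apply: (rintegrable_le _ ti).
  by apply: measurable_funM => //; exact: measurable_tent.
by move=> x; rewrite normrM (ger0_norm (tent_ge0 x)) ler_piMr ?tent_ge0.
Qed.

Lemma rintegral_tent_cos a : a != 0 ->
  \int[leb]_x (tent x * cos (a * x)) = 2 * (1 - cos a) / a ^+ 2.
Proof.
move=> a0; have cc : continuous (fun x : R => cos (a * x)).
  move=> x; apply: (@continuous_comp _ _ _ (fun x : R => a * x) (@cos R)).
    by apply: cvgM; [exact: cvg_cst|exact: cvg_id].
  exact: continuous_cos.
have dF x : is_derive x 1
    (fun x : R => (1 - x) * sin (a * x) / a - cos (a * x) / a ^+ 2)
    ((1 - x) * cos (a * x)).
  by apply: is_derive_eq; rewrite /GRing.scale/=; field.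
have dG x : is_derive x 1
    (fun x : R => (1 + x) * sin (a * x) / a + cos (a * x) / a ^+ 2)
    ((1 + x) * cos (a * x)).
  by apply: is_derive_eq; rewrite /GRing.scale/=; field.
have [_ ->] := rintegral_tent cc dF dG.
by rewrite !mulr0 mulrN1 mulr1 sin0 cosN cos0; field.
Qed.

(** The Fourier transform of [tent], written as a cosine integral because [tent]
    is even; up to scaling it is the square of the cardinal sine. *)
Definition fejer xi := \int[leb]_x (tent x * cos (2 * pi * xi * x)).

Lemma rintegrable_tent_cos a : rintegrable leb (fun x => tent x * cos (a * x)).
Proof.
apply: rintegrable_tentM; first exact: measurable_cosM.
by move=> x; exact: cos_max.
Qed.

Lemma fejer0 : fejer 0 = 1.
Proof.
rewrite /fejer; have [_ <-] := rintegrable_tent.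
by apply: eq_Rintegral => x _; rewrite mulr0 mul0r cos0 mulr1.
Qed.

Lemma fejerE xi : xi != 0 ->
  fejer xi = 2 * (1 - cos (2 * pi * xi)) / (2 * pi * xi) ^+ 2.
Proof.
move=> x0; rewrite /fejer rintegral_tent_cos// !mulf_neq0//.
by rewrite gt_eqF ?pi_gt0.
Qed.

Lemma fejer_ge0 xi : 0 <= fejer xi.
Proof.
have [->|x0] := eqVneq xi 0; first by rewrite fejer0.
by rewrite fejerE// divr_ge0 ?sqr_ge0// mulr_ge0// subr_ge0 cos_le1.
Qed.

Lemma fejer_le1 xi : fejer xi <= 1.
Proof.
have [ti <-] := rintegrable_tent; apply: le_rintegral => //.
  exact: rintegrable_tent_cos.
by move=> x; rewrite ler_piMr ?tent_ge0// cos_le1.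
Qed.

Lemma fejerN xi : fejer (- xi) = fejer xi.
Proof. by apply: eq_Rintegral => x _; rewrite mulrN mulNr cosN. Qed.

(** Decay of the Fejer kernel, in a form without singularity at 0 whose
    right-hand side is twice the derivative of the arctangent. *)
Lemma fejer_le xi : fejer xi <= 2 * (1 + xi ^+ 2)^-1.
Proof.
have p0 : 0 < 1 + xi ^+ 2 by rewrite ltr_pwDl// sqr_ge0.
rewrite -ler_pdivrMr ?invr_gt0// invrK mulrDr mulr1.
have [->|x0] := eqVneq xi 0; first by rewrite expr0n/= mulr0 addr0 fejer0 ler1n.
rewrite (_ : 2 = 1 + 1)// lerD ?fejer_le1// fejerE//.
have pi1 : 1 <= (pi : R) by rewrite (le_trans _ (pi_ge2 R))// ler1n.
have pi0 : (pi : R) != 0 by rewrite gt_eqF ?pi_gt0.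
have aux (p c : R) : p != 0 ->
    2 * (1 - c) / (2 * p * xi) ^+ 2 * xi ^+ 2 = (1 - c) / (2 * p ^+ 2).
  by move=> p1; field; rewrite p1 x0.
rewrite aux//.
rewrite ler_pdivrMr ?mulr_gt0 ?exprn_gt0 ?pi_gt0// mul1r.
have := cos_geN1 (2 * pi * xi); have : 1 <= (pi : R) ^+ 2 by rewrite exprn_ege1.
lra.
Qed.

(** Tonelli's theorem gives the measurability of parametric integrals of
    nonnegative functions, so [tent] is added to the integrand and its integral
    subtracted again. *)
Lemma measurable_fejer :
  measurable_fun setT (fejer : measurableTypeR R -> measurableTypeR R).
Proof.
pose g (z : measurableTypeR R * measurableTypeR R) : \bar R :=
  (tent z.1 * cos (2 * pi * z.2 * z.1) + tent z.1)%:E.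
have mt : measurable_fun setT (fun z : measurableTypeR R * measurableTypeR R =>
    tent z.1 : measurableTypeR R).
  by apply: measurableT_comp measurable_tent _.
have mg : measurable_fun setT g.
  apply/measurable_EFinP; apply: measurable_funD => //.
  apply: measurable_funM => //.
  apply: measurableT_comp (continuous_measurable_fun (@continuous_cos R)) _.
  by apply: measurable_funM => //; exact: measurable_funM.
have g0 z : (0 <= g z)%E.
  rewrite lee_fin -[X in _ + X]mulr1 -mulrDr mulr_ge0 ?tent_ge0//.
have mG := measurable_tonelli2 leb g mg g0.
have [ti te] := rintegrable_tent.
rewrite (_ : fejer = fun xi => fine (\int[leb]_x g (x, xi))%E - 1).
  by apply: measurable_funB => //; exact: measurableT_comp mG.
apply/funext => xi; rewrite -te /g/= rintegral_EFin/=; last first.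
  by apply: rintegrableD => //; exact: rintegrable_tent_cos.
by rewrite rintegralD ?addrK//; exact: rintegrable_tent_cos.
Qed.

Lemma rintegrable_fejer : rintegrable leb fejer.
Proof.
have gi : rintegrable leb (fun x => 2 * (1 + x ^+ 2)^-1).
  apply: rintegrableZ; apply: rintegrableP.
  - exact: continuous_measurable_fun (@continuous_oneDsqrV R).
  - by move=> x; rewrite invr_ge0 addr_ge0 ?sqr_ge0.
  rewrite (@ge0_symfun_integralT _ (fun x : R => (oneDsqr x)^-1)).
  - rewrite (_ : [set x | _] = `[0, +oo[%classic); last first.
      by apply/seteqP; split => x/=; rewrite in_itv/= andbT.
    by rewrite integral0y_oneDsqr -EFinM ltry.
  - by move=> x; rewrite invr_ge0 addr_ge0 ?sqr_ge0.
  - exact: continuous_oneDsqrV.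
  - by move=> x/=; rewrite /oneDsqr sqrrN.
by apply: (rintegrable_le measurable_fejer gi) => x; rewrite ger0_norm ?fejer_ge0// fejer_le.
Qed.

(* On [1/4, 1/2] the cosine is nonpositive, so [fejer] is at least 2 / pi^2. *)
Lemma rintegral_fejer_gt0 : 0 < \int[leb]_x fejer x.
Proof.
have dF x : is_derive x 1 (fun x : R => 2 / pi ^+ 2 * x) (2 / pi ^+ 2 : R).
  by apply: is_derive_eq; rewrite /GRing.scale/= mulr1.
have cf : continuous (fun _ : R => 2 / pi ^+ 2 : R) by move=> x; exact: cvg_cst.
have q : (4^-1 < 2^-1 :> R) by lra.
have [i e] := rintegral_segment q cf dF.
have pi0 := pi_gt0 R.
apply: lt_le_trans (_ : 2 / pi ^+ 2 * 2^-1 - 2 / pi ^+ 2 * 4^-1 <= _).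
  by rewrite subr_gt0 ltr_pM2l// divr_gt0// exprn_gt0.
rewrite -e; apply: le_rintegral => //; first exact: rintegrable_fejer.
move=> x; rewrite indicE mem_setE in_itv/=.
have [/andP[x1 x2]|_] := boolP (_ && _); last by rewrite mulr0 fejer_ge0.
rewrite mulr1 fejerE; last by apply: lt0r_neq0; lra.
have pix1 : pi / 2 <= 2 * pi * x by nra.
have pix2 : 2 * pi * x <= pi by nra.
have c0 : cos (2 * pi * x) <= 0.
  rewrite -[X in cos X](subrK (pi / 2)) cosDpihalf oppr_le0.
  by apply: sin_ge0_pi; apply/andP; split; lra.
have y0 : 0 < 2 * pi * x by lra.
apply: ler_pM; rewrite ?invr_ge0 ?sqr_ge0//; first lra.
by rewrite lef_pV2 ?posrE ?exprn_gt0// ler_sqr ?nnegrE; lra.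
Qed.

Lemma fejer_cvg1 (u : nat -> R) : u k @[k --> \oo] --> (0 : R) ->
  fejer (u k) @[k --> \oo] --> (1 : R).
Proof.
move=> u0; have [ti te] := rintegrable_tent.
apply/subr_cvg0.
rewrite (_ : (fun k => _) = fun k =>
    \int[leb]_x (tent x * (cos (2 * pi * u k * x) - 1))); last first.
  apply/funext => k; rewrite -[X in _ - X = _]te -RintegralB//; last exact: rintegrable_tent_cos.
  by apply: eq_Rintegral => x _; rewrite mulrBr mulr1.
apply: (rintegral_cvg0 _ (rintegrableZ 2 ti)).
- move=> k; apply: measurable_funM; first exact: measurable_tent.
  by apply: measurable_funB => //; exact: measurable_cosM.
- move=> k x; rewrite normrM (ger0_norm (tent_ge0 x)) mulrC ler_wpM2r ?tent_ge0//.
  have := cos_geN1 (2 * pi * u k * x); have := cos_le1 (2 * pi * u k * x).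
  by rewrite ler_norml => *; apply/andP; split; lra.
- move=> x; rewrite -[X in _ --> X](mulr0 (tent x)); apply: cvgM; first exact: cvg_cst.
  rewrite -[X in _ --> X](subrr (1 : R)); apply: cvgB; last exact: cvg_cst.
  rewrite -[X in _ --> X]cos0; apply: continuous_cvg; first exact: continuous_cos.
  rewrite -[X in _ --> X](mul0r x); apply: cvgM; last exact: cvg_cst.
  by rewrite -[X in _ --> X](mulr0 (2 * pi)); apply: cvgM => //; exact: cvg_cst.
Qed.

Lemma tent_cvg1 (u : nat -> R) : u k @[k --> \oo] --> (0 : R) ->
  tent (u k) @[k --> \oo] --> (1 : R).
Proof.
move=> u0; rewrite -[X in _ --> X]tent0; apply: continuous_cvg => //.
exact: continuous_tent.
Qed.

(** The imaginary part vanishes because its integrand is odd. *)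
Lemma fourier_tent xi :
  cintegral leb (fun x => (tent x)%:C%C * expi (- (2 * pi * (x * xi)))) =
  (fejer xi)%:C%C.
Proof.
have E x : - (2 * pi * (x * xi)) = - (2 * pi * xi * x) by ring.
rewrite /cintegral /real_complex_def; congr Complex.
  apply: eq_Rintegral => x _; rewrite ReM/= mul0r subr0.
  by rewrite E cosN.
under eq_Rintegral do rewrite ImM/= mul0r addr0 E sinN mulrN.
have si : rintegrable leb (fun x => - (tent x * sin (2 * pi * xi * x))).
  under [X in rintegrable _ X]eq_fun do rewrite -mulrN -sinN -mulNr.
  apply: rintegrable_tentM; first exact: measurable_sinM.
  by move=> x; exact: sin_max.
have := rintegral_scales (scales_affine_line 0 (ltr0_neq0 (ltrN10 R))) si.
rewrite normrN1 invr1 mul1r => E2.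
pose S := \int[leb]_x (- (tent x * sin (2 * pi * xi * x))).
suff : S = - S by move=> ?; rewrite -[LHS]/S; lra.
rewrite -[RHS]mulN1r /S -(rintegralZ (-1) si) -[LHS]E2.
apply: eq_Rintegral => x _; rewrite addr0 !mulN1r tentN.
by rewrite mulrN sinN mulrN opprK.
Qed.

End tent.

(** * Product kernels on Euclidean space *)

Section product_kernels.
Context {R : realType}.
Local Notation leb := (@lebesgue_measure R).
Local Notation lebn := (@lebesgue_rV R).
Implicit Types (k : R -> R) (n : nat).

Definition prod_fun n k (x : 'rV[R]_n) : R := \prod_(i < n) k (x ord0 i).

Lemma prod_fun_cons n k p : prod_fun k (@cons_rV R n p) = k p.1 * prod_fun k p.2.
Proof.
rewrite /prod_fun big_ord_recl cons_rV0; congr (_ * _).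
by apply: eq_bigr => i _; rewrite cons_rVS.
Qed.

Lemma dotr_cons n p (xi : 'rV[R]_n.+1) : dotr (@cons_rV R n p) xi =
  p.1 * (uncons_rV xi).1 + dotr p.2 (uncons_rV xi).2.
Proof.
rewrite /dotr big_ord_recl cons_rV0; congr (_ + _).
by apply: eq_bigr => i _; rewrite cons_rVS !mxE.
Qed.

Lemma measurable_prod_fun n k :
  measurable_fun setT (k : measurableTypeR R -> measurableTypeR R) ->
  measurable_fun setT (@prod_fun n k).
Proof.
move=> mk; apply: measurable_prod => i _.
exact: measurableT_comp mk (measurable_coord_rV i).
Qed.

Lemma rintegral_prod_fun n k : rintegrable leb k ->
  rintegrable (lebn n) (@prod_fun n k) /\
  \int[lebn n]_x prod_fun k x = (\int[leb]_x k x) ^+ n.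
Proof.
move=> ki; have mk := rintegrable_measurable ki.
elim: n => [|n [IHi IHe]].
  have -> : @prod_fun 0 k = fun=> 1 by apply/funext => x; exact: big_ord0.
  have i1 : rintegrable (lebn 0) (fun=> 1).
    apply: rintegrableP => //; rewrite integral_cst// mul1e.
    by apply: (@eq_ind_r _ 1%E (fun z => z < +oo)%E (ltry 1)); exact: diracT.
  split => //; rewrite expr0 Rintegral_cst//.
  rewrite mul1r -[RHS]/(fine 1%E); congr fine; exact: diracT.
have mp : measurable_fun setT (@prod_fun n.+1 k) by exact: measurable_prod_fun.
have E : (fun z => prod_fun k (@cons_rV R n z)) = fun z => k z.1 * prod_fun k z.2.
  by apply/funext => z; exact: prod_fun_cons.
have i : rintegrable (lebn n.+1) (@prod_fun n.+1 k).
  apply/(rintegrable_scales (scales_cons_rV n)) => //; rewrite E.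
  exact: rintegrable_tensor.
split => //; have := rintegral_scales (scales_cons_rV n) i.
by rewrite mul1r => <-; rewrite E rintegral_tensor// IHe exprS.
Qed.

Lemma prod_fun_bound n k : (forall x, 0 <= k x <= 1) ->
  forall x, 0 <= @prod_fun n k x <= 1.
Proof.
move=> k01 x; rewrite prodr_ge0 => [|i _]; last by case/andP: (k01 (x ord0 i)).
by apply: prodr_ile1 => i _; exact: k01.
Qed.

Lemma prod_funN n k : (forall x, k (- x) = k x) ->
  forall x, @prod_fun n k (- x) = prod_fun k x.
Proof. by move=> kN x; apply: eq_bigr => i _; rewrite mxE kN. Qed.

Lemma prod_fun_cvg1 n k : (forall u : nat -> R, u j @[j --> \oo] --> (0 : R) ->
    k (u j) @[j --> \oo] --> (1 : R)) ->
  forall u : nat -> 'rV[R]_n, (forall i, u j ord0 i @[j --> \oo] --> (0 : R)) ->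
  prod_fun k (u j) @[j --> \oo] --> (1 : R).
Proof.
move=> k1; elim: n => [|n IH] u u0.
  rewrite /prod_fun; under eq_fun do rewrite big_ord0; exact: cvg_cst.
rewrite -[X in _ --> X](mulr1 1).
rewrite (_ : (fun j => _) = fun j =>
    k (u j ord0 ord0) * prod_fun k (uncons_rV (u j)).2); last first.
  by apply/funext => j; rewrite -{1}(uncons_rVK (u j)) prod_fun_cons.
apply: cvgM; first exact: k1.
by apply: IH => i; under eq_fun do rewrite mxE; exact: u0.
Qed.

(** The exponential of a sum factors over the coordinates. *)
Lemma fourier_prod_fun n k (k' : R -> R) : rintegrable leb k ->
  (forall xi, cintegral leb (fun x => (k x)%:C%C * expi (- (2 * pi * (x * xi)))) =
    (k' xi)%:C%C) ->
  forall xi, cintegral (lebn n) (fun x =>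
    (prod_fun k x)%:C%C * expi (- (2 * pi * dotr x xi))) = (prod_fun k' xi)%:C%C.
Proof.
move=> ki kE.
have ci m (xi : 'rV[R]_m) : cintegrable (lebn m) (fun x =>
    (prod_fun k x)%:C%C * expi (- (2 * pi * dotr x xi))).
  have [pi _] := rintegral_prod_fun m ki.
  apply: (cintegrable_le _ (rintegrable_abs pi)).
    apply: cmeasurableM; first exact: cmeasurable_real (rintegrable_measurable pi).
    apply: cmeasurable_expi; apply: measurableT_comp => //.
    by apply: measurable_funM => //; exact: measurable_dotr.
  by move=> x; rewrite Normc.normcM normc_expi mulr1 normc_real.
have ci1 (xi : R) : cintegrable leb (fun x =>
    (k x)%:C%C * expi (- (2 * pi * (x * xi)))).
  apply: (cintegrable_le _ (rintegrable_abs ki)).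
    apply: cmeasurableM; first exact: cmeasurable_real (rintegrable_measurable ki).
    apply: cmeasurable_expi; apply: measurableT_comp => //.
    by apply: measurable_funM => //; exact: measurable_funM.
  by move=> x; rewrite Normc.normcM normc_expi mulr1 normc_real.
elim: n => [|n IH] xi.
  rewrite /prod_fun; under eq_cintegral do rewrite big_ord0 /dotr big_ord0 mulr0 oppr0 expi0 mulr1.
  rewrite big_ord0 cintegral_real Rintegral_cst//.
  congr (_%:C)%C; rewrite mul1r -[RHS]/(fine 1%E); congr fine; exact: diracT.
have := cintegral_scales (scales_cons_rV n) (ci n.+1 xi); rewrite mul1r => <-.
under eq_cintegral => z do rewrite prod_fun_cons dotr_cons mulrDr opprD expiD
  rmorphM mulrACA.
rewrite (cintegral_tensor (ci1 (uncons_rV xi).1) (ci n (uncons_rV xi).2)) kE IH.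
by rewrite -rmorphM -{3}(uncons_rVK xi) prod_fun_cons.
Qed.

End product_kernels.

Section kernels.
Context {R : realType} (n : nat).
Local Notation lebn := (lebesgue_rV n).
Implicit Types (x : 'rV[R]_n) (u : nat -> 'rV[R]_n).

Definition tent_rV x : R := prod_fun tent x.
Definition fejer_rV x : R := prod_fun fejer x.

Lemma tent_rV_bound x : 0 <= tent_rV x <= 1.
Proof. by apply: prod_fun_bound => y; rewrite tent_ge0 tent_le1. Qed.

Lemma fejer_rV_bound x : 0 <= fejer_rV x <= 1.
Proof. by apply: prod_fun_bound => y; rewrite fejer_ge0 fejer_le1. Qed.

Lemma tent_rVN x : tent_rV (- x) = tent_rV x.
Proof. by apply: prod_funN; exact: tentN. Qed.

Lemma fejer_rVN x : fejer_rV (- x) = fejer_rV x.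
Proof. by apply: prod_funN; exact: fejerN. Qed.

Lemma rintegrable_tent_rV : rintegrable lebn tent_rV.
Proof.
by have [ti _] := @rintegrable_tent R; have [] := rintegral_prod_fun n ti.
Qed.

Lemma rintegrable_fejer_rV : rintegrable lebn fejer_rV.
Proof. by have [] := rintegral_prod_fun n (@rintegrable_fejer R). Qed.

Lemma rintegral_fejer_rV_gt0 : 0 < \int[lebn]_x fejer_rV x.
Proof.
have [_ ->] := rintegral_prod_fun n (@rintegrable_fejer R).
by rewrite exprn_gt0// rintegral_fejer_gt0.
Qed.

Lemma measurable_tent_rV : measurable_fun setT tent_rV.
Proof. exact: rintegrable_measurable rintegrable_tent_rV. Qed.

Lemma measurable_fejer_rV : measurable_fun setT fejer_rV.
Proof. exact: rintegrable_measurable rintegrable_fejer_rV. Qed.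

Lemma tent_rV_cvg1 u : (forall i, u k ord0 i @[k --> \oo] --> (0 : R)) ->
  tent_rV (u k) @[k --> \oo] --> (1 : R).
Proof. by apply: prod_fun_cvg1 => v; exact: tent_cvg1. Qed.

Lemma fejer_rV_cvg1 u : (forall i, u k ord0 i @[k --> \oo] --> (0 : R)) ->
  fejer_rV (u k) @[k --> \oo] --> (1 : R).
Proof. by apply: prod_fun_cvg1 => v; exact: fejer_cvg1. Qed.

Lemma rintegrable_homothety (F : 'rV[R]_n -> R) (c : R) : 0 < c ->
  rintegrable lebn F -> rintegrable lebn (fun x => F (c *: x)).
Proof.
move=> c0 Fi; apply/(rintegrable_scales (scales_homothety n c0)) => //.
exact: rintegrable_measurable Fi.
Qed.

Lemma cintegrable_fourier (k : 'rV[R]_n -> R) xi : rintegrable lebn k ->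
  cintegrable lebn (fun x => (k x)%:C%C * expi (- (2 * pi * dotr x xi))).
Proof.
move=> ki; apply: (cintegrable_le _ (rintegrable_abs ki)).
  apply: cmeasurableM; first exact: cmeasurable_real (rintegrable_measurable ki).
  apply: cmeasurable_expi; apply: measurableT_comp => //.
  by apply: measurable_funM => //; exact: measurable_dotr.
by move=> x; rewrite Normc.normcM normc_expi mulr1 normc_real.
Qed.

Lemma dotrZl (c : R) x y : dotr (c *: x) y = c * dotr x y.
Proof. by rewrite /dotr mulr_sumr; apply: eq_bigr => i _; rewrite mxE mulrA. Qed.

Lemma dotrZr (c : R) x y : dotr x (c *: y) = c * dotr x y.
Proof. by rewrite /dotr mulr_sumr; apply: eq_bigr => i _; rewrite mxE mulrCA. Qed.

Lemma dotrDl x y z : dotr (x + y) z = dotr x z + dotr y z.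
Proof. by rewrite /dotr -big_split; apply: eq_bigr => i _; rewrite mxE mulrDl. Qed.

Lemma dotrDr x y z : dotr z (x + y) = dotr z x + dotr z y.
Proof. by rewrite /dotr -big_split; apply: eq_bigr => i _; rewrite mxE mulrDr. Qed.

Lemma dotrNr x y : dotr x (- y) = - dotr x y.
Proof. by rewrite -scaleN1r dotrZr mulN1r. Qed.

Lemma dotrNl x y : dotr (- x) y = - dotr x y.
Proof. by rewrite -scaleN1r dotrZl mulN1r. Qed.

Lemma dotrC x y : dotr x y = dotr y x.
Proof. by apply: eq_bigr => i _; rewrite mulrC. Qed.

Lemma fourier_tent_rV (c : R) xi : 0 < c ->
  cintegral lebn (fun x =>
    (tent_rV (c *: x))%:C%C * expi (- (2 * pi * dotr x xi))) =
  (c^-1 ^+ n * fejer_rV (c^-1 *: xi))%:C%C.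
Proof.
move=> c0; have [ti _] := @rintegrable_tent R.
have H : cintegral lebn (fun x => (tent_rV x)%:C%C *
    expi (- (2 * pi * dotr x (c^-1 *: xi)))) = (fejer_rV (c^-1 *: xi))%:C%C.
  exact: (fourier_prod_fun ti (@fourier_tent R)).
have := cintegral_scales (scales_homothety n c0)
  (cintegrable_fourier (c^-1 *: xi) rintegrable_tent_rV).
rewrite H -rmorphM => <-.
apply: eq_cintegral => x; rewrite dotrZl dotrZr.
by rewrite mulVKf// gt_eqF.
Qed.

End kernels.

(* Unification would otherwise compare these kernels by unfolding them into
   products over the coordinates. *)
#[global] Opaque tent_rV fejer_rV.

(** * Continuity of translations in L1 *)

Section translation_continuity_line.
Context {R : realType}.
Local Notation leb := (@lebesgue_measure R).

Lemma rintegrable_translate n (f : 'rV[R]_n -> R) h :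
  rintegrable (lebesgue_rV n) f ->
  rintegrable (lebesgue_rV n) (fun x => f (x + h)).
Proof.
move=> fi; apply/(rintegrable_scales (scales_translation h)) => //.
exact: rintegrable_measurable fi.
Qed.

Lemma scales_translation_line (h : R) :
  scales_measure 1 leb leb (fun x : measurableTypeR R => x + h : measurableTypeR R).
Proof.
have := scales_affine_line h (oner_neq0 R); rewrite normr1 invr1.
by congr (scales_measure _ _ _ _); apply/funext => x; rewrite mul1r.
Qed.

Lemma rintegrable_translate_line (f : R -> R) (h : R) :
  rintegrable leb f -> rintegrable leb (fun x => f (x + h)).
Proof.
move=> fi; apply/(rintegrable_scales (scales_translation_line h)) => //.
exact: rintegrable_measurable fi.
Qed.

Lemma rintegrable_indic_segment (a b : R) : a < b ->
  rintegrable leb (\1_`[a, b] : R -> R).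
Proof.
move=> ab; have dF (x : R) : is_derive x 1 (fun x : R => x : R) (1 : R).
  exact: is_derive_id.
have c1 : continuous (fun _ : R => 1 : R) by move=> x; exact: cvg_cst.
have [+ _] := rintegral_segment ab c1 dF.
by under [X in rintegrable _ X]eq_fun do rewrite mul1r.
Qed.

(** Continuous functions of compact support are uniformly approximated by their
    translates, so dominated convergence applies to them. *)
Lemma translation_cvg0_compact (g : R -> R) (M B H : R) (h : nat -> R) :
  continuous g -> (forall x, `|g x| <= B * \1_`[- M, M] x) -> 0 <= B -> 0 < M ->
  (forall k, `|h k| <= H) -> h k @[k --> \oo] --> (0 : R) ->
  \int[leb]_x `|g (x + h k) - g x| @[k --> \oo] --> (0 : R).
Proof.
move=> cg gB B0 M0 hH h0.
have H0 : 0 <= H by rewrite (le_trans _ (hH 0%N)).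
have MH : - (M + H) < M + H by lra.
have mg : measurable_fun setT (g : measurableTypeR R -> measurableTypeR R).
  exact: continuous_measurable_fun.
apply: (rintegral_cvg0 _ (rintegrableZ (2 * B)
  (rintegrable_indic_segment MH))).
- move=> k; apply: measurableT_comp => //; apply: measurable_funB => //.
  by case: (scales_translation_line (h k)) => _ mh _; exact: measurableT_comp mh.
- move=> k x; rewrite normr_id (le_trans (ler_normB _ _))//.
  rewrite mulrAC -mulrA mulrDl mul1r.
  have K y : `|y - x| <= H -> `|g y| <= \1_`[- (M + H), M + H] x * B.
    move=> yx; rewrite (le_trans (gB y))// mulrC ler_wpM2r//.
    rewrite !indicE !mem_setE !in_itv/=.
    case: (boolP (_ <= y <= _)) => // /andP[y1 y2].
    move: yx; rewrite ler_norml => /andP[? ?].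
    by rewrite (_ : _ <= x <= _)//; apply/andP; split; lra.
  by rewrite lerD// K ?subrr ?normr0// addrAC subrr add0r.
- move=> x; rewrite -[X in _ --> X](normr0 R).
  apply: cvg_norm; rewrite -[X in _ --> X](subrr (g x)).
  apply: cvgB; last exact: cvg_cst.
  apply: (@continuous_cvg _ _ _ _ _ _ g); first exact: cg.
  by rewrite -[X in _ --> X]addr0; apply: cvgD => //; exact: cvg_cst.
Qed.

(** Multiplying by a wide tent truncates [f]; on the remaining segment [f] is
    close to a continuous function, and a second factor [chi k] makes the
    approximant continuous on the whole line and compactly supported. *)
Lemma compact_approximation (f : R -> R) (e : R) : rintegrable leb f -> 0 < e ->
  exists g, [/\ continuous g, exists M B : R, [/\ 0 <= B, 0 < M &
      forall x, `|g x| <= B * \1_`[- M, M] x],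
    rintegrable leb g & \int[leb]_x `|f x - g x| <= e].
Proof.
move=> fi e0; have mf := rintegrable_measurable fi.
have e2 : 0 < e / 2 by rewrite divr_gt0.
pose chi k (x : R) := tent (k.+1%:R^-1 * x).
have cchi k : continuous (chi k).
  move=> x; apply: (@continuous_comp _ _ _ (fun x : R => k.+1%:R^-1 * x) (@tent R)).
    by apply: cvgM; [exact: cvg_cst|exact: cvg_id].
  exact: continuous_tent.
have mchi k : measurable_fun setT (chi k : measurableTypeR R -> measurableTypeR R).
  exact: continuous_measurable_fun.
have chi01 k x : 0 <= chi k x <= 1 by rewrite tent_ge0 tent_le1.
have chi0 k x : chi k x <= \1_`[- k.+1%:R, k.+1%:R] x.
  rewrite indicE mem_setE in_itv/= -ler_norml; have [_|h] := leP `|x| k.+1%:R.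
    by case/andP: (chi01 k x).
  rewrite /chi /tent max_l// subr_le0 normrM gtr0_norm ?invr_gt0//.
  by rewrite mulrC ler_pdivlMr// mul1r ltW.
have [k kle] : exists k, \int[leb]_x `|f x - f x * chi k x| <= e / 2.
  have tail : \int[leb]_x `|f x - f x * chi k x| @[k --> \oo] --> (0 : R).
    apply: (rintegral_cvg0 _ (rintegrableZ 2 (rintegrable_abs fi))).
    - move=> k; apply: measurableT_comp => //; apply: measurable_funB => //.
      by apply: measurable_funM; [exact: mf|exact: mchi].
    - move=> k x; rewrite normr_id (le_trans (ler_normB _ _))// mulrDl mul1r.
      rewrite lerD2l normrM ler_piMr//.
      by case/andP: (chi01 k x) => *; rewrite ger0_norm.
    - move=> x; rewrite -[X in _ --> X](normr0 R); apply: cvg_norm.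
      rewrite -[X in _ --> X](subrr (f x)); apply: cvgB; first exact: cvg_cst.
      rewrite -[X in _ --> X]mulr1; apply: cvgM; first exact: cvg_cst.
      apply: tent_cvg1; rewrite -[X in _ --> X](mul0r x).
      by apply: cvgM; [exact: cvg_harmonic|exact: cvg_cst].
  have /cvgrPdist_le/(_ _ e2)[k _ kP] := tail; exists k.
  have := kP k (leqnn k); rewrite /= sub0r normrN.
  exact: le_trans (ler_norm _).
pose M : R := k.+1%:R; pose E := `[- M, M]%classic.
have M0 : 0 < M by rewrite ltr0n.
have [g [cg gle]] : exists g : R -> R, continuous g /\
    \int[leb]_x (`|f x - g x| * \1_E x) <= e / 2.
  have mE : measurable (E : set (measurableTypeR R)) by exact: measurable_itv.
  have finE : (leb E < +oo)%E.
    exact: compact_finite_measure (@segment_compact R (- M) M).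
  have iE : leb.-integrable E (EFin \o f) by exact: integrableS fi.
  have [g_ [cg_ ig_ lim_]] := approximation_continuous_integrable mE finE iE.
  have /fine_cvgP[_ /cvgrPdist_le/(_ _ e2)[j _ jP]] := lim_.
  exists (g_ j); split => //; have := jP j (leqnn j).
  rewrite /= sub0r normrN => /(le_trans (ler_norm _)).
  apply: le_trans; rewrite le_eqVlt; apply/orP; left; apply/eqP.
  rewrite -[RHS]/(\int[leb]_(x in E) `|f x - g_ j x|) [RHS]Rintegral_mkcond.
  apply: eq_Rintegral => x _; rewrite patchE indicE.
  by case: ifP => _; rewrite ?mulr1 ?mulr0.
have [B [B0 gB]] : exists B : R, 0 <= B /\ forall x, E x -> `|g x| <= B.
  have /compact_bounded[B [_ BP]] : compact (g @` E).
    by apply: continuous_compact; [exact: continuous_subspaceT|exact: segment_compact].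
  exists (`|B| + 1); split; first by rewrite addr_ge0.
  by move=> x Ex; apply: BP; [rewrite (le_lt_trans (ler_norm _))// ltrDl|exists x].
have cgchi : continuous (fun x => g x * chi k x).
  by move=> x; apply: cvgM; [exact: cg|exact: cchi].
have gchiB x : `|g x * chi k x| <= B * \1_E x.
  have /andP[c0 c1] := chi01 k x.
  have := chi0 k x; rewrite indicE normrM (ger0_norm c0).
  have [xE|xE] := boolP (x \in E) => /= h.
    rewrite mulr1; apply: le_trans (gB x _); last exact: set_mem.
    by rewrite ler_piMr.
  have -> : chi k x = 0 by apply/eqP; rewrite eq_le h c0.
  by rewrite !mulr0.
have M1 : - M < M by lra.
have gi : rintegrable leb (fun x => g x * chi k x).
  have iB := rintegrableZ B (rintegrable_indic_segment M1).
  by apply: (rintegrable_le _ iB) => //; exact: continuous_measurable_fun.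
have mg : measurable_fun setT (g : measurableTypeR R -> measurableTypeR R).
  exact: continuous_measurable_fun.
have fgi : rintegrable leb (fun x => `|f x - g x| * \1_E x).
  apply: (rintegrable_le _ (rintegrableD (rintegrable_abs fi)
      (rintegrableZ B (rintegrable_indic_segment M1)))).
    apply: measurable_funM; last exact: rintegrable_measurable (rintegrable_indic_segment M1).
    by apply: measurableT_comp => //; apply: measurable_funB; [exact: mf|exact: mg].
  move=> x; rewrite ger0_norm ?mulr_ge0//.
  rewrite indicE; have [xE|xE] := boolP (x \in E); rewrite ?mulr0 ?addr0// !mulr1.
  by rewrite (le_trans (ler_normB _ _))// lerD2l gB//; exact: set_mem.
exists (fun x => g x * chi k x); split => //.
  by exists M, B.
have fchi : rintegrable leb (fun x => `|f x - f x * chi k x|).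
  apply: (rintegrable_le _ (rintegrableZ 2 (rintegrable_abs fi))).
    apply: measurableT_comp => //; apply: measurable_funB => //.
    by apply: measurable_funM; [exact: mf|exact: mchi].
  move=> x; rewrite normr_id (le_trans (ler_normB _ _))// mulrDl mul1r.
  rewrite lerD2l normrM ler_piMr//.
  by case/andP: (chi01 k x) => *; rewrite ger0_norm.
apply: (@le_trans _ _ (\int[leb]_x (`|f x - f x * chi k x| + `|f x - g x| * \1_E x))).
  apply: le_rintegral.
  - apply: rintegrable_abs.
    rewrite (_ : (fun x => _) = fun x => f x + (-1) * (g x * chi k x)).
      by apply: rintegrableD => //; exact: rintegrableZ.
    by apply/funext => x; rewrite mulN1r.
  - exact: rintegrableD.
  - move=> x.
    rewrite (_ : f x - g x * chi k x = (f x - f x * chi k x) + (f x - g x) * chi k x); last by ring.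
    rewrite (le_trans (ler_normD _ _))// lerD2l normrM.
    have /andP[c0 c1] := chi01 k x.
    by rewrite (ger0_norm c0) ler_wpM2l// chi0.
by rewrite rintegralD// (splitr e) lerD.
Qed.

Lemma translation_cvg0_line (f : R -> R) (H : R) (h : nat -> R) :
  rintegrable leb f -> (forall k, `|h k| <= H) ->
  h k @[k --> \oo] --> (0 : R) ->
  \int[leb]_x `|f (x + h k) - f x| @[k --> \oo] --> (0 : R).
Proof.
move=> fi hH h0; apply/cvgrPdist_le => e e0.
have e3 : 0 < e / 3 by rewrite divr_gt0.
have [g [cg [M [B [B0 M0 gB]]] gi fge]] := compact_approximation fi e3.
have := translation_cvg0_compact cg gB B0 M0 hH h0.
move=> /cvgrPdist_le/(_ _ e3); apply: filterS => k.
rewrite !sub0r !normrN => gk.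
have di : rintegrable leb (fun x => `|f x - g x|).
  apply: rintegrable_abs; under [X in rintegrable _ X]eq_fun do rewrite -mulN1r.
  by apply: rintegrableD => //; exact: rintegrableZ.
have dgi : rintegrable leb (fun x => `|g (x + h k) - g x|).
  apply: rintegrable_abs; under [X in rintegrable _ X]eq_fun do rewrite -mulN1r.
  by apply: rintegrableD; [exact: rintegrable_translate_line|exact: rintegrableZ].
have dfi : rintegrable leb (fun x => `|f (x + h k) - f x|).
  apply: rintegrable_abs; under [X in rintegrable _ X]eq_fun do rewrite -mulN1r.
  by apply: rintegrableD; [exact: rintegrable_translate_line|exact: rintegrableZ].
have dti := rintegrable_translate_line (h k) di.
rewrite ger0_norm; last by apply: Rintegral_ge0.
apply: (@le_trans _ _ (\int[leb]_x (`|f (x + h k) - g (x + h k)| +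
    (`|f x - g x| + `|g (x + h k) - g x|)))).
  apply: le_rintegral => //; first by apply: rintegrableD => //; exact: rintegrableD.
  move=> x; rewrite (_ : f (x + h k) - f x = (f (x + h k) - g (x + h k)) +
    (- (f x - g x) + (g (x + h k) - g x))); last by ring.
  rewrite (le_trans (ler_normD _ _))// lerD2l (le_trans (ler_normD _ _))//.
  by rewrite normrN.
rewrite rintegralD//; last exact: rintegrableD.
rewrite rintegralD// (rintegral_scales (scales_translation_line (h k)) di) mul1r.
have := le_trans (ler_norm _) gk; lra.
Qed.

End translation_continuity_line.

Section translation_continuity.
Context {R : realType}.
Local Notation leb := (@lebesgue_measure R).
Local Notation lebn := (@lebesgue_rV R).

Lemma rintegrableB d (T : measurableType d) (mu : {measure set T -> \bar R})
    (f g : T -> R) : rintegrable mu f -> rintegrable mu g ->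
  rintegrable mu (fun x => f x - g x).
Proof.
move=> fi gi; rewrite (_ : (fun x => _) = fun x => f x + -1 * g x).
  by apply: rintegrableD => //; exact: rintegrableZ.
by apply/funext => x; rewrite mulN1r.
Qed.

Lemma rintegrable_dist_translate n (f : 'rV[R]_n -> R) u :
  rintegrable (lebn n) f ->
  rintegrable (lebn n) (fun x => `|f (x + u) - f x|).
Proof.
move=> fi; apply: rintegrable_abs; apply: rintegrableB => //.
exact: rintegrable_translate.
Qed.

(** Induction on the dimension.  A translation is composed of one of the first
    coordinate and one of the others; each is treated on almost every slice by
    the lower dimensional case, and the slice integrals are dominated by twice
    the integral of [|f|] over the slice. *)
Lemma translation_cvg0 n (f : 'rV[R]_n -> R) (H : R) (u : nat -> 'rV[R]_n) :
  rintegrable (lebn n) f -> (forall k i, `|u k ord0 i| <= H) ->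
  (forall i, u k ord0 i @[k --> \oo] --> (0 : R)) ->
  \int[lebn n]_x `|f (x + u k) - f x| @[k --> \oo] --> (0 : R).
Proof.
elim: n f u => [|n IH] f u fi uH u0.
  rewrite (_ : (fun k => _) = fun=> 0); first exact: cvg_cst.
  apply/funext => k; rewrite (_ : (fun x => _) = fun=> 0).
    by rewrite Rintegral_cst// mul0r.
  apply/funext => x.
  by rewrite (_ : x + u k = x) ?subrr ?normr0//; apply/rowP => -[].
pose a k := u k ord0 ord0; pose b k := (uncons_rV (u k)).2.
pose F (z : measurableTypeR R * 'rV[R]_n) := f (cons_rV z).
have mf := rintegrable_measurable fi.
have Fi : rintegrable (leb \X lebn n)%E F.
  exact/(rintegrable_scales (scales_cons_rV n) mf).
have mF := rintegrable_measurable Fi.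
have consD z k : cons_rV z + u k = cons_rV (z.1 + a k, z.2 + b k).
  apply/rowP => i; rewrite [LHS]mxE; case: (unliftP ord0 i) => [j|] ->.
    by rewrite !cons_rVS !mxE.
  by rewrite !cons_rV0.
have sa k : scales_measure 1 (leb \X lebn n)%E (leb \X lebn n)%E
    (fun z : measurableTypeR R * 'rV[R]_n => (z.1 + a k : measurableTypeR R, z.2)).
  by have := scales_prod (scales_translation_line (a k)) (scales_id (lebn n)); rewrite mulr1.
have sb k : scales_measure 1 (leb \X lebn n)%E (leb \X lebn n)%E
    (fun z : measurableTypeR R * 'rV[R]_n => (z.1, z.2 + b k)).
  by have := scales_prod (scales_id leb) (scales_translation (b k)); rewrite mulr1.
have msa k : measurable_fun setT (fun z : measurableTypeR R * 'rV[R]_n =>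
    (z.1 + a k : measurableTypeR R, z.2)) by case: (sa k).
have msb k : measurable_fun setT (fun z : measurableTypeR R * 'rV[R]_n =>
    (z.1, z.2 + b k)) by case: (sb k).
have Fai k : rintegrable (leb \X lebn n)%E (fun z => F (z.1 + a k, z.2)).
  exact/(rintegrable_scales (sa k) mF).
have Fbi k : rintegrable (leb \X lebn n)%E (fun z => F (z.1, z.2 + b k)).
  exact/(rintegrable_scales (sb k) mF).
have dai k : rintegrable (leb \X lebn n)%E (fun z => `|F (z.1 + a k, z.2) - F z|).
  by apply: rintegrable_abs; exact: rintegrableB.
have dbi k : rintegrable (leb \X lebn n)%E (fun z => `|F (z.1, z.2 + b k) - F z|).
  by apply: rintegrable_abs; exact: rintegrableB.
have lima : \int[(leb \X lebn n)%E]_z `|F (z.1 + a k, z.2) - F z| @[k --> \oo] --> (0 : R).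
  have ae := ae_integrable2 Fi.
  rewrite (_ : (fun k => _) = fun k =>
      \int[lebn n]_y \int[leb]_x `|F (x + a k, y) - F (x, y)|); last first.
    by apply/funext => k; have [_ <-] := rintegral_fubini2 (dai k).
  have [gi _] := rintegral_fubini2 (rintegrable_abs Fi).
  apply: (rintegral_cvg0_ae _ (rintegrableZ 2 gi)).
  - by move=> k; have [/rintegrable_measurable] := rintegral_fubini2 (dai k).
  - apply: filterS ae => y Fy k.
    have Fyi : rintegrable leb (fun x => F (x, y)) by exact: Fy.
    have Fyti := rintegrable_translate_line (a k) Fyi.
    rewrite ger0_norm; last by apply: Rintegral_ge0.
    apply: (@le_trans _ _ (\int[leb]_x (`|F (x + a k, y)| + `|F (x, y)|))).
      apply: le_rintegral.
      + by apply: rintegrable_abs; exact: rintegrableB.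
      + by apply: rintegrableD; exact: rintegrable_abs.
      + by move=> x; exact: ler_normB.
    rewrite rintegralD//; [|exact: rintegrable_abs|exact: rintegrable_abs].
    rewrite (rintegral_scales (scales_translation_line (a k))
      (F := fun x => `|F (x, y)|) (rintegrable_abs Fyi)).
    by rewrite mulrDl !mul1r.
  - apply: filterS ae => y Fy.
    apply: (@translation_cvg0_line _ (fun x => F (x, y)) H) => //.
      by move=> k; exact: uH.
    exact: u0.
have limb : \int[(leb \X lebn n)%E]_z `|F (z.1, z.2 + b k) - F z| @[k --> \oo] --> (0 : R).
  have ae := ae_integrable1 Fi.
  rewrite (_ : (fun k => _) = fun k =>
      \int[leb]_x \int[lebn n]_y `|F (x, y + b k) - F (x, y)|); last first.
    by apply/funext => k; have [_ <-] := rintegral_fubini1 (dbi k).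
  have [gi _] := rintegral_fubini1 (rintegrable_abs Fi).
  apply: (rintegral_cvg0_ae _ (rintegrableZ 2 gi)).
  - by move=> k; have [/rintegrable_measurable] := rintegral_fubini1 (dbi k).
  - apply: filterS ae => x Fx k.
    have Fxi : rintegrable (lebn n) (fun y => F (x, y)) by exact: Fx.
    have Fxti := rintegrable_translate (b k) Fxi.
    rewrite ger0_norm; last by apply: Rintegral_ge0.
    apply: (@le_trans _ _ (\int[lebn n]_y (`|F (x, y + b k)| + `|F (x, y)|))).
      apply: le_rintegral.
      + by apply: rintegrable_abs; exact: rintegrableB.
      + by apply: rintegrableD; exact: rintegrable_abs.
      + by move=> y; exact: ler_normB.
    rewrite rintegralD//; [|exact: rintegrable_abs|exact: rintegrable_abs].
    rewrite (rintegral_scales (scales_translation (b k))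
      (F := fun y => `|F (x, y)|) (rintegrable_abs Fxi)).
    by rewrite mulrDl !mul1r.
  - apply: filterS ae => x Fx.
    apply: (IH (fun y => F (x, y))) => //.
      by move=> k i; rewrite mxE; exact: uH.
    by move=> i; under eq_fun do rewrite mxE; exact: u0.
have lim := cvgD lima limb; rewrite addr0 in lim.
apply: (@squeeze_cvgr _ _ _ _ (cst 0) (fun k =>
  \int[(leb \X lebn n)%E]_z `|F (z.1 + a k, z.2) - F z| +
  \int[(leb \X lebn n)%E]_z `|F (z.1, z.2 + b k) - F z|)); last exact: lim;
  last exact: cvg_cst.
apply: nearW => k; rewrite Rintegral_ge0//=.
have di := rintegrable_dist_translate (u k) fi.
have := rintegral_scales (scales_cons_rV n) di; rewrite mul1r => <-.
have dabi : rintegrable (leb \X lebn n)%E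
    (fun z => `|F (z.1 + a k, z.2 + b k) - F (z.1, z.2 + b k)|).
  exact: (rintegrable_scales (sb k) (rintegrable_measurable (dai k))).2 (dai k).
apply: (@le_trans _ _ (\int[(leb \X lebn n)%E]_z
  (`|F (z.1 + a k, z.2 + b k) - F (z.1, z.2 + b k)| + `|F (z.1, z.2 + b k) - F z|))).
  apply: le_rintegral.
  - exact: (rintegrable_scales (scales_cons_rV n) (rintegrable_measurable di)).2 di.
  - exact: rintegrableD.
  - by move=> z; rewrite consD; exact: ler_distD.
rewrite rintegralD// (rintegral_scales (sb k) (dai k)).
by rewrite mul1r.
Qed.

End translation_continuity.

(** * Square integrable functions *)

Section square_integrable.
Context {R : realType} d (T : measurableType d) (mu : {measure set T -> \bar R}).
Implicit Types f g : T -> R[i].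

Definition cL2 f :=
  cmeasurable f /\ rintegrable mu (fun x => normc (f x) ^+ 2).

Lemma mulr_le_sqr (a b : R) : a * b <= a ^+ 2 + b ^+ 2.
Proof. have := sqr_ge0 (a - b); have := sqr_ge0 a; have := sqr_ge0 b; nra. Qed.

Lemma cL2_mul f g : cL2 f -> cL2 g -> cintegrable mu (fun x => f x * g x).
Proof.
move=> [mf fi] [mg gi]; apply: (cintegrable_le _ (rintegrableD fi gi)).
  exact: cmeasurableM.
by move=> x; rewrite Normc.normcM mulr_le_sqr.
Qed.

Lemma cL2_conj f : cL2 f -> cL2 (fun x => conjc (f x)).
Proof.
move=> [mf fi]; split; first exact: cmeasurable_conj.
by under [X in rintegrable _ X]eq_fun do rewrite normc_conj.
Qed.

Lemma cL2_le f (g : T -> R) : cmeasurable f -> rintegrable mu g ->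
  (forall x, normc (f x) ^+ 2 <= g x) -> cL2 f.
Proof.
move=> mf gi fg; split => //; apply: rintegrable_le gi _ => //.
  by apply: measurable_funX; exact: measurable_normc.
by move=> x; rewrite ger0_norm// sqr_ge0.
Qed.

Lemma cL2B f g : cL2 f -> cL2 g -> cL2 (fun x => f x - g x).
Proof.
move=> [mf fi] [mg gi].
apply: (cL2_le _ (rintegrableZ 2 (rintegrableD fi gi))); first exact: cmeasurableB.
move=> x; have := le_normcD (f x) (- g x); rewrite normcN => h.
have f0 := normc_ge0 (f x); have g0 := normc_ge0 (g x).
have := normc_ge0 (f x - g x); have := sqr_ge0 (normc (f x) - normc (g x)).
nra.
Qed.

Lemma cL2Z (c : R[i]) f : cL2 f -> cL2 (fun x => c * f x).
Proof.
move=> [mf fi]; apply: (cL2_le _ (rintegrableZ (normc c ^+ 2) fi)).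
  by apply: cmeasurableM => //; exact: cmeasurable_cst.
by move=> x; rewrite Normc.normcM exprMn.
Qed.

(** Cauchy-Schwarz in the form of a limit: weighting the arithmetic-geometric
    inequality by a small parameter. *)
Lemma rintegral_mul_cvg0 (p_ : nat -> T -> R) (q : T -> R) :
  (forall k, measurable_fun setT (p_ k)) -> measurable_fun setT q ->
  (forall k, rintegrable mu (fun x => p_ k x ^+ 2)) ->
  rintegrable mu (fun x => q x ^+ 2) ->
  (forall k x, 0 <= p_ k x) -> (forall x, 0 <= q x) ->
  \int[mu]_x p_ k x ^+ 2 @[k --> \oo] --> (0 : R) ->
  \int[mu]_x (p_ k x * q x) @[k --> \oo] --> (0 : R).
Proof.
move=> mp mq pi qi p0 q0 lim; apply/cvgrPdist_le => e e0.
pose A := \int[mu]_x q x ^+ 2.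
have A0 : 0 <= A by apply: Rintegral_ge0 => x _; exact: sqr_ge0.
pose s := e / (A + 1).
have s0 : 0 < s by rewrite divr_gt0// ltr_wpDl.
have es0 : 0 < e * s by rewrite mulr_gt0.
move/cvgrPdist_le : lim => /(_ _ es0); apply: filterS => k.
rewrite !sub0r !normrN => Dk.
rewrite ger0_norm; last by apply: Rintegral_ge0 => x _; rewrite mulr_ge0.
have Dk' : \int[mu]_x p_ k x ^+ 2 <= e * s := le_trans (ler_norm _) Dk.
apply: (@le_trans _ _ (\int[mu]_x (s / 2 * q x ^+ 2 + s^-1 / 2 * p_ k x ^+ 2))).
  apply: le_rintegral.
  - apply: (rintegrable_le _ (rintegrableD (pi k) qi)); first exact: measurable_funM.
    by move=> x; rewrite ger0_norm ?mulr_ge0// mulr_le_sqr.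
  - by apply: rintegrableD; exact: rintegrableZ.
  - move=> x.
    have -> : s / 2 * q x ^+ 2 + s^-1 / 2 * p_ k x ^+ 2 =
        p_ k x * q x + (s * q x - p_ k x) ^+ 2 / (2 * s).
      by field; rewrite gt_eqF.
    by rewrite lerDl divr_ge0 ?sqr_ge0// mulr_ge0// ltW.
rewrite rintegralD; [|exact: rintegrableZ|exact: rintegrableZ].
rewrite !rintegralZ//.
have h1 : s / 2 * A <= e / 2.
  have : s * A + s = e by rewrite -{2}(mulr1 s) -mulrDr divfK// gt_eqF// ltr_wpDl.
  lra.
have h2 : s^-1 / 2 * \int[mu]_x p_ k x ^+ 2 <= e / 2.
  have : s^-1 * \int[mu]_x p_ k x ^+ 2 <= e by rewrite ler_pdivrMl// mulrC.
  lra.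
by rewrite (splitr e) lerD.
Qed.

End square_integrable.

Section translation_L2.
Context {R : realType}.
Local Notation lebn := (@lebesgue_rV R).

(** Hoelder continuity of the inverse of the signed square [r |-> r * `|r|]. *)
Lemma sqr_dist_le (a b : R) : `|a - b| ^+ 2 <= 2 * `|a * `|a| - b * `|b| |.
Proof.
rewrite real_normK ?num_real//; have h := sqr_ge0 (a + b).
have [a0|a0] := ger0P a; have [b0|b0] := ger0P b.
- have [ab|ab] := lerP a b.
    have : 0 <= (b - a) * (a + b + a + a) by apply: mulr_ge0; lra.
    have := ler_norm (- (a * a - b * b)); rewrite normrN; nra.
  have : 0 <= (a - b) * (a + b + b + b) by apply: mulr_ge0; lra.
  by have := ler_norm (a * a - b * b); nra.
- by have := ler_norm (a * a - b * - b); nra.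
- by have := ler_norm (- (a * - a - b * b)); rewrite normrN; nra.
- have [ab|ab] := lerP a b.
    have : 0 <= (b - a) * (- (a + b + b + b)) by apply: mulr_ge0; lra.
    have := ler_norm (- (a * - a - b * - b)); rewrite normrN; nra.
  have : 0 <= (a - b) * (- (a + b + a + a)) by apply: mulr_ge0; lra.
  by have := ler_norm (a * - a - b * - b); nra.
Qed.

Lemma cmeasurable_translate n (f : 'rV[R]_n -> R[i]) (u : 'rV[R]_n) :
  cmeasurable f -> cmeasurable (fun x : 'rV[R]_n => f (x + u)).
Proof.
move=> mf; apply: cmeasurable_comp mf _.
by case: (scales_translation u).
Qed.

Lemma cL2_translate n (f : 'rV[R]_n -> R[i]) (u : 'rV[R]_n) :
  cL2 (lebn n) f -> cL2 (lebn n) (fun x => f (x + u)).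
Proof.
move=> [mf fi]; split; first exact: cmeasurable_translate.
exact: (rintegrable_translate u fi).
Qed.

(** The signed square maps square integrable functions to integrable ones and
    its inverse is Hoelder continuous, which transfers the continuity of
    translations from L1 to L2. *)
Lemma translation_L2_cvg0 n (f : 'rV[R]_n -> R[i]) (H : R) (u : nat -> 'rV[R]_n) :
  cL2 (lebn n) f -> (forall k i, `|u k ord0 i| <= H) ->
  (forall i, u k ord0 i @[k --> \oo] --> (0 : R)) ->
  \int[lebn n]_x (normc (f (x + u k) - f x) ^+ 2) @[k --> \oo] --> (0 : R).
Proof.
move=> [[rf jf] fi] uH u0.
pose sg (r : R) := r * `|r|.
have sgi (r : 'rV[R]_n -> R) : measurable_fun setT r ->
    (forall x, r x ^+ 2 <= normc (f x) ^+ 2) -> rintegrable (lebn n) (sg \o r).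
  move=> mr rf2; apply: (rintegrable_le _ fi).
    by apply: measurable_funM => //; exact: measurableT_comp.
  by move=> x; rewrite /= /sg normrM normr_id -expr2 real_normK ?num_real.
have ri := sgi _ rf; have ji := sgi _ jf.
have {}ri : rintegrable (lebn n) (fun x => sg (complex.Re (f x))).
  by apply: ri => x; rewrite normc_sqr lerDl sqr_ge0.
have {}ji : rintegrable (lebn n) (fun x => sg (complex.Im (f x))).
  by apply: ji => x; rewrite normc_sqr lerDr sqr_ge0.
have lim := cvgD (cvgM (cvg_cst (2 : R)) (translation_cvg0 ri uH u0))
                 (cvgM (cvg_cst (2 : R)) (translation_cvg0 ji uH u0)).
rewrite mulr0 addr0 in lim.
apply: (@squeeze_cvgr _ _ _ _ (cst 0) (fun k =>
  2 * \int[lebn n]_x `|sg (complex.Re (f (x + u k))) - sg (complex.Re (f x))| +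
  2 * \int[lebn n]_x `|sg (complex.Im (f (x + u k))) - sg (complex.Im (f x))|));
  last exact: lim; last exact: cvg_cst.
apply: nearW => k; rewrite Rintegral_ge0/= => [|x _]; last exact: sqr_ge0.
have r1 := rintegrable_dist_translate (u k) ri.
have j1 := rintegrable_dist_translate (u k) ji.
rewrite -!rintegralZ// -rintegralD; [|exact: rintegrableZ|exact: rintegrableZ].
have f2 : cL2 (lebn n) f by split; [split|].
apply: le_rintegral.
- by have [] := cL2B (cL2_translate (u k) f2) f2.
- by apply: rintegrableD; exact: rintegrableZ.
- move=> x; rewrite normc_sqr ReB ImB -[X in X + _ <= _]real_normK ?num_real//.
  rewrite -[X in _ + X <= _]real_normK ?num_real//.
  by rewrite lerD// sqr_dist_le.
Qed.

(** The Cauchy-Schwarz inequality against [f] turns the L2 continuity of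
    translations into L1 convergence of the integrands. *)
Lemma correlation_cvg n (f : 'rV[R]_n -> R[i]) (H : R) (u : nat -> 'rV[R]_n) :
  cL2 (lebn n) f -> (forall k i, `|u k ord0 i| <= H) ->
  (forall i, u k ord0 i @[k --> \oo] --> (0 : R)) ->
  \int[lebn n]_x normc (f (x + u k) * conjc (f x) - f x * conjc (f x))
    @[k --> \oo] --> (0 : R).
Proof.
move=> f2 uH u0; have [mf fi] := f2.
under eq_cvg => k.
  under eq_Rintegral => x _ do rewrite -mulrBl Normc.normcM normc_conj.
  over.
apply: rintegral_mul_cvg0.
- move=> k; apply: measurable_normc; apply: cmeasurableB => //.
  exact: cmeasurable_translate.
- exact: measurable_normc.
- by move=> k; have [] := cL2B (cL2_translate (u k) f2) f2.
- exact: fi.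
- by move=> k x; exact: normc_ge0.
- by move=> x; exact: normc_ge0.
- exact: translation_L2_cvg0.
Qed.

End translation_L2.

(** * Tensor products and Bessel's inequality *)

Section weighted_tensor.
Context {R : realType} d1 d2 (T1 : measurableType d1) (T2 : measurableType d2)
  (m1 : {sigma_finite_measure set T1 -> \bar R})
  (m2 : {sigma_finite_measure set T2 -> \bar R}).

(** The weights are only pointwise convergent and the factors only convergent in
    L1: the factors are replaced by their limits at a cost bounded by their L1
    distances, and dominated convergence treats the weights afterwards. *)
Lemma weighted_tensor_cvg (p_ : nat -> T1 -> R[i]) (p : T1 -> R[i])
    (q_ : nat -> T2 -> R[i]) (q : T2 -> R[i]) (w_ : nat -> T1 * T2 -> R) :
  (forall k, cintegrable m1 (p_ k)) -> cintegrable m1 p ->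
  (forall k, cintegrable m2 (q_ k)) -> cintegrable m2 q ->
  \int[m1]_x normc (p_ k x - p x) @[k --> \oo] --> (0 : R) ->
  \int[m2]_y normc (q_ k y - q y) @[k --> \oo] --> (0 : R) ->
  (forall k, measurable_fun setT (w_ k)) -> (forall k z, 0 <= w_ k z <= 1) ->
  (forall z, w_ k z @[k --> \oo] --> (1 : R)) ->
  ccvg (fun k => cintegral (m1 \X m2)%E
          (fun z => p_ k z.1 * q_ k z.2 * (w_ k z)%:C%C))
       (cintegral m1 p * cintegral m2 q).
Proof.
move=> pki pi qki qi lp lq mw w01 w1.
have pqi := cintegrable_tensor pi qi.
have pqki k := cintegrable_tensor (pki k) (qki k).
have nw k z : normc (w_ k z)%:C%C <= 1.
  by rewrite normc_real; case/andP: (w01 k z) => *; rewrite ger0_norm.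
have wi k (f : T1 * T2 -> R[i]) : cintegrable (m1 \X m2)%E f ->
    cintegrable (m1 \X m2)%E (fun z => f z * (w_ k z)%:C%C).
  move=> [mf fi]; apply: (cintegrable_le _ fi).
    by apply: cmeasurableM => //; exact: cmeasurable_real.
  by move=> z; rewrite Normc.normcM ler_piMr ?normc_ge0.
have dpi k := cintegrableB (pki k) pi; have dqi k := cintegrableB (qki k) qi.
pose P := \int[m1]_x normc (p x); pose Q := \int[m2]_y normc (q y).
pose a k := \int[m1]_x normc (p_ k x - p x).
pose b k := \int[m2]_y normc (q_ k y - q y).
pose c k := normc (cintegral (m1 \X m2)%E (fun z => p z.1 * q z.2 * (w_ k z)%:C%C) -
  cintegral m1 p * cintegral m2 q).
have c0 : c k @[k --> \oo] --> (0 : R).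
  rewrite /c -(cintegral_tensor pi qi).
  have [mpq pqi'] := pqi.
  apply: (cintegral_cvg _ mpq pqi').
  - by move=> k; case: (wi k _ pqi).
  - by move=> k z; rewrite [leLHS]Normc.normcM ler_piMr ?normc_ge0.
  - by [].
  - move=> z; rewrite /ccvg.
    rewrite (_ : (fun k => _) = fun k => normc (p z.1 * q z.2) * `|w_ k z - 1|).
      rewrite -[X in _ --> X](mulr0 (normc (p z.1 * q z.2))).
      apply: cvgM; first exact: cvg_cst.
      rewrite -[X in _ --> X](normr0 R); apply: cvg_norm.
      by apply/subr_cvg0; exact: w1.
    apply/funext => k; rewrite -{2}(mulr1 (p z.1 * q z.2)) -mulrBr.
    rewrite (_ : (w_ k z)%:C%C - 1 = (w_ k z - 1)%:C%C); last by rewrite rmorphB.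
    by rewrite Normc.normcM normc_real.
apply: (@squeeze_cvgr _ _ _ _ (cst 0) (fun k => a k * (b k + Q) + P * b k + c k)).
- apply: nearW => k; apply/andP; split; first exact: normc_ge0.
  set X := cintegral _ _; set L := _ * _.
  pose Y := cintegral (m1 \X m2)%E (fun z => p z.1 * q z.2 * (w_ k z)%:C%C).
  rewrite (_ : X - L = (X - Y) + (Y - L)); last by rewrite addrA subrK.
  rewrite (le_trans (le_normcD _ _))// lerD2r.
  rewrite /X /Y -cintegralB; [|exact: wi|exact: wi].
  apply: le_trans (le_normc_cintegral _) _.
    by apply: cintegrableB; exact: wi.
  have i1 := rintegrable_tensor (dpi k).2 (qki k).2.
  have i2 := rintegrable_tensor pi.2 (dqi k).2.
  apply: (@le_trans _ _ (\int[(m1 \X m2)%E]_z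
    (normc (p_ k z.1 - p z.1) * normc (q_ k z.2) +
     normc (p z.1) * normc (q_ k z.2 - q z.2)))).
    apply: le_rintegral.
    + by case: (cintegrableB (wi k _ (pqki k)) (wi k _ pqi)).
    + exact: rintegrableD.
    + move=> z; rewrite -mulrBl Normc.normcM.
      apply: (@le_trans _ _ (normc (p_ k z.1 * q_ k z.2 - p z.1 * q z.2))).
        by rewrite ler_piMr ?normc_ge0.
      rewrite (_ : _ - _ = (p_ k z.1 - p z.1) * q_ k z.2 +
        p z.1 * (q_ k z.2 - q z.2)); last by ring.
      by rewrite (le_trans (le_normcD _ _))// !Normc.normcM.
  rewrite rintegralD// (rintegral_tensor (dpi k).2 (qki k).2).
  rewrite (rintegral_tensor pi.2 (dqi k).2) lerD2r ler_wpM2l//.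
    by apply: Rintegral_ge0 => x _; exact: normc_ge0.
  rewrite /b /Q -rintegralD//; [|exact: (dqi k).2|exact: qi.2].
  apply: le_rintegral; [exact: (qki k).2| |].
    by apply: rintegrableD; [exact: (dqi k).2|exact: qi.2].
  by move=> y; rewrite -{1}(subrK (q y) (q_ k y)) le_normcD.
- exact: cvg_cst.
- rewrite -[X in _ --> X](_ : 0 * (0 + Q) + P * 0 + 0 = 0); last by ring.
  apply: cvgD => //; apply: cvgD; apply: cvgM => //; try exact: cvg_cst.
  by apply: cvgD => //; exact: cvg_cst.
Qed.

End weighted_tensor.

Section bessel.
Context {R : realType} d (T : measurableType d) (mu : {measure set T -> \bar R}).
Implicit Types f g h : T -> R[i].

Definition orthonormal (e : nat -> T -> R[i]) :=
  (forall n, cL2 mu (e n)) /\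
  (forall m n, cinner mu (e m) (e n) = (m == n)%:R).

Lemma cinnerBl f g h (c : R[i]) : cL2 mu f -> cL2 mu g -> cL2 mu h ->
  cinner mu (fun x => f x - c * g x) h = cinner mu f h - c * cinner mu g h.
Proof.
move=> f2 g2 h2; have fhi := cL2_mul f2 (cL2_conj h2).
have ghi := cL2_mul g2 (cL2_conj h2).
rewrite /cinner -cintegralZ// -cintegralB//; last exact: cintegrableZ.
by apply: eq_cintegral => x; rewrite mulrBl mulrA.
Qed.

Lemma cinner_norm f : cinner mu f f = (\int[mu]_x (normc (f x) ^+ 2))%:C%C.
Proof.
rewrite -cintegral_real; apply: eq_cintegral => x; exact: mulc_conj.
Qed.

Lemma sqr_norm_projection h e : cL2 mu h -> cL2 mu e -> cinner mu e e = 1 ->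
  \int[mu]_x (normc (h x - cinner mu h e * e x) ^+ 2) =
  \int[mu]_x (normc (h x) ^+ 2) - normc (cinner mu h e) ^+ 2.
Proof.
move=> h2 e2 e1; set b := cinner mu h e.
have r2 : cL2 mu (fun x => h x - b * e x) by apply: cL2B => //; exact: cL2Z.
have orth : cinner mu (fun x => h x - b * e x) e = 0.
  by rewrite cinnerBl// e1 mulr1 subrr.
suff : (\int[mu]_x (normc (h x - b * e x) ^+ 2))%:C%C =
    (\int[mu]_x (normc (h x) ^+ 2) - normc b ^+ 2)%:C%C :> R[i] by case.
have rB (x y : R) : (x - y)%:C%C = x%:C%C - y%:C%C :> R[i] by exact: rmorphB.
rewrite rB -!cinner_norm -mulc_conj.
have -> : cinner mu (fun x => h x - b * e x) (fun x => h x - b * e x) =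
    cinner mu (fun x => h x - b * e x) h -
    conjc b * cinner mu (fun x => h x - b * e x) e.
  have i1 := cL2_mul r2 (cL2_conj h2); have i2 := cL2_mul r2 (cL2_conj e2).
  rewrite /cinner -cintegralZ// -cintegralB//; last exact: cintegrableZ.
  by apply: eq_cintegral => x; rewrite conjcB conjcM; ring.
rewrite orth mulr0 subr0 cinnerBl//; congr (_ - b * _).
rewrite /b /cinner -cintegral_conj; last exact: cL2_mul h2 (cL2_conj e2).
by apply: eq_cintegral => x; rewrite conjcM conjcK mulrC.
Qed.

(** Bessel's inequality: subtracting from [h] its successive projections lowers
    the squared norm by the squares of the coefficients, whose series therefore
    converges. *)
Lemma cinner_orthonormal_cvg0 (e : nat -> T -> R[i]) h :
  orthonormal e -> cL2 mu h -> normc (cinner mu h (e n)) @[n --> \oo] --> (0 : R).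
Proof.
move=> [e2 eE] h2.
pose fix r n : T -> R[i] := if n is n'.+1
  then fun x => r n' x - cinner mu (r n') (e n') * e n' x else h.
have rP n : [/\ cL2 mu (r n),
    forall m, (n <= m)%N -> cinner mu (r n) (e m) = cinner mu h (e m) &
    \int[mu]_x (normc (r n x) ^+ 2) = \int[mu]_x (normc (h x) ^+ 2) -
      \sum_(0 <= j < n) normc (cinner mu h (e j)) ^+ 2].
  elim: n => [|n [r2 rE rN]]; first by split => //; rewrite big_nil subr0.
  split.
  - by apply: cL2B => //; exact: cL2Z.
  - move=> m nm /=; rewrite cinnerBl// eE ltn_eqF// mulr0 subr0 rE//.
    exact: ltnW.
  - rewrite /= sqr_norm_projection ?eE ?eqxx// rN rE// big_nat_recr//=.
    by rewrite opprD addrA.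
have sumle n : \sum_(0 <= j < n) normc (cinner mu h (e j)) ^+ 2 <=
    \int[mu]_x (normc (h x) ^+ 2).
  have [_ _ rN] := rP n; rewrite -subr_ge0 -rN.
  by apply: Rintegral_ge0 => x _; exact: sqr_ge0.
have cvs : cvgn (series (fun j => normc (cinner mu h (e j)) ^+ 2)).
  apply: nondecreasing_is_cvgn.
    by apply: nondecreasing_series => *; exact: sqr_ge0.
  by exists (\int[mu]_x (normc (h x) ^+ 2)) => _ [n _ <-]; exact: sumle.
have lim2 := cvg_series_cvg_0 cvs.
have lim : Num.sqrt (normc (cinner mu h (e n)) ^+ 2) @[n --> \oo]
    --> Num.sqrt (0 : R).
  by apply: continuous_cvg; [exact: sqrt_continuous|exact: lim2].
rewrite sqrtr0 in lim; apply: cvg_trans lim; apply: near_eq_cvg.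
by apply: nearW => n /=; rewrite sqrtr_sqr ger0_norm ?normc_ge0.
Qed.

End bessel.

Section tensor_orthonormal.
Context {R : realType} d1 d2 (T1 : measurableType d1) (T2 : measurableType d2)
  (m1 : {sigma_finite_measure set T1 -> \bar R})
  (m2 : {sigma_finite_measure set T2 -> \bar R}).

Lemma cL2_tensor (f : T1 -> R[i]) (g : T2 -> R[i]) : cL2 m1 f -> cL2 m2 g ->
  cL2 (m1 \X m2)%E (fun z => f z.1 * g z.2).
Proof.
move=> [mf fi] [mg gi]; split.
  apply: cmeasurableM.
    exact: cmeasurable_comp mf measurable_fst.
  exact: cmeasurable_comp mg measurable_snd.
under [X in rintegrable _ X]eq_fun do rewrite Normc.normcM exprMn.
exact: (rintegrable_tensor fi gi).
Qed.

Lemma orthonormal_tensor (e : nat -> T1 -> R[i]) (e' : nat -> T2 -> R[i]) :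
  orthonormal m1 e -> orthonormal m2 e' ->
  orthonormal (m1 \X m2)%E (fun n z => e n z.1 * e' n z.2).
Proof.
move=> [e2 eE] [e'2 e'E]; split; first by move=> n; exact: cL2_tensor.
move=> m n; rewrite /cinner.
under eq_cintegral do rewrite conjcM mulrACA.
rewrite (cintegral_tensor (cL2_mul (e2 m) (cL2_conj (e2 n)))
  (cL2_mul (e'2 m) (cL2_conj (e'2 n)))).
rewrite -[cintegral m1 _]/(cinner m1 (e m) (e n)) eE.
rewrite -[cintegral m2 _]/(cinner m2 (e' m) (e' n)) e'E.
by case: eqP; rewrite ?mulr1 ?mulr0.
Qed.

End tensor_orthonormal.

(** Conjugate factors of the quartic form are thus members of an orthonormal
    sequence too. *)
Lemma orthonormal_conj {R : realType} d (T : measurableType d)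
    (mu : {measure set T -> \bar R}) (e : nat -> T -> R[i]) :
  orthonormal mu e -> orthonormal mu (fun n x => conjc (e n x)).
Proof.
move=> [e2 eE]; split; first by move=> n; exact: cL2_conj.
move=> m n; rewrite /cinner.
under eq_cintegral do rewrite -conjcM.
rewrite cintegral_conj; last exact: cL2_mul (cL2_conj (e2 n)).
rewrite -[cintegral mu _]/(cinner mu (e m) (e n)) eE.
by case: eqP => _; rewrite ?conjc1 ?conjc0.
Qed.

(** * Permutations of variables and linear maps of pairs *)

Section shuffles.
Context {R : realType}.
Local Open Scope ereal_scope.

Lemma scales_inverse d1 d2 (T1 : measurableType d1) (T2 : measurableType d2)
    (m1 : {measure set T1 -> \bar R}) (m2 : {measure set T2 -> \bar R})
    (f : T1 -> T2) (g : T2 -> T1) :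
  scales_measure 1%R m1 m2 f -> measurable_fun setT g -> cancel f g ->
  scales_measure 1%R m2 m1 g.
Proof.
move=> [_ mf fE] mg fg; split => // A mA.
have mgA : measurable (g @^-1` A).
  by rewrite -[X in measurable X]setTI; exact: mg.
rewrite mul1e -[LHS]mul1e -(fE _ mgA); congr (m1 _).
by apply/seteqP; split => x /=; rewrite fg.
Qed.

Section assoc_inverse.
Context d1 d2 d3 (T1 : measurableType d1) (T2 : measurableType d2)
  (T3 : measurableType d3)
  (m1 : {sigma_finite_measure set T1 -> \bar R})
  (m2 : {sigma_finite_measure set T2 -> \bar R})
  (m3 : {sigma_finite_measure set T3 -> \bar R}).

Definition prod_unassoc (z : T1 * (T2 * T3)) : T1 * T2 * T3 :=
  (z.1, z.2.1, z.2.2).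

Lemma scales_unassoc :
  scales_measure 1%R (m1 \X (m2 \X m3)) (m1 \X m2 \X m3) prod_unassoc.
Proof.
apply: (scales_inverse (scales_assoc m1 m2 m3)); last by move=> [[]].
apply/measurable_fun_pairP; split.
  apply/measurable_fun_pairP; split; first exact: measurable_fst.
  exact: measurableT_comp measurable_fst measurable_snd.
exact: measurableT_comp measurable_snd measurable_snd.
Qed.

Definition prod_swapr (z : T1 * T2 * T3) : T1 * T3 * T2 :=
  (z.1.1, z.2, z.1.2).

End assoc_inverse.

Lemma scales_swapr d1 d2 d3 (T1 : measurableType d1) (T2 : measurableType d2)
  (T3 : measurableType d3)
  (m1 : {sigma_finite_measure set T1 -> \bar R})
  (m2 : {sigma_finite_measure set T2 -> \bar R})
  (m3 : {sigma_finite_measure set T3 -> \bar R}) :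
  scales_measure 1%R (m1 \X m2 \X m3) (m1 \X m3 \X m2) (@prod_swapr _ _ _ T1 T2 T3).
Proof.
have h2 := scales_prod (scales_id m1) (scales_swap m2 m3).
have := scales_comp (scales_comp (scales_assoc m1 m2 m3) h2)
  (scales_unassoc m1 m3 m2).
by rewrite !mulr1; congr (scales_measure _ _ _ _); apply/funext => -[[]].
Qed.

Definition prod_shuffle (T1 T2 T3 T4 : Type) (z : (T1 * T2) * (T3 * T4)) :
  (T1 * T3) * (T2 * T4) := ((z.1.1, z.2.1), (z.1.2, z.2.2)).

Lemma scales_shuffle d1 d2 d3 d4 (T1 : measurableType d1)
  (T2 : measurableType d2) (T3 : measurableType d3) (T4 : measurableType d4)
  (m1 : {sigma_finite_measure set T1 -> \bar R})
  (m2 : {sigma_finite_measure set T2 -> \bar R})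
  (m3 : {sigma_finite_measure set T3 -> \bar R})
  (m4 : {sigma_finite_measure set T4 -> \bar R}) :
  scales_measure 1%R ((m1 \X m2) \X (m3 \X m4)) ((m1 \X m3) \X (m2 \X m4))
    (@prod_shuffle T1 T2 T3 T4).
Proof.
have h1 := scales_unassoc (m1 \X m2) m3 m4.
have h2 := scales_prod (scales_swapr m1 m2 m3) (scales_id m4).
have h3 := scales_assoc (m1 \X m3) m2 m4.
have := scales_comp (scales_comp h1 h2) h3; rewrite !mulr1.
by congr (scales_measure _ _ _ _); apply/funext => -[[a b] [c e]].
Qed.

(** For two points of phase space [(x, w)], each with an integration variable
    [t], this pairs every [x] with its [t] and collects the two frequencies in
    the last factor, over which Fubini's theorem can then integrate first. *)
Definition prod_shuffle6 (T : Type) (z : ((T * T) * (T * T)) * (T * T)) :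
  ((T * T) * (T * T)) * (T * T) :=
  (((z.1.1.1, z.2.1), (z.1.2.1, z.2.2)), (z.1.1.2, z.1.2.2)).

Lemma scales_shuffle6 d (T : measurableType d)
    (m : {sigma_finite_measure set T -> \bar R}) :
  scales_measure 1%R ((m \X m) \X (m \X m) \X (m \X m))
    ((m \X m) \X (m \X m) \X (m \X m)) (@prod_shuffle6 T).
Proof.
have h1 := scales_prod (scales_shuffle m m m m) (scales_id (m \X m)).
have h2 := scales_swapr (m \X m) (m \X m) (m \X m).
have := scales_comp (scales_comp h1 h2) h1; rewrite !mulr1.
by congr (scales_measure _ _ _ _); apply/funext => -[[[a b] [c e]] [g h]].
Qed.

End shuffles.

Section linear_maps.
Context {R : realType} {n : nat}.
Local Notation V := ('rV[R]_n).
Local Notation leb := (@lebesgue_rV R n).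
Local Notation leb2 := (leb \X leb)%E.

Definition midpoint_map (z : V * V) : V * V :=
  (z.1 + 2^-1 *: z.2, z.1 - 2^-1 *: z.2).

Definition sumdiff_map (z : V * V) : V * V := (z.1 + z.2, z.1 - z.2).

(** The map is the composite of the shears [x |-> x + y / 2] and
    [y |-> x - y]. *)
Lemma scales_midpoint : scales_measure 1 leb2 leb2 midpoint_map.
Proof.
have m1 : measurable_fun setT (fun z : V * V => z.1 + 2^-1 *: z.2).
  by apply: measurable_rVD; [exact: measurable_fst|apply: measurable_rVZ; exact: measurable_snd].
have m2 : measurable_fun setT (fun z : V * V => z.1 - z.2).
  by apply: measurable_rVB; [exact: measurable_fst|exact: measurable_snd].
have h1 := scales_fibre1 leb m1
  (fun y => scales_translation (2^-1 *: y)).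
have h2 := scales_fibre2 leb m2 (fun x => scales_opp x).
have := scales_comp h1 h2; rewrite mulr1; congr (scales_measure _ _ _ _).
apply/funext => -[x y]; rewrite /midpoint_map /comp/=; congr (_, _).
apply/rowP => i; rewrite !mxE; lra.
Qed.

(** The map is the composite of the shear [x |-> x + y] and the affine map
    [y |-> x - 2 y] of each fibre, which carries the Jacobian. *)
Lemma scales_sumdiff : scales_measure (2^-1 ^+ n) leb2 leb2 sumdiff_map.
Proof.
have m1 : measurable_fun setT (fun z : V * V => z.1 + z.2).
  by apply: measurable_rVD; [exact: measurable_fst|exact: measurable_snd].
have m2 : measurable_fun setT (fun z : V * V => (- 2) *: z.2 + z.1).
  by apply: measurable_rVD; [apply: measurable_rVZ; exact: measurable_snd|exact: measurable_fst].
have h1 := scales_fibre1 leb m1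
  (fun y => scales_translation y).
have n2 : (- 2 : R) != 0 by rewrite oppr_eq0 pnatr_eq0.
have h2 := scales_fibre2 leb m2
  (fun x => scales_affine x n2).
have := scales_comp h1 h2; rewrite mul1r normrN ger0_norm//.
congr (scales_measure _ _ _ _).
apply/funext => -[x y]; rewrite /sumdiff_map /comp/=; congr (_, _).
apply/rowP => i; rewrite !mxE; lra.
Qed.

(** The substitution [v = u - c w] in the second pair, under which a kernel
    concentrating on the diagonal [u = v] becomes a fixed function of [w]. *)
Lemma scales_diagonal (c : R) : 0 < c ->
  scales_measure (c^-1 ^+ n * c^-1 ^+ n) (leb2 \X leb2)%E (leb2 \X leb2)%E
    (fun z : (V * V) * (V * V) =>
      (z.1, (z.1.1 - c *: z.2.1, z.1.2 - c *: z.2.2))).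
Proof.
move=> c0; have c1 : - c != 0 by rewrite oppr_eq0 gt_eqF.
have mS : measurable_fun setT (fun z : (V * V) * (V * V) =>
    (z.1.1 - c *: z.2.1, z.1.2 - c *: z.2.2)).
  apply/measurable_fun_pairP; split; apply: measurable_rVB.
  - exact: measurableT_comp measurable_fst measurable_fst.
  - by apply: measurable_rVZ; exact: measurableT_comp measurable_fst measurable_snd.
  - exact: measurableT_comp measurable_snd measurable_fst.
  - by apply: measurable_rVZ; exact: measurableT_comp measurable_snd measurable_snd.
apply: (scales_fibre2 leb2 mS) => -[x y].
have := scales_prod (scales_affine x c1) (scales_affine y c1).
rewrite normrN gtr0_norm//; congr (scales_measure _ _ _ _).
by apply/funext => -[p q] /=; rewrite !scaleNr; congr (_, _); rewrite addrC.
Qed.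

End linear_maps.

(** * Products of two Wigner distributions as fourfold integrals *)

Ltac measurable_coordinates := repeat first
  [ exact: measurable_fst | exact: measurable_snd
  | exact: measurableT_comp measurable_fst measurable_fst
  | exact: measurableT_comp measurable_snd measurable_fst
  | exact: measurableT_comp measurable_fst measurable_snd
  | exact: measurableT_comp measurable_snd measurable_snd
  | apply: measurable_rVB | apply: measurable_rVD | apply: measurable_rVZ ].

Section wigner_quadratic.
Context {R : realType} {n : nat}.
Local Notation V := ('rV[R]_n).
Local Notation leb := (@lebesgue_rV R n).
Local Notation leb2 := (leb \X leb)%E.
Local Notation leb4 := (leb2 \X leb2)%E.
Variable f : V -> R[i].
Hypothesis f2 : cL2 leb f.

Definition wigner_kernel (z : V * V) : R[i] :=
  f (z.1 + 2^-1 *: z.2) * conjc (f (z.1 - 2^-1 *: z.2)).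

(** The constant obtained by replacing the Cauchy-Schwarz inequality by
    [x * y <= x ^+ 2 + y ^+ 2]. *)
Definition wigner_bound : R := 2 * 2 ^+ n * \int[leb]_x (normc (f x) ^+ 2).

Lemma cmeasurable_kernel : cmeasurable wigner_kernel.
Proof.
have [mf _] := f2; apply: cmeasurableM.
  by apply: cmeasurable_comp mf _; measurable_coordinates.
by apply: cmeasurable_conj; apply: cmeasurable_comp mf _; measurable_coordinates.
Qed.

Lemma wigner_kernel_integrable u :
  cintegrable leb (fun t => wigner_kernel (u, t)) /\
  \int[leb]_t normc (wigner_kernel (u, t)) <= wigner_bound.
Proof.
have [mf fi] := f2; pose N (x : V) := normc (f x) ^+ 2.
have n2 : (2^-1 : R) != 0 by rewrite invr_eq0 pnatr_eq0.
have n2' : (- 2^-1 : R) != 0 by rewrite oppr_eq0.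
have s1 := scales_affine u n2; have s2 := scales_affine u n2'.
have i1 : rintegrable leb (fun t => N (2^-1 *: t + u)).
  exact: (rintegrable_scales s1 (rintegrable_measurable fi)).2 fi.
have i2 : rintegrable leb (fun t => N (- 2^-1 *: t + u)).
  exact: (rintegrable_scales s2 (rintegrable_measurable fi)).2 fi.
have bd t : normc (wigner_kernel (u, t)) <=
    N (2^-1 *: t + u) + N (- 2^-1 *: t + u).
  rewrite /wigner_kernel Normc.normcM normc_conj/= scaleNr (addrC _ u) (addrC _ u).
  exact: mulr_le_sqr.
have mk : cmeasurable (fun t => wigner_kernel (u, t)).
  exact: cmeasurable_comp cmeasurable_kernel (pair1_measurable u).
have ki : cintegrable leb (fun t => wigner_kernel (u, t)).
  exact: (cintegrable_le mk (rintegrableD i1 i2) bd).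
split => //.
apply: (le_trans (le_rintegral ki.2 (rintegrableD i1 i2) bd)).
rewrite rintegralD// (rintegral_scales s1 (F := N))// (rintegral_scales s2 (F := N))//.
rewrite /wigner_bound normrN gtr0_norm ?invr_gt0// invrK.
by rewrite -mulrDl mulr_natl mulr2n.
Qed.

Definition wigner_integrand (u : V * V) (t : V) : R[i] :=
  wigner_kernel (u.1, t) * expi (- (2 * pi * dotr t u.2)).

Lemma wignerE u : wigner f u = cintegral leb (wigner_integrand u).
Proof. by []. Qed.

Lemma normc_wigner_integrand u t :
  normc (wigner_integrand u t) = normc (wigner_kernel (u.1, t)).
Proof. by rewrite Normc.normcM normc_expi mulr1. Qed.

Lemma wigner_integrand_integrable u : cintegrable leb (wigner_integrand u).
Proof.
have [[mk ki] _] := wigner_kernel_integrable u.1.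
apply: (cintegrable_le _ ki); last by move=> t; rewrite normc_wigner_integrand.
apply: cmeasurableM => //; apply: cmeasurable_expi; apply: measurableT_comp => //.
by apply: measurable_funM => //; exact: measurable_dotr.
Qed.

(** The bound depends only on the norm of [f]; it makes the supremum over an
    orthonormal sequence finite at every point. *)
Lemma normc_wigner_le u : normc (wigner f u) <= wigner_bound.
Proof.
have [_ kb] := wigner_kernel_integrable u.1.
rewrite wignerE (le_trans (le_normc_cintegral (wigner_integrand_integrable u)))//.
apply: le_trans kb; rewrite le_eqVlt; apply/orP; left; apply/eqP.
by apply: eq_Rintegral => t _; rewrite normc_wigner_integrand.
Qed.

(** A product of two Wigner distributions is a double integral over differences.
    Integrating over the two frequencies first replaces the weight [B] by its
    Fourier transform [B'], and the measure preserving passage from midpoints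
    and differences to end points produces the four arguments of [f].  The
    boundedness of the integrals of [wigner_kernel] justifies the exchange. *)
Section fubini.
Variables (A B B' : V * V -> R).
Hypotheses (Ai : rintegrable leb2 A) (Bi : rintegrable leb2 B)
  (mB' : measurable_fun setT B').
Hypothesis B'E : forall t, cintegral leb2 (fun w =>
  (B w)%:C%C * expi (- (2 * pi * (dotr t.1 w.1 + dotr t.2 w.2)))) =
  (B' t)%:C%C.

Let mA := rintegrable_measurable Ai.
Let mB := rintegrable_measurable Bi.

Let AB (z : (V * V) * (V * V)) : R := A (z.1.1, z.2.1) * B (z.1.2, z.2.2).

Let ABi : rintegrable leb4 AB.
Proof.
have ti := rintegrable_tensor Ai Bi.
exact: (rintegrable_scales (scales_shuffle leb leb leb leb)
  (rintegrable_measurable ti)).2 ti.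
Qed.

Let X (z : ((V * V) * (V * V)) * (V * V)) : R[i] :=
  (AB z.1)%:C%C * (wigner_integrand z.1.1 z.2.1 * wigner_integrand z.1.2 z.2.2).

Let X' (z : ((V * V) * (V * V)) * (V * V)) : R[i] :=
  (A (z.1.1.1, z.1.2.1))%:C%C * (wigner_kernel z.1.1 * wigner_kernel z.1.2) *
  ((B z.2)%:C%C *
    expi (- (2 * pi * (dotr z.1.1.2 z.2.1 + dotr z.1.2.2 z.2.2)))).

Let XE z : X z = X' (prod_shuffle6 z).
Proof.
rewrite /X /X' /AB /wigner_integrand /prod_shuffle6/=.
have -> : (A (z.1.1.1, z.1.2.1) * B (z.1.1.2, z.1.2.2))%:C%C =
  (A (z.1.1.1, z.1.2.1))%:C%C * (B (z.1.1.2, z.1.2.2))%:C%C :> R[i].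
  by rewrite -rmorphM.
rewrite (_ : - (2 * pi * (dotr z.2.1 z.1.1.2 + dotr z.2.2 z.1.2.2)) =
  - (2 * pi * dotr z.2.1 z.1.1.2) + - (2 * pi * dotr z.2.2 z.1.2.2)).
  by rewrite expiD; ring.
by rewrite [X in - X = _]mulrDr opprD.
Qed.

Let mX' : cmeasurable X'.
Proof.
have mk := cmeasurable_kernel.
have m11 : measurable_fun setT (fun z : ((V * V) * (V * V)) * (V * V) => z.1.1).
  exact: measurableT_comp measurable_fst measurable_fst.
have m12 : measurable_fun setT (fun z : ((V * V) * (V * V)) * (V * V) => z.1.2).
  exact: measurableT_comp measurable_snd measurable_fst.
have m2 : measurable_fun setT (fun z : ((V * V) * (V * V)) * (V * V) => z.2).
  exact: measurable_snd.
apply: cmeasurableM.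
  apply: cmeasurableM.
    apply: cmeasurable_real; apply: measurableT_comp mA _.
    apply/measurable_fun_pairP; split.
      exact: measurableT_comp measurable_fst m11.
    exact: measurableT_comp measurable_fst m12.
  apply: cmeasurableM; first exact: cmeasurable_comp mk m11.
  exact: cmeasurable_comp mk m12.
apply: cmeasurableM.
  by apply: cmeasurable_real; exact: measurableT_comp mB m2.
apply: cmeasurable_expi; apply: measurableT_comp => //.
apply: measurable_funM => //; apply: measurable_funD; apply: measurable_dotr.
- exact: measurableT_comp measurable_snd m11.
- exact: measurableT_comp measurable_fst m2.
- exact: measurableT_comp measurable_snd m12.
- exact: measurableT_comp measurable_snd m2.
Qed.

Let s6 := scales_shuffle6 (lebesgue_rV n : {sigma_finite_measure set V -> \bar R}).

Let mX : cmeasurable X.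
Proof.
have -> : X = X' \o @prod_shuffle6 V by apply/funext => z; exact: XE.
by apply: cmeasurable_comp mX' _; case: s6.
Qed.

Let Xi : cintegrable (leb4 \X leb2)%E X.
Proof.
split; first exact: mX.
have gi := rintegrableZ (wigner_bound * wigner_bound) (rintegrable_abs ABi).
apply: (rintegrable_prod_le _ _ gi).
- exact: measurable_normc.
- by move=> z; exact: normc_ge0.
move=> [u v].
have [[mku kui] kub] := wigner_kernel_integrable u.1.
have [[mkv kvi] kvb] := wigner_kernel_integrable v.1.
have ti := rintegrable_tensor kui kvi.
have -> : (\int[leb2]_y (normc (X ((u, v), y)))%:E)%E =
  (`|AB (u, v)| * \int[leb2]_y (normc (wigner_kernel (u.1, y.1)) *
     normc (wigner_kernel (v.1, y.2))))%:E.
  rewrite -rintegralZ// -rintegral_EFin; last exact: rintegrableZ.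
  apply: eq_integral => y _; congr EFin.
  by rewrite /X Normc.normcM normc_real Normc.normcM !normc_wigner_integrand.
rewrite lee_fin (rintegral_tensor kui kvi) mulrC ler_wpM2r//.
by apply: ler_pM => //; apply: Rintegral_ge0 => t _; exact: normc_ge0.
Qed.

Let X'i : cintegrable (leb4 \X leb2)%E X'.
Proof.
apply: (cintegrable_scales s6 mX').1.
by under [X in cintegrable _ X]eq_fun do rewrite -XE; exact: Xi.
Qed.

Definition quartic_integrand (z : (V * V) * (V * V)) : R[i] :=
  ((f z.1.1 * conjc (f z.1.2)) * (f z.2.1 * conjc (f z.2.2))) *
  (A (2^-1 *: (z.1.1 + z.1.2), 2^-1 *: (z.2.1 + z.2.2)) *
   B' (z.1.1 - z.1.2, z.2.1 - z.2.2))%:C%C.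

Let sT := scales_prod (@scales_midpoint R n) (@scales_midpoint R n).

Lemma wigner_quadratic :
  [/\ cintegrable leb4 (fun z => (A (z.1.1, z.2.1) * B (z.1.2, z.2.2))%:C%C *
        (wigner f z.1 * wigner f z.2)),
      cintegrable leb4 quartic_integrand &
      cintegral leb4 (fun z => (A (z.1.1, z.2.1) * B (z.1.2, z.2.2))%:C%C *
        (wigner f z.1 * wigner f z.2)) = cintegral leb4 quartic_integrand].
Proof.
have [F1i F1e] := cintegral_fubini1 Xi.
have [F2i F2e] := cintegral_fubini1 X'i.
have E1 : (fun z => cintegral leb2 (fun y => X (z, y))) =
    (fun z => (A (z.1.1, z.2.1) * B (z.1.2, z.2.2))%:C%C *
        (wigner f z.1 * wigner f z.2)).
  apply/funext => z; rewrite !wignerE.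
  have i1 := wigner_integrand_integrable z.1.
  have i2 := wigner_integrand_integrable z.2.
  by rewrite -(cintegral_tensor i1 i2) -cintegralZ//; exact: cintegrable_tensor.
have E2 : (fun z => cintegral leb2 (fun y => X' (z, y))) =
    (fun z : (V * V) * (V * V) =>
      quartic_integrand (midpoint_map z.1, midpoint_map z.2)).
  apply/funext => z.
  rewrite [LHS](cintegralZ (mu := leb2) ((A (z.1.1, z.2.1))%:C%C *
    (wigner_kernel z.1 * wigner_kernel z.2))); last first.
    apply: (cintegrable_le _ (rintegrable_abs Bi)).
      apply: cmeasurableM; first exact: cmeasurable_real.
      apply: cmeasurable_expi; apply: measurableT_comp => //.
      apply: measurable_funM => //.
      by apply: measurable_funD; apply: measurable_dotr => //;
        (exact: measurable_fst || exact: measurable_snd).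
    by move=> y; rewrite Normc.normcM normc_expi mulr1 normc_real.
  rewrite (B'E (z.1.2, z.2.2)) /quartic_integrand /midpoint_map/=.
  have mid (x t : V) : 2^-1 *: (x + 2^-1 *: t + (x - 2^-1 *: t)) = x.
    by apply/rowP => i; rewrite !mxE; lra.
  have dif (x t : V) : x + 2^-1 *: t - (x - 2^-1 *: t) = t.
    by apply/rowP => i; rewrite !mxE; lra.
  rewrite !mid !dif /wigner_kernel.
  have -> : (A (z.1.1, z.2.1) * B' (z.1.2, z.2.2))%:C%C =
    (A (z.1.1, z.2.1))%:C%C * (B' (z.1.2, z.2.2))%:C%C :> R[i].
    by rewrite -rmorphM.
  ring.
rewrite E1 in F1i F1e; rewrite E2 in F2i F2e.
have mq : cmeasurable quartic_integrand.
  have [mf _] := f2.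
  have m11 : measurable_fun setT (fun z : (V * V) * (V * V) => z.1.1).
    exact: measurableT_comp measurable_fst measurable_fst.
  have m12 : measurable_fun setT (fun z : (V * V) * (V * V) => z.1.2).
    exact: measurableT_comp measurable_snd measurable_fst.
  have m21 : measurable_fun setT (fun z : (V * V) * (V * V) => z.2.1).
    exact: measurableT_comp measurable_fst measurable_snd.
  have m22 : measurable_fun setT (fun z : (V * V) * (V * V) => z.2.2).
    exact: measurableT_comp measurable_snd measurable_snd.
  apply: cmeasurableM; first apply: cmeasurableM; try apply: cmeasurableM.
  - exact: cmeasurable_comp mf m11.
  - by apply: cmeasurable_conj; exact: cmeasurable_comp mf m12.
  - exact: cmeasurable_comp mf m21.
  - by apply: cmeasurable_conj; exact: cmeasurable_comp mf m22.
  apply: cmeasurable_real; apply: measurable_funM.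
    apply: measurableT_comp mA _; apply/measurable_fun_pairP; split.
      by apply: measurable_rVZ; exact: measurable_rVD.
    by apply: measurable_rVZ; exact: measurable_rVD.
  apply: measurableT_comp mB' _; apply/measurable_fun_pairP; split.
    exact: measurable_rVB.
  exact: measurable_rVB.
have qi : cintegrable leb4 quartic_integrand.
  exact: (cintegrable_scales sT mq).1 F2i.
split => //.
have := cintegral_scales sT qi; rewrite F2e mulr1 mul1r => <-.
rewrite F1e; under eq_cintegral do rewrite XE.
by rewrite (cintegral_scales s6 X'i) mul1r.
Qed.

End fubini.
End wigner_quadratic.

(** * The quartic form and its symmetry *)

Section quartic_form.
Context {R : realType} {n : nat}.
Local Notation V := ('rV[R]_n).
Local Notation leb := (@lebesgue_rV R n).
Local Notation leb2 := (leb \X leb)%E.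
Local Notation leb4 := (leb2 \X leb2)%E.
Implicit Types (f : V -> R[i]) (p q r s : R).

Lemma rintegrable_sumdiff (k l : V -> R) : rintegrable leb k ->
  rintegrable leb l -> rintegrable leb2 (fun z => k (z.1 + z.2) * l (z.1 - z.2)).
Proof.
move=> ki li; have ti := rintegrable_tensor ki li.
exact: (rintegrable_scales (@scales_sumdiff R n) (rintegrable_measurable ti)).2 ti.
Qed.

(** The pairing is preserved up to the factor 2 by passing to sums and
    differences in both arguments, so the transform of a product in these
    coordinates is again such a product. *)
Lemma fourier_sumdiff (k l k' l' : V -> R) :
  rintegrable leb k -> rintegrable leb l ->
  (forall xi, cintegral leb (fun x => (k x)%:C%C *
    expi (- (2 * pi * dotr x xi))) = (k' xi)%:C%C) ->
  (forall xi, cintegral leb (fun x => (l x)%:C%C *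
    expi (- (2 * pi * dotr x xi))) = (l' xi)%:C%C) ->
  forall t : V * V, cintegral leb2 (fun w => (k (w.1 + w.2) * l (w.1 - w.2))%:C%C *
    expi (- (2 * pi * (dotr t.1 w.1 + dotr t.2 w.2)))) =
  (2^-1 ^+ n * (k' (2^-1 *: (t.1 + t.2)) * l' (2^-1 *: (t.1 - t.2))))%:C%C.
Proof.
move=> ki li kE lE t.
have fk := cintegrable_fourier (2^-1 *: (t.1 + t.2)) ki.
have fl := cintegrable_fourier (2^-1 *: (t.1 - t.2)) li.
have := cintegral_scales (@scales_sumdiff R n) (cintegrable_tensor fk fl).
rewrite (cintegral_tensor fk fl) kE lE -!rmorphM => <-.
apply: eq_cintegral => w; rewrite /sumdiff_map/= mulrACA -expiD -rmorphM.
congr (_ * expi _); rewrite -opprD -mulrDr; congr (- (_ * _)).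
rewrite !dotrZr !dotrDr !dotrDl !dotrNr !dotrNl.
rewrite (dotrC t.1 w.1) (dotrC t.2 w.2).
lra.
Qed.

Definition tent_fejer p q (z : V * V) : R :=
  tent_rV (p *: (z.1 + z.2)) * fejer_rV (q *: (z.1 - z.2)).

Definition tent_tent p q (z : V * V) : R :=
  tent_rV (p *: (z.1 + z.2)) * tent_rV (q *: (z.1 - z.2)).

Definition fejer_fejer p q (z : V * V) : R :=
  fejer_rV (p *: (z.1 + z.2)) * fejer_rV (q *: (z.1 - z.2)).

Lemma rintegrable_tent_fejer p q : 0 < p -> 0 < q -> rintegrable leb2 (tent_fejer p q).
Proof.
move=> p0 q0; exact: (rintegrable_sumdiff
  (rintegrable_homothety p0 (rintegrable_tent_rV n))
  (rintegrable_homothety q0 (rintegrable_fejer_rV n))).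
Qed.

Lemma rintegrable_tent_tent p q : 0 < p -> 0 < q -> rintegrable leb2 (tent_tent p q).
Proof.
move=> p0 q0; exact: (rintegrable_sumdiff
  (rintegrable_homothety p0 (rintegrable_tent_rV n))
  (rintegrable_homothety q0 (rintegrable_tent_rV n))).
Qed.

Lemma rintegrable_fejer_fejer p q : 0 < p -> 0 < q -> rintegrable leb2 (fejer_fejer p q).
Proof.
move=> p0 q0; exact: (rintegrable_sumdiff
  (rintegrable_homothety p0 (rintegrable_fejer_rV n))
  (rintegrable_homothety q0 (rintegrable_fejer_rV n))).
Qed.

Lemma fourier_tent_tent p q : 0 < p -> 0 < q ->
  forall t : V * V, cintegral leb2 (fun w => (tent_tent p q w)%:C%C *
    expi (- (2 * pi * (dotr t.1 w.1 + dotr t.2 w.2)))) =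
  ((2 * p * q)^-1 ^+ n * fejer_fejer (2 * p)^-1 (2 * q)^-1 t)%:C%C.
Proof.
move=> p0 q0 t; rewrite (fourier_sumdiff
  (rintegrable_homothety p0 (rintegrable_tent_rV n))
  (rintegrable_homothety q0 (rintegrable_tent_rV n))
  (fun xi => fourier_tent_rV xi p0) (fun xi => fourier_tent_rV xi q0)).
congr (_%:C)%C; rewrite /fejer_fejer !scalerA !invfM (mulrC _ 2^-1) (mulrC _ 2^-1).
by rewrite !exprMn; ring.
Qed.

Definition quartic_kernel p q r s (z : (V * V) * (V * V)) : R :=
  tent_fejer p q (z.1.1 + z.1.2, z.2.1 + z.2.2) *
  fejer_fejer r s (z.1.1 - z.1.2, z.2.1 - z.2.2).

Definition quartic_product f (z : (V * V) * (V * V)) : R[i] :=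
  (f z.1.1 * conjc (f z.1.2)) * (f z.2.1 * conjc (f z.2.2)).

Definition quartic f p q r s : R[i] :=
  cintegral leb4 (fun z => quartic_product f z * (quartic_kernel p q r s z)%:C%C).

(** The weights of positions and frequencies differ: the frequency weight is a
    product of tents, so that its Fourier transform is [fejer_fejer], and the
    position weight [tent_fejer] contains the same Fejer kernel in the
    difference variable.  Without this match the exchange of arguments in
    [quartic_swap] would not preserve the form of the kernel. *)
Definition wigner_form f p q r s : R[i] :=
  cintegral leb4 (fun z =>
    (tent_fejer p q (z.1.1, z.2.1) * tent_tent r s (z.1.2, z.2.2))%:C%C *
    (wigner f z.1 * wigner f z.2)).

Lemma wigner_form_quartic f p q r s : cL2 leb f ->
  0 < p -> 0 < q -> 0 < r -> 0 < s ->
  [/\ cintegrable leb4 (fun z =>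
      (tent_fejer p q (z.1.1, z.2.1) * tent_tent r s (z.1.2, z.2.2))%:C%C *
      (wigner f z.1 * wigner f z.2)),
    cintegrable leb4 (fun z => quartic_product f z *
      (quartic_kernel (p / 2) (q / 2) (2 * r)^-1 (2 * s)^-1 z)%:C%C) &
    wigner_form f p q r s = ((2 * r * s)^-1 ^+ n)%:C%C *
      quartic f (p / 2) (q / 2) (2 * r)^-1 (2 * s)^-1].
Proof.
move=> f2 p0 q0 r0 s0.
have r20 : 0 < (2 * r)^-1 by rewrite invr_gt0 mulr_gt0.
have s20 : 0 < (2 * s)^-1 by rewrite invr_gt0 mulr_gt0.
have mC := rintegrable_measurable (rintegrableZ ((2 * r * s)^-1 ^+ n)
  (rintegrable_fejer_fejer r20 s20)).
have [i1 i2 e] := wigner_quadratic f2 (rintegrable_tent_fejer p0 q0)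
  (rintegrable_tent_tent r0 s0) mC (fourier_tent_tent r0 s0).
set c : R := (2 * r * s)^-1 ^+ n in mC i2 e *.
have c0 : 0 < c by rewrite exprn_gt0// invr_gt0 !mulr_gt0.
have E : quartic_integrand f (tent_fejer p q)
    (fun x => c * fejer_fejer (2 * r)^-1 (2 * s)^-1 x) =
  (fun z => c%:C%C * (quartic_product f z *
      (quartic_kernel (p / 2) (q / 2) (2 * r)^-1 (2 * s)^-1 z)%:C%C)).
  apply/funext => z; rewrite /quartic_integrand /quartic_product /quartic_kernel.
  rewrite [RHS]mulrCA -rmorphM; congr (_ * (_%:C)%C).
  have -> : tent_fejer p q (2^-1 *: (z.1.1 + z.1.2), 2^-1 *: (z.2.1 + z.2.2)) =
      tent_fejer (p / 2) (q / 2) (z.1.1 + z.1.2, z.2.1 + z.2.2).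
    by rewrite /tent_fejer/= -scalerDr -scalerBr !scalerA.
  exact: mulrCA.
rewrite E in i2 e.
have i2' : cintegrable leb4 (fun z => quartic_product f z *
      (quartic_kernel (p / 2) (q / 2) (2 * r)^-1 (2 * s)^-1 z)%:C%C).
  have := cintegrableZ (c^-1)%:C%C i2.
  rewrite (_ : (fun x => _) = (fun z => quartic_product f z *
      (quartic_kernel (p / 2) (q / 2) (2 * r)^-1 (2 * s)^-1 z)%:C%C))//.
  apply/funext => z; rewrite mulrA -rmorphM mulVf ?gt_eqF//.
  exact: mul1r.
split => //.
by rewrite /wigner_form e cintegralZ.
Qed.

Lemma quartic_integrable f p q r s : cL2 leb f ->
  0 < p -> 0 < q -> 0 < r -> 0 < s ->
  cintegrable leb4 (fun z => quartic_product f z * (quartic_kernel p q r s z)%:C%C).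
Proof.
move=> f2 p0 q0 r0 s0.
have p2 : 0 < p * 2 by rewrite mulr_gt0.
have q2 : 0 < q * 2 by rewrite mulr_gt0.
have r2 : 0 < (2 * r)^-1 by rewrite invr_gt0 mulr_gt0.
have s2 : 0 < (2 * s)^-1 by rewrite invr_gt0 mulr_gt0.
have [_ + _] := wigner_form_quartic f2 p2 q2 r2 s2.
have t2 : (2 : R) != 0 by rewrite pnatr_eq0.
have h (x : R) : 0 < x -> (2 * (2 * x)^-1)^-1 = x.
  by move=> x0; rewrite invfM invrK mulKf// pnatr_eq0.
by rewrite (h r r0) (h s s0) (mulfK t2) (mulfK t2).
Qed.

(** Exchanging the conjugated arguments of f(a) f(b)^* f(a') f(b')^* leaves the
    product, a + b + a' + b' and a - b + a' - b' unchanged and swaps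
    a + b - a' - b' with a - b - a' + b', the combinations inside the Fejer
    kernels with parameters [q] and [s]. *)
Lemma quartic_swap f p q r s : cL2 leb f ->
  0 < p -> 0 < q -> 0 < r -> 0 < s -> quartic f p q r s = quartic f p s r q.
Proof.
move=> f2 p0 q0 r0 s0.
have h1 := scales_shuffle leb leb leb leb.
have h2 := scales_prod (scales_id leb2) (scales_swap leb leb).
have hs := scales_comp (scales_comp h1 h2) h1; rewrite !mulr1 in hs.
have := cintegral_scales hs (quartic_integrable f2 p0 s0 r0 q0).
rewrite mul1r => E; rewrite /quartic -[RHS]E {E}.
apply: eq_cintegral => -[[a b] [c e]].
rewrite /quartic_product /quartic_kernel /tent_fejer /fejer_fejer /comp
  /prod_shuffle /prod_swap/=.
have -> : a + e + (c + b) = a + b + (c + e) by rewrite [RHS]addrACA (addrC b) addrACA.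
have -> : a + e - (c + b) = a - b - (c - e).
  by apply/rowP => i; rewrite !mxE; lra.
have -> : a - e + (c - b) = a - b + (c - e).
  by apply/rowP => i; rewrite !mxE; lra.
have -> : a - e - (c - b) = a + b - (c + e).
  by apply/rowP => i; rewrite !mxE; lra.
have -> : f a * (f e)^*%C * (f c * (f b)^*%C) = f a * (f b)^*%C * (f c * (f e)^*%C).
  by ring.
have aux (x y w v : R) : x * y * (w * v) = x * v * (w * y) by ring.
rewrite aux; exact: erefl.
Qed.

Lemma mulr_bound (a b : R) : 0 <= a <= 1 -> 0 <= b <= 1 -> 0 <= a * b <= 1.
Proof.
move=> /andP[a0 a1] /andP[b0 b1].
by apply/andP; split; [exact: (mulr_ge0 a0 b0)|exact: (mulr_ile1 a0 b0 a1 b1)].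
Qed.

Lemma kernel_bound :
  [/\ forall p q z, 0 <= tent_fejer p q z <= 1, forall p q z, 0 <= tent_tent p q z <= 1 &
      forall p q z, 0 <= fejer_fejer p q z <= 1].
Proof.
by split => p q z; apply: mulr_bound; (exact: tent_rV_bound || exact: fejer_rV_bound).
Qed.

Lemma quartic_kernel_bound p q r s z : 0 <= quartic_kernel p q r s z <= 1.
Proof.
have [hA _ hC] := kernel_bound; rewrite /quartic_kernel.
have /andP[a0 a1] := hA p q (z.1.1 + z.1.2, z.2.1 + z.2.2).
have /andP[b0 b1] := hC r s (z.1.1 - z.1.2, z.2.1 - z.2.2).
by apply/andP; split; [exact: (mulr_ge0 a0 b0)|exact: (mulr_ile1 a0 b0 a1 b1)].
Qed.

Lemma rintegrable_quartic_kernel p q r s : 0 < p -> 0 < q -> 0 < r -> 0 < s ->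
  rintegrable leb4 (quartic_kernel p q r s).
Proof.
move=> p0 q0 r0 s0.
have p2 : 0 < p * 2 by rewrite mulr_gt0.
have q2 : 0 < q * 2 by rewrite mulr_gt0.
have iA := rintegrable_tent_fejer p2 q2; have iC := rintegrable_fejer_fejer r0 s0.
have iAC := rintegrable_tensor iA iC.
have i4 : rintegrable leb4 (fun z : (V * V) * (V * V) =>
    tent_fejer (p * 2) (q * 2) (z.1.1, z.2.1) * fejer_fejer r s (z.1.2, z.2.2)).
  exact: (rintegrable_scales (scales_shuffle leb leb leb leb)
    (rintegrable_measurable iAC)).2 iAC.
have sT := scales_prod (@scales_midpoint R n) (@scales_midpoint R n).
have mA := rintegrable_measurable (rintegrable_tent_fejer p0 q0).
have mC := rintegrable_measurable iC.
have mK : measurable_fun setT (quartic_kernel p q r s).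
  apply: measurable_funM.
    apply: measurableT_comp mA _; apply/measurable_fun_pairP.
    by split; measurable_coordinates.
  apply: measurableT_comp mC _; apply/measurable_fun_pairP.
  by split; measurable_coordinates.
have mid (x t : V) : x + 2^-1 *: t + (x - 2^-1 *: t) = 2 *: x.
  by apply/rowP => i; rewrite !mxE; lra.
have dif (x t : V) : x + 2^-1 *: t - (x - 2^-1 *: t) = t.
  by apply/rowP => i; rewrite !mxE; lra.
have E : (fun z => quartic_kernel p q r s (midpoint_map z.1, midpoint_map z.2)) =
    (fun z : (V * V) * (V * V) =>
    tent_fejer (p * 2) (q * 2) (z.1.1, z.2.1) * fejer_fejer r s (z.1.2, z.2.2)).
  apply/funext => z; rewrite /quartic_kernel /midpoint_map /=.
  rewrite !mid !dif /tent_fejer/= -scalerDr -scalerBr !scalerA.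
  exact: erefl.
by apply: (rintegrable_scales sT mK).1; rewrite E; exact: i4.
Qed.

(** The quartic form is the inner product of a fixed kernel with a member of the
    orthonormal sequence of fourfold tensor powers, so Bessel's inequality
    applies. *)
Lemma quartic_cvg0 (g : nat -> V -> R[i]) p q r s : orthonormal leb g ->
  0 < p -> 0 < q -> 0 < r -> 0 < s ->
  normc (quartic (g m) p q r s) @[m --> \oo] --> (0 : R).
Proof.
move=> og p0 q0 r0 s0.
have og2 := orthonormal_tensor og (orthonormal_conj og).
have og4 := orthonormal_tensor og2 og2.
have ki := rintegrable_quartic_kernel p0 q0 r0 s0.
have mk := rintegrable_measurable ki.
have k2 : cL2 leb4 (fun z => (quartic_kernel p q r s z)%:C%C).
  apply: (cL2_le _ ki); first exact: cmeasurable_real.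
  move=> z; have /andP[k0 k1] := quartic_kernel_bound p q r s z.
  by rewrite normc_real ger0_norm// expr2 ler_piMr.
have := cinner_orthonormal_cvg0 og4 k2.
apply: cvg_trans; apply: near_eq_cvg; apply: nearW => m.
have [e2 _] := og4.
rewrite -(normc_conj (quartic _ _ _ _ _)) /quartic -cintegral_conj.
  congr normc; apply: eq_cintegral => z.
  rewrite [RHS]conjcM [RHS]mulrC; congr (_ * _).
  by rewrite /= oppr0.
exact: quartic_integrable (og.1 m) p0 q0 r0 s0.
Qed.

End quartic_form.

(** * The limit of the quartic form on unit vectors *)

Section diagonal_limit.
Context {R : realType} {n : nat}.
Local Notation V := ('rV[R]_n).
Local Notation leb := (@lebesgue_rV R n).
Local Notation leb2 := (leb \X leb)%E.
Local Notation leb4 := (leb2 \X leb2)%E.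
Variable f : V -> R[i].
Hypothesis f2 : cL2 leb f.

(** New variables in which the four arguments are [e + c (p + y)], [b],
    [b + c (p - y)] and [e]: the two combinations on which the swapped
    kernel concentrates become [2 c p] and [2 c y]. *)
Definition blowup (c : R) (z : (V * V) * (V * V)) : (V * V) * (V * V) :=
  ((z.2.1 + c *: (z.1.1 + z.1.2), z.2.2),
   (z.2.2 + c *: (z.1.1 - z.1.2), z.2.1)).

Lemma scales_blowup c : 0 < c ->
  scales_measure (2^-1 ^+ n * (c^-1 ^+ n * c^-1 ^+ n)) leb4 leb4 (blowup c).
Proof.
move=> c0.
have hc := scales_homothety n c0.
have h1 := scales_prod (scales_comp (@scales_sumdiff R n) (scales_prod hc hc)) (scales_id leb2).
have m1 : measurable_fun setT (fun z : (V * V) * (V * V) =>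
    (z.1.1 + z.2.1, z.1.2 + z.2.2)).
  by apply/measurable_fun_pairP; split; measurable_coordinates.
have h2 := scales_fibre1 leb2 m1 (fun y => scales_prod (scales_translation y.1)
  (scales_translation y.2)).
have h3 := scales_prod (scales_id leb2) (scales_swap leb leb).
have h4 := scales_shuffle leb leb leb leb.
have := scales_comp (scales_comp (scales_comp h1 h2) h3) h4.
rewrite !mulr1; congr (scales_measure _ _ _ _).
apply/funext => -[[p y] [e b]].
by rewrite /blowup /prod_shuffle /prod_swap /sumdiff_map /comp/= (addrC e) (addrC b).
Qed.

Definition blowup_weight (c : R) (x e : V * V) : R :=
  tent_rV (c *: (e.1 + e.2 + c *: x.1)) * fejer_rV (c *: (e.1 - e.2 + c *: x.2)).

Definition correlation_product (u v : V) (e : V * V) : R[i] :=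
  (f (e.1 + u) * conjc (f e.1)) * (f (e.2 + v) * conjc (f e.2)).

(** In the new variables the concentrating factors of the kernel no longer
    depend on [c], and the remaining ones form a weight that tends to 1. *)
Lemma quartic_blowup c z : 0 < c ->
  quartic_product f (blowup c z) *
    (quartic_kernel (c / 2) (2 * c)^-1 (2 * c)^-1 (c / 2) (blowup c z))%:C%C =
  (fejer_rV z.1.1 * fejer_rV z.1.2)%:C%C *
  (correlation_product (c *: (z.1.1 + z.1.2)) (c *: (z.1.1 - z.1.2)) z.2 *
   (blowup_weight c z.1 z.2)%:C%C).
Proof.
move=> c0; move: z => [[p y] [e b]].
rewrite /quartic_product /quartic_kernel /tent_fejer /fejer_fejer /blowup
  /correlation_product /blowup_weight [in LHS]/= [in RHS]/=.
have c20 : 2 * c != 0 by rewrite mulf_neq0 ?pnatr_eq0// gt_eqF.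
have E1 : (c / 2) *: (e + c *: (p + y) + b + (b + c *: (p - y) + e)) =
    c *: (e + b + c *: p) by apply/rowP => i; rewrite !mxE; lra.
have E2 : (2 * c)^-1 *: (e + c *: (p + y) + b - (b + c *: (p - y) + e)) = y.
  have -> : e + c *: (p + y) + b - (b + c *: (p - y) + e) = (2 * c) *: y.
    by apply/rowP => i; rewrite !mxE; lra.
  by rewrite scalerA mulVf// scale1r.
have E3 : (2 * c)^-1 *: (e + c *: (p + y) - b + (b + c *: (p - y) - e)) = p.
  have -> : e + c *: (p + y) - b + (b + c *: (p - y) - e) = (2 * c) *: p.
    by apply/rowP => i; rewrite !mxE; lra.
  by rewrite scalerA mulVf// scale1r.
have E4 : (c / 2) *: (e + c *: (p + y) - b - (b + c *: (p - y) - e)) =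
    c *: (e - b + c *: y) by apply/rowP => i; rewrite !mxE; lra.
rewrite E1 E2 E3 E4.
have aux (t1 t2 t3 t4 : R) : (t1 * t2 * (t3 * t4))%:C%C =
   (t3 * t2)%:C%C * (t1 * t4)%:C%C :> R[i].
  by rewrite -rmorphM; congr (_%:C)%C; ring.
rewrite aux.
have aux' (z1 z2 z3 z4 k1 k2 : R[i]) : z1 * z2 * (z3 * z4) * (k1 * k2) =
    k1 * (z1 * z4 * (z3 * z2) * k2) by ring.
exact: aux'.
Qed.

Lemma correlation_integrable (u : V) :
  cintegrable leb (fun e => f (e + u) * conjc (f e)) /\
  \int[leb]_e normc (f (e + u) * conjc (f e)) <=
    2 * \int[leb]_e (normc (f e) ^+ 2).
Proof.
have ci := cL2_mul (cL2_translate u f2) (cL2_conj f2).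
split => //; have [_ ti] := cL2_translate u f2; have [_ fi] := f2.
apply: (@le_trans _ _ (\int[leb]_e (normc (f (e + u)) ^+ 2 + normc (f e) ^+ 2))).
  apply: le_rintegral; [exact: ci.2|exact: rintegrableD|] => e.
  by rewrite Normc.normcM normc_conj mulr_le_sqr.
rewrite rintegralD// (rintegral_scales (scales_translation u)
  (F := fun e => normc (f e) ^+ 2))// mul1r.
by rewrite [leRHS]mulr_natl mulr2n.
Qed.

Lemma blowup_weight_bound c x e : 0 <= blowup_weight c x e <= 1.
Proof.
have /andP[a0 a1] := tent_rV_bound (c *: (e.1 + e.2 + c *: x.1)).
have /andP[b0 b1] := fejer_rV_bound (c *: (e.1 - e.2 + c *: x.2)).
by apply/andP; split; [exact: (mulr_ge0 a0 b0)|exact: (mulr_ile1 a0 b0 a1 b1)].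
Qed.

Lemma measurable_blowup_weight c x : measurable_fun setT (blowup_weight c x).
Proof.
apply: measurable_funM.
  apply: measurableT_comp (@measurable_tent_rV R n) _.
  by measurable_coordinates; exact: measurable_cst.
apply: measurableT_comp (@measurable_fejer_rV R n) _.
by measurable_coordinates; exact: measurable_cst.
Qed.

Lemma weighted_correlation_integrable c (u v : V) x :
  cintegrable leb2 (fun e => correlation_product u v e *
    (blowup_weight c x e)%:C%C) /\
  normc (cintegral leb2 (fun e => correlation_product u v e *
    (blowup_weight c x e)%:C%C)) <=
  (2 * \int[leb]_e (normc (f e) ^+ 2)) * (2 * \int[leb]_e (normc (f e) ^+ 2)).
Proof.
have [iu bu] := correlation_integrable u; have [iv bv] := correlation_integrable v.
have [mt ti] := cintegrable_tensor iu iv.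
have bd e : normc (correlation_product u v e * (blowup_weight c x e)%:C%C) <=
    normc (f (e.1 + u) * conjc (f e.1) * (f (e.2 + v) * conjc (f e.2))).
  have /andP[w0 w1] := blowup_weight_bound c x e.
  rewrite Normc.normcM normc_real ger0_norm// ler_piMr// normc_ge0//.
have ci : cintegrable leb2 (fun e => correlation_product u v e *
    (blowup_weight c x e)%:C%C).
  apply: (cintegrable_le _ ti bd); apply: cmeasurableM => //.
  by apply: cmeasurable_real; exact: measurable_blowup_weight.
split => //.
apply: (le_trans (le_normc_cintegral ci)).
apply: (le_trans (le_rintegral ci.2 ti bd)).
under eq_Rintegral do rewrite Normc.normcM.
rewrite (rintegral_tensor iu.2 iv.2).
by apply: ler_pM => //; apply: Rintegral_ge0 => e _; exact: normc_ge0.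
Qed.

Let blowup_integrand c (z : (V * V) * (V * V)) : R[i] :=
  (fejer_rV z.1.1 * fejer_rV z.1.2)%:C%C *
    (correlation_product (c *: (z.1.1 + z.1.2)) (c *: (z.1.1 - z.1.2)) z.2 *
     (blowup_weight c z.1 z.2)%:C%C).

Lemma wigner_form_blowup c : 0 < c ->
  cintegrable leb2 (fun x =>
    (fejer_rV x.1 * fejer_rV x.2)%:C%C * cintegral leb2 (fun e =>
      correlation_product (c *: (x.1 + x.2)) (c *: (x.1 - x.2)) e *
      (blowup_weight c x e)%:C%C)) /\
  wigner_form f c c c c = cintegral leb2 (fun x =>
    (fejer_rV x.1 * fejer_rV x.2)%:C%C * cintegral leb2 (fun e =>
      correlation_product (c *: (x.1 + x.2)) (c *: (x.1 - x.2)) e *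
      (blowup_weight c x e)%:C%C)).
Proof.
move=> c0.
have c20 : 0 < (2 * c)^-1 by rewrite invr_gt0 mulr_gt0.
have c2 : 0 < c / 2 by rewrite divr_gt0.
have [_ _ ->] := wigner_form_quartic f2 c0 c0 c0 c0.
rewrite (quartic_swap f2 c2 c2 c20 c20).
have qi := quartic_integrable f2 c2 c20 c20 c2.
have sb := scales_blowup c0.
have E := cintegral_scales sb qi.
have i4 := (cintegrable_scales sb qi.1).2 qi.
pose G z : R[i] := quartic_product f z *
  (quartic_kernel (c / 2) (2 * c)^-1 (2 * c)^-1 (c / 2) z)%:C%C.
have EB z : blowup_integrand c z = G (blowup c z).
  by apply: esym; exact: (quartic_blowup z c0).
have {}E : cintegral leb4 (blowup_integrand c) =
    (2^-1 ^+ n * (c^-1 ^+ n * c^-1 ^+ n))%:C%C * cintegral leb4 G.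
  by rewrite -[RHS]E; exact: (eq_cintegral _ EB).
have {}i4 : cintegrable leb4 (blowup_integrand c).
  have -> : blowup_integrand c = (fun z => G (blowup c z)).
    by apply/funext => z; exact: EB.
  exact: i4.
have [Fi Fe] := cintegral_fubini1 i4.
have EF : (fun x => cintegral leb2 (fun y => blowup_integrand c (x, y))) =
   (fun x =>
    (fejer_rV x.1 * fejer_rV x.2)%:C%C * cintegral leb2 (fun e =>
      correlation_product (c *: (x.1 + x.2)) (c *: (x.1 - x.2)) e *
      (blowup_weight c x e)%:C%C)).
  apply/funext => x.
  have [wi _] := weighted_correlation_integrable c (c *: (x.1 + x.2))
    (c *: (x.1 - x.2)) x.
  rewrite -(cintegralZ ((fejer_rV x.1 * fejer_rV x.2)%:C)%C wi).
  by apply: eq_cintegral => y; rewrite /blowup_integrand.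
split; first by rewrite -EF; exact: Fi.
transitivity (cintegral leb4 (blowup_integrand c)); last by rewrite -Fe EF.
rewrite E; congr (_%:C%C * _).
by rewrite !invfM !exprMn mulrA.
Qed.

Lemma harmonicM_cvg0 (a : R) : k.+1%:R^-1 * a @[k --> \oo] --> (0 : R).
Proof.
rewrite -[X in _ --> X](mul0r a).
by apply: cvgM; [exact: cvg_harmonic|exact: cvg_cst].
Qed.

Lemma harmonicMD_cvg0 (a b : R) :
  k.+1%:R^-1 * (a + k.+1%:R^-1 * b) @[k --> \oo] --> (0 : R).
Proof.
rewrite -[X in _ --> X](mul0r (a + 0)).
apply: cvgM; first exact: cvg_harmonic.
by apply: cvgD; [exact: cvg_cst|exact: harmonicM_cvg0].
Qed.

Let N := \int[leb]_e (normc (f e) ^+ 2).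
Let C := \int[leb]_x (fejer_rV x : R).

Lemma correlation_cvg_line (p : V) :
  \int[leb]_e normc (f (e + k.+1%:R^-1 *: p) * conjc (f e) - f e * conjc (f e))
    @[k --> \oo] --> (0 : R).
Proof.
apply: (@correlation_cvg _ _ _ (\sum_(i < n) `|p ord0 i|)) => //.
- move=> k i; rewrite mxE normrM ger0_norm ?invr_ge0//.
  rewrite (le_trans (_ : _ <= `|p ord0 i|))//.
    by rewrite ler_piMl// invf_le1// ler1n.
  by rewrite (bigD1 i)//= lerDl sumr_ge0.
- move=> i; under eq_fun do rewrite mxE.
  exact: harmonicM_cvg0.
Qed.

Lemma blowup_weight_cvg1 (x e : V * V) :
  blowup_weight k.+1%:R^-1 x e @[k --> \oo] --> (1 : R).
Proof.
have lin (a b : V) i : (k.+1%:R^-1 *: (a + k.+1%:R^-1 *: b)) ord0 i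
    @[k --> \oo] --> (0 : R).
  under eq_fun do rewrite !mxE.
  exact: harmonicMD_cvg0.
rewrite -[X in _ --> X](mulr1 1); apply: cvgM.
  by apply: tent_rV_cvg1 => i; exact: lin.
by apply: fejer_rV_cvg1 => i; exact: lin.
Qed.

(** After the blow-up the inner integral tends to |f|^4, since the translations
    by multiples of [1 / k.+1] tend to the identity in L2; the remaining
    outer weight is a product of two Fejer kernels. *)
Lemma wigner_form_diagonal_cvg :
  ccvg (fun k => wigner_form f k.+1%:R^-1 k.+1%:R^-1 k.+1%:R^-1 k.+1%:R^-1)
       ((C ^+ 2 * N ^+ 2)%:C%C).
Proof.
have e0 k : 0 < k.+1%:R^-1 :> R by rewrite invr_gt0.
have Ci : rintegrable leb (@fejer_rV R n) := @rintegrable_fejer_rV R n.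
have CCi := rintegrable_tensor Ci Ci.
have ffE : cintegral leb (fun e => f e * conjc (f e)) = N%:C%C.
  by rewrite -cintegral_real; apply: eq_cintegral => e; exact: mulc_conj.
pose S k (x : V * V) := cintegral leb2 (fun e =>
  correlation_product (k.+1%:R^-1 *: (x.1 + x.2)) (k.+1%:R^-1 *: (x.1 - x.2)) e *
  (blowup_weight k.+1%:R^-1 x e)%:C%C).
have Slim x : ccvg (S ^~ x) (N%:C%C * N%:C%C).
  rewrite -ffE.
  apply: (@weighted_tensor_cvg _ _ _ _ _ leb leb
    (fun k e => f (e + k.+1%:R^-1 *: (x.1 + x.2)) * conjc (f e)) _
    (fun k e => f (e + k.+1%:R^-1 *: (x.1 - x.2)) * conjc (f e)) _
    (fun k e => blowup_weight k.+1%:R^-1 x e)).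
  - by move=> k; have [] := correlation_integrable (k.+1%:R^-1 *: (x.1 + x.2)).
  - exact: cL2_mul f2 (cL2_conj f2).
  - by move=> k; have [] := correlation_integrable (k.+1%:R^-1 *: (x.1 - x.2)).
  - exact: cL2_mul f2 (cL2_conj f2).
  - exact: correlation_cvg_line.
  - exact: correlation_cvg_line.
  - by move=> k; exact: measurable_blowup_weight.
  - by move=> k z; exact: blowup_weight_bound.
  - by move=> z; exact: blowup_weight_cvg1.
have WE k : wigner_form f k.+1%:R^-1 k.+1%:R^-1 k.+1%:R^-1 k.+1%:R^-1 =
    cintegral leb2 (fun x => (fejer_rV x.1 * fejer_rV x.2)%:C%C * S k x).
  by have [_ ->] := wigner_form_blowup (e0 k).
have limE : (C ^+ 2 * N ^+ 2)%:C%C =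
    cintegral leb2 (fun x => (fejer_rV x.1 * fejer_rV x.2)%:C%C * (N%:C%C * N%:C%C)).
  under eq_cintegral do rewrite mulrC.
  rewrite cintegralZ; last exact: cintegrable_real.
  by rewrite cintegral_real (rintegral_tensor Ci Ci) -!rmorphM mulrC !expr2.
rewrite (_ : (fun k => _) = fun k => cintegral leb2 (fun x =>
  (fejer_rV x.1 * fejer_rV x.2)%:C%C * S k x)); last exact/funext.
rewrite limE.
have N0 : 0 <= N by apply: Rintegral_ge0 => x _; exact: sqr_ge0.
have ff0 (x : V * V) : 0 <= fejer_rV x.1 * fejer_rV x.2 :> R.
  have /andP[a0 _] := fejer_rV_bound x.1; have /andP[b0 _] := fejer_rV_bound x.2.
  exact: (mulr_ge0 a0 b0).
have bi := rintegrableZ ((2 * N) * (2 * N)) CCi.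
apply: (cintegral_cvg _ _ bi).
- by move=> k; case: (wigner_form_blowup (e0 k)).1.
- apply: cmeasurableM; last exact: cmeasurable_cst.
  exact: cmeasurable_real (rintegrable_measurable CCi).
- move=> k x; rewrite Normc.normcM normc_real ger0_norm; last exact: ff0.
  rewrite mulrC; apply: ler_wpM2r; first exact: ff0.
  by have [] := weighted_correlation_integrable k.+1%:R^-1
    (k.+1%:R^-1 *: (x.1 + x.2)) (k.+1%:R^-1 *: (x.1 - x.2)) x.
- move=> x; rewrite Normc.normcM normc_real ger0_norm; last exact: ff0.
  rewrite mulrC; apply: ler_wpM2r; first exact: ff0.
  by rewrite Normc.normcM !normc_real ger0_norm//; apply: ler_pM => //; lra.
- move=> x; rewrite /ccvg.
  rewrite (_ : (fun k => _) = fun k => fejer_rV x.1 * fejer_rV x.2 *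
      normc (S k x - N%:C%C * N%:C%C)).
    rewrite -[X in _ --> X](mulr0 (fejer_rV x.1 * fejer_rV x.2)).
    by apply: cvgM; [exact: cvg_cst|exact: Slim].
  apply/funext => k; rewrite -mulrBr Normc.normcM normc_real ger0_norm//.
Qed.

End diagonal_limit.

(** * Cutoffs under a dominating function *)

Section domination.
Context {R : realType} {n : nat}.
Local Notation V := ('rV[R]_n).
Local Notation leb := (@lebesgue_rV R n).
Local Notation leb2 := (leb \X leb)%E.
Local Notation leb4 := (leb2 \X leb2)%E.
Implicit Types (c e : R) (z : (V * V) * (V * V)) (f : V -> R[i]).

Definition sum_cutoff c z : R :=
  tent_rV (c *: (z.1.1 + z.2.1)) * tent_rV (c *: (z.1.2 + z.2.2)).

Definition diff_cutoff c z : R :=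
  fejer_rV (c *: (z.1.1 - z.2.1)) * tent_rV (c *: (z.1.2 - z.2.2)).

Lemma sum_cutoff_bound c z : 0 <= sum_cutoff c z <= 1.
Proof. exact: (mulr_bound (tent_rV_bound _) (tent_rV_bound _)). Qed.

Lemma diff_cutoff_bound c z : 0 <= diff_cutoff c z <= 1.
Proof. exact: (mulr_bound (fejer_rV_bound _) (tent_rV_bound _)). Qed.

Lemma sum_cutoff_swap c z : sum_cutoff c (prod_swap z) = sum_cutoff c z.
Proof.
by rewrite /sum_cutoff /prod_swap/= (addrC z.2.1) (addrC z.2.2).
Qed.

Lemma diff_cutoff_swap c z : diff_cutoff c (prod_swap z) = diff_cutoff c z.
Proof.
rewrite /diff_cutoff /prod_swap/= -(opprB z.1.1) -(opprB z.1.2) !scalerN.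
by rewrite fejer_rVN tent_rVN.
Qed.

Lemma measurable_sum_cutoff c : measurable_fun setT (sum_cutoff c).
Proof.
by apply: measurable_funM; apply: measurableT_comp (@measurable_tent_rV R n) _;
  measurable_coordinates.
Qed.

Lemma measurable_diff_cutoff c : measurable_fun setT (diff_cutoff c).
Proof.
apply: measurable_funM.
  by apply: measurableT_comp (@measurable_fejer_rV R n) _; measurable_coordinates.
by apply: measurableT_comp (@measurable_tent_rV R n) _; measurable_coordinates.
Qed.

Definition cutoff_form f c e : R[i] := wigner_form f c e c e.

Lemma cutoff_form_integrable f c e : cL2 leb f -> 0 < c -> 0 < e ->
  cintegrable leb4 (fun z => (sum_cutoff c z * diff_cutoff e z)%:C%C *
    (wigner f z.1 * wigner f z.2)) /\
  cutoff_form f c e = cintegral leb4 (fun z =>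
    (sum_cutoff c z * diff_cutoff e z)%:C%C * (wigner f z.1 * wigner f z.2)).
Proof.
move=> f2 c0 e0; have [i _ _] := wigner_form_quartic f2 c0 e0 c0 e0.
have E : (fun z => (sum_cutoff c z * diff_cutoff e z)%:C%C *
    (wigner f z.1 * wigner f z.2)) =
  (fun z => (tent_fejer c e (z.1.1, z.2.1) * tent_tent c e (z.1.2, z.2.2))%:C%C *
      (wigner f z.1 * wigner f z.2)).
  apply/funext => z; congr (_%:C%C * _).
  have aux (x y w v : R) : x * y * (w * v) = x * w * (y * v) by ring.
  exact: aux.
by rewrite E; split.
Qed.

(** The difference cutoff of scale [e] is traded for one of scale [1 / e], the
    regularised form of Moyal's identity. *)
Lemma cutoff_form_swap f c e : cL2 leb f -> 0 < c -> 0 < e ->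
  cutoff_form f c e = (e^-1 ^+ n * e^-1 ^+ n)%:C%C * cutoff_form f c e^-1.
Proof.
move=> f2 c0 e0; have e'0 : 0 < e^-1 by rewrite invr_gt0.
have c20 : 0 < (2 * c)^-1 by rewrite invr_gt0 mulr_gt0.
have c2 : 0 < c / 2 by rewrite divr_gt0.
have e20 : 0 < (2 * e)^-1 by rewrite invr_gt0 mulr_gt0.
have e2 : 0 < e / 2 by rewrite divr_gt0.
rewrite /cutoff_form; have [_ _ ->] := wigner_form_quartic f2 c0 e0 c0 e0.
have [_ _ ->] := wigner_form_quartic f2 c0 e'0 c0 e'0.
rewrite (quartic_swap f2 c2 e2 c20 e20).
have -> : e^-1 / 2 = (2 * e)^-1 by rewrite invfM mulrC.
have -> : (2 * e^-1)^-1 = e / 2 by rewrite invfM invrK mulrC.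
rewrite mulrA -rmorphM; congr (_%:C%C * _).
rewrite -!exprMn; congr (_ ^+ n); field.
by rewrite !gt_eqF.
Qed.

Lemma mulr_le_mean (x y p q : R) : x ^+ 2 <= p -> y ^+ 2 <= q ->
  x * y <= 2^-1 * (p + q).
Proof. by move=> *; have := sqr_ge0 (x - y); lra. Qed.

Lemma dist_le_complements (x y : R) : 0 <= x <= 1 -> 0 <= y <= 1 ->
  `|x - y| <= (1 - x) + (1 - y).
Proof.
move=> /andP[x0 x1] /andP[y0 y1].
by rewrite ler_norml; apply/andP; split; lra.
Qed.

Section dominating_function.
Variables (P : V * V -> R).
Hypotheses (Pi : rintegrable leb2 P) (P0 : forall u, 0 <= P u).

Let mP := rintegrable_measurable Pi.
Let mP1 : measurable_fun setT (fun z : (V * V) * (V * V) => P z.1).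
Proof. exact: measurableT_comp mP measurable_fst. Qed.

(** By the arithmetic-geometric inequality |W(u) W(v)| is at most the mean of
    P(u) and P(v), and both contribute equally because [D] is symmetric. *)
Lemma wigner_domination f (k k' D : (V * V) * (V * V) -> R) :
  (forall u, normc (wigner f u) ^+ 2 <= P u) ->
  cintegrable leb4 (fun z => (k z)%:C%C * (wigner f z.1 * wigner f z.2)) ->
  cintegrable leb4 (fun z => (k' z)%:C%C * (wigner f z.1 * wigner f z.2)) ->
  (forall z, `|k z - k' z| <= D z) -> (forall z, D (prod_swap z) = D z) ->
  rintegrable leb4 (fun z => D z * P z.1) ->
  normc (cintegral leb4 (fun z => (k z)%:C%C * (wigner f z.1 * wigner f z.2)) -
    cintegral leb4 (fun z => (k' z)%:C%C * (wigner f z.1 * wigner f z.2))) <=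
    \int[leb4]_z (D z * P z.1).
Proof.
move=> fP ki k'i kD Dsw Di.
have sw := scales_swap leb2 leb2.
have Di' : rintegrable leb4 (fun z => D z * P z.2).
  have := (rintegrable_scales sw (rintegrable_measurable Di)).2 Di.
  by under [X in rintegrable _ X]eq_fun do rewrite Dsw.
have E' : \int[leb4]_z (D z * P z.2) = \int[leb4]_z (D z * P z.1).
  have := rintegral_scales sw Di; rewrite mul1r => <-.
  by apply: eq_Rintegral => z _; rewrite Dsw.
rewrite -(cintegralB ki k'i).
have Yi := cintegrableB ki k'i.
apply: (le_trans (le_normc_cintegral Yi)).
apply: (@le_trans _ _ (\int[leb4]_z (2^-1 * (D z * P z.1 + D z * P z.2)))).
  apply: le_rintegral; first exact: Yi.2.
    by apply: rintegrableZ; exact: rintegrableD.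
  move=> z; rewrite -mulrBl -rmorphB Normc.normcM Normc.normcM normc_real.
  rewrite -mulrDr [leRHS]mulrCA.
  have W1 := fP z.1; have W2 := fP z.2.
  apply: ler_pM => //; first by apply: mulr_ge0; exact: normc_ge0.
  exact: mulr_le_mean W1 W2.
rewrite rintegralZ; last exact: rintegrableD.
rewrite rintegralD// E' -mulr2n -[X in _ * X]mulr_natl mulrA mulVf ?mul1r//.
Qed.

(** A bound, uniform in [f], for the error made in the form when the difference
    cutoff is omitted. *)
Definition tail_diff c e : R :=
  \int[leb4]_z (sum_cutoff c z * (1 - diff_cutoff e z) * P z.1).

Lemma rintegrable_sum_cutoff c : 0 < c ->
  rintegrable leb4 (fun z => sum_cutoff c z * P z.1).
Proof.
move=> c0; pose k (w : V * V) : R := tent_rV w.1 * tent_rV w.2.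
have ti : rintegrable leb (@tent_rV R n) by exact: rintegrable_tent_rV.
have ki : rintegrable leb2 k := rintegrable_tensor ti ti.
have Pk := rintegrable_tensor Pi ki.
pose S (z : (V * V) * (V * V)) : V * V :=
  (c *: (z.1.1 + z.2.1), c *: (z.1.2 + z.2.2)).
have mS : measurable_fun setT S.
  by apply/measurable_fun_pairP; split; measurable_coordinates.
have aff (u : V) : scales_measure (c^-1 ^+ n) leb leb (fun v => c *: (u + v)).
  have := scales_affine (c *: u) (lt0r_neq0 c0); rewrite gtr0_norm//.
  by congr (scales_measure _ _ _ _); apply/funext => v; rewrite scalerDr addrC.
have s := scales_fibre2 leb2 mS (fun u => scales_prod (aff u.1) (aff u.2)).
have := (rintegrable_scales s (rintegrable_measurable Pk)).2 Pk.
rewrite (_ : (fun x => _) = (fun z => sum_cutoff c z * P z.1))//.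
by apply/funext => z; rewrite mulrC.
Qed.

Lemma tail_diff_integrable c e : 0 < c ->
  rintegrable leb4 (fun z => sum_cutoff c z * (1 - diff_cutoff e z) * P z.1).
Proof.
move=> c0; have si := rintegrable_sum_cutoff c0.
apply: (rintegrable_le _ si).
  apply: measurable_funM => //; apply: measurable_funM; first exact: measurable_sum_cutoff.
  by apply: measurable_funB => //; exact: measurable_diff_cutoff.
move=> z; have /andP[a0 a1] := sum_cutoff_bound c z.
have /andP[b0 b1] := diff_cutoff_bound e z; have p0 := P0 z.1.
have d0 : 0 <= 1 - diff_cutoff e z by lra.
rewrite ger0_norm; last by apply: mulr_ge0; [exact: mulr_ge0|exact: p0].
by apply: ler_wpM2r; [exact: p0|apply: ler_piMr; [exact: a0|lra]].
Qed.

Lemma tail_diff_cvg0 c : 0 < c ->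
  tail_diff c k.+1%:R^-1 @[k --> \oo] --> (0 : R).
Proof.
move=> c0; have si := rintegrable_sum_cutoff c0.
apply: (rintegral_cvg0 _ si).
- by move=> k; exact: rintegrable_measurable (tail_diff_integrable _ c0).
- move=> k z; have /andP[a0 a1] := sum_cutoff_bound c z.
  have /andP[b0 b1] := diff_cutoff_bound k.+1%:R^-1 z; have p0 := P0 z.1.
  have d0 : 0 <= 1 - diff_cutoff k.+1%:R^-1 z by lra.
  rewrite ger0_norm; last by apply: mulr_ge0; [exact: mulr_ge0|exact: p0].
  by apply: ler_wpM2r; [exact: p0|apply: ler_piMr; [exact: a0|lra]].
- move=> z; rewrite -[X in _ --> X](mul0r (P z.1)); apply: cvgM; last exact: cvg_cst.
  rewrite -[X in _ --> X](mulr0 (sum_cutoff c z)); apply: cvgM; first exact: cvg_cst.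
  rewrite -[X in _ --> X](subrr (1 : R)); apply: cvgB; first exact: cvg_cst.
  rewrite -[X in _ --> X](mulr1 (1 : R)); apply: cvgM.
    apply: fejer_rV_cvg1 => i; under eq_fun do rewrite mxE.
    exact: harmonicM_cvg0.
  apply: tent_rV_cvg1 => i; under eq_fun do rewrite mxE.
  exact: harmonicM_cvg0.
Qed.

Lemma cutoff_form_diff f c e e' : cL2 leb f ->
  (forall u, normc (wigner f u) ^+ 2 <= P u) -> 0 < c -> 0 < e -> 0 < e' ->
  normc (cutoff_form f c e - cutoff_form f c e') <=
    tail_diff c e + tail_diff c e'.
Proof.
move=> f2 fP c0 e0 e'0.
have [i1 ->] := cutoff_form_integrable f2 c0 e0.
have [i2 ->] := cutoff_form_integrable f2 c0 e'0.
have t1 := tail_diff_integrable e c0; have t2 := tail_diff_integrable e' c0.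
pose D z := sum_cutoff c z * (1 - diff_cutoff e z) +
  sum_cutoff c z * (1 - diff_cutoff e' z).
have DP z : D z * P z.1 = sum_cutoff c z * (1 - diff_cutoff e z) * P z.1 +
    sum_cutoff c z * (1 - diff_cutoff e' z) * P z.1 by rewrite mulrDl.
rewrite /tail_diff -rintegralD//; under eq_Rintegral do rewrite -DP.
apply: (wigner_domination fP i1 i2).
- move=> z; rewrite /D -mulrBr -mulrDr normrM.
  have /andP[a0 _] := sum_cutoff_bound c z.
  have b01 := diff_cutoff_bound e z; have d01 := diff_cutoff_bound e' z.
  by rewrite (ger0_norm a0); apply: ler_wpM2l => //; exact: dist_le_complements.
- by move=> z; rewrite /D sum_cutoff_swap !diff_cutoff_swap.
- by under [X in rintegrable _ X]eq_fun do rewrite DP; exact: rintegrableD.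
Qed.

(** A bound, uniform in [f], for the error made when the sum cutoff is omitted
    after the exchange of arguments.  It is written in the variable
    [(u - v) / e], in which the dominating function does not depend on [e]. *)
Definition tail_sum c e : R := \int[leb4]_z
  ((1 - sum_cutoff c (z.1, (z.1.1 - e *: z.2.1, z.1.2 - e *: z.2.2))) *
   (fejer_rV z.2.1 * tent_rV z.2.2) * P z.1).

Let localised_dominant_integrable : rintegrable leb4 (fun z =>
  P z.1 * (fejer_rV z.2.1 * tent_rV z.2.2)).
Proof.
have ti : rintegrable leb (@tent_rV R n) by exact: rintegrable_tent_rV.
have fi : rintegrable leb (@fejer_rV R n) by exact: rintegrable_fejer_rV.
exact: (rintegrable_tensor Pi (rintegrable_tensor fi ti)).
Qed.

Let diag (e : R) z : (V * V) * (V * V) :=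
  (z.1, (z.1.1 - e *: z.2.1, z.1.2 - e *: z.2.2)).

Let diff_cutoff_diag e z : 0 < e ->
  diff_cutoff e^-1 (diag e z) = fejer_rV z.2.1 * tent_rV z.2.2.
Proof.
move=> e0; rewrite /diff_cutoff /diag/= !opprB.
have -> : z.1.1 + (e *: z.2.1 - z.1.1) = e *: z.2.1 by rewrite addrC subrK.
have -> : z.1.2 + (e *: z.2.2 - z.1.2) = e *: z.2.2 by rewrite addrC subrK.
by rewrite !scalerA mulVf ?gt_eqF// !scale1r.
Qed.

Let tail_sum_bound c e z :
  `|(1 - sum_cutoff c (diag e z)) * (fejer_rV z.2.1 * tent_rV z.2.2) * P z.1| <=
  P z.1 * (fejer_rV z.2.1 * tent_rV z.2.2).
Proof.
have /andP[a0 a1] := sum_cutoff_bound c (diag e z).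
have /andP[b0 b1] := mulr_bound (fejer_rV_bound z.2.1) (tent_rV_bound z.2.2).
have p0 := P0 z.1; have d0 : 0 <= 1 - sum_cutoff c (diag e z) by lra.
rewrite ger0_norm; last by apply: mulr_ge0 => //; exact: mulr_ge0.
by rewrite [leRHS]mulrC; apply: ler_wpM2r; [exact: p0|apply: ler_piMl; [exact: b0|lra]].
Qed.

Let tail_sum_integrable c e : 0 < e ->
  rintegrable leb4 (fun z =>
    (1 - sum_cutoff c (diag e z)) * (fejer_rV z.2.1 * tent_rV z.2.2) * P z.1).
Proof.
move=> e0; apply: (rintegrable_le _ localised_dominant_integrable); last exact: tail_sum_bound.
have [_ mh _] := @scales_diagonal R n e e0.
apply: measurable_funM => //; apply: measurable_funM.
  apply: measurable_funB => //.
  exact: measurableT_comp (measurable_sum_cutoff c) mh.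
apply: measurable_funM.
  by apply: measurableT_comp (@measurable_fejer_rV R n) _; measurable_coordinates.
by apply: measurableT_comp (@measurable_tent_rV R n) _; measurable_coordinates.
Qed.

Lemma tail_sum_localised c e : 0 < e ->
  rintegrable leb4 (fun z => (1 - sum_cutoff c z) * diff_cutoff e^-1 z * P z.1) /\
  tail_sum c e = e^-1 ^+ n * e^-1 ^+ n *
    \int[leb4]_z ((1 - sum_cutoff c z) * diff_cutoff e^-1 z * P z.1).
Proof.
move=> e0; have sd := @scales_diagonal R n e e0.
pose F z := (1 - sum_cutoff c z) * diff_cutoff e^-1 z * P z.1.
have mF : measurable_fun setT F.
  apply: measurable_funM => //; apply: measurable_funM.
    by apply: measurable_funB => //; exact: measurable_sum_cutoff.
  exact: measurable_diff_cutoff.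
have EF : (fun z => F (diag e z)) = (fun z =>
    (1 - sum_cutoff c (diag e z)) * (fejer_rV z.2.1 * tent_rV z.2.2) * P z.1).
  by apply/funext => z; rewrite /F diff_cutoff_diag.
have Fi : rintegrable leb4 F.
  apply: (rintegrable_scales sd mF).1.
  rewrite -/(diag e) EF; exact: tail_sum_integrable.
split; first exact: Fi.
have := rintegral_scales sd Fi; rewrite -[X in _ -> _ = X]/(_ * \int[leb4]_z F z).
move=> <-; rewrite /tail_sum.
by apply: eq_Rintegral => z _; rewrite /F -/(diag e z) diff_cutoff_diag.
Qed.

Lemma tail_sum_cvg0 (c e : nat -> R) : (forall k, 0 < e k) ->
  c k @[k --> \oo] --> (0 : R) -> e k @[k --> \oo] --> (0 : R) ->
  tail_sum (c k) (e k) @[k --> \oo] --> (0 : R).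
Proof.
move=> e0 lc le; apply: (rintegral_cvg0 _ localised_dominant_integrable).
- by move=> k; exact: rintegrable_measurable (tail_sum_integrable (c k) (e0 k)).
- by move=> k z; exact: tail_sum_bound.
- move=> z; rewrite -[X in _ --> X](mul0r (P z.1)); apply: cvgM; last exact: cvg_cst.
  rewrite -[X in _ --> X](mul0r (fejer_rV z.2.1 * tent_rV z.2.2)).
  apply: cvgM; last exact: cvg_cst.
  rewrite -[X in _ --> X](subrr (1 : R)); apply: cvgB; first exact: cvg_cst.
  have lin (a b w : R) : c k * (a + (b - e k * w)) @[k --> \oo] --> (0 : R).
    rewrite -[X in _ --> X](mul0r (a + (b - 0 * w))); apply: cvgM => //.
    apply: cvgD; first exact: cvg_cst.
    apply: cvgB; first exact: cvg_cst.
    by apply: cvgM => //; exact: cvg_cst.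
  rewrite -[X in _ --> X](mulr1 (1 : R)); apply: cvgM.
    by apply: tent_rV_cvg1 => i; under eq_fun do rewrite !mxE; exact: lin.
  by apply: tent_rV_cvg1 => i; under eq_fun do rewrite !mxE; exact: lin.
Qed.

(** The estimate is made after the exchange of arguments: before it, [v] ranges
    over a region of volume of order [e ^- (2 * n)], and the error would not be
    small uniformly for small [e]. *)
Lemma cutoff_form_sum f c c' e : cL2 leb f ->
  (forall u, normc (wigner f u) ^+ 2 <= P u) -> 0 < c -> 0 < c' -> 0 < e ->
  normc (cutoff_form f c e - cutoff_form f c' e) <=
    tail_sum c e + tail_sum c' e.
Proof.
move=> f2 fP c0 c'0 e0.
rewrite (cutoff_form_swap f2 c0 e0) (cutoff_form_swap f2 c'0 e0) -mulrBr.
have e'0 : 0 < e^-1 by rewrite invr_gt0.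
have k0 : 0 <= e^-1 ^+ n * e^-1 ^+ n by rewrite mulr_ge0// exprn_ge0// ltW.
rewrite Normc.normcM normc_real (ger0_norm k0).
have [t1 ->] := tail_sum_localised c e0; have [t2 ->] := tail_sum_localised c' e0.
rewrite -mulrDr; apply: ler_wpM2l => //.
have [i1 ->] := cutoff_form_integrable f2 c0 e'0.
have [i2 ->] := cutoff_form_integrable f2 c'0 e'0.
pose D z := (1 - sum_cutoff c z) * diff_cutoff e^-1 z +
  (1 - sum_cutoff c' z) * diff_cutoff e^-1 z.
have DP z : D z * P z.1 = (1 - sum_cutoff c z) * diff_cutoff e^-1 z * P z.1 +
    (1 - sum_cutoff c' z) * diff_cutoff e^-1 z * P z.1 by rewrite mulrDl.
rewrite -rintegralD//; under eq_Rintegral do rewrite -DP.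
apply: (wigner_domination fP i1 i2).
- move=> z; rewrite /D -mulrBl -mulrDl normrM.
  have /andP[a0 _] := diff_cutoff_bound e^-1 z.
  have b01 := sum_cutoff_bound c z; have d01 := sum_cutoff_bound c' z.
  by rewrite (ger0_norm a0); apply: ler_wpM2r => //; exact: dist_le_complements.
- by move=> z; rewrite /D !sum_cutoff_swap diff_cutoff_swap.
- by under [X in rintegrable _ X]eq_fun do rewrite DP; exact: rintegrableD.
Qed.

End dominating_function.
End domination.

(** * Orthonormal sequences have no dominating function *)

Lemma lt_four_quarters {R : realType} (a b c w M : R) : a < M / 4 ->
  b <= M / 8 + M / 8 -> c <= M / 8 + M / 8 -> w < M / 4 ->
  M <= a + (b + (c + w)) -> False.
Proof. lra. Qed.

Lemma normc_chain {R : realType} (x y z w : R[i]) :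
  normc w <= normc x + (normc (y - x) + (normc (y - z) + normc (z - w))).
Proof.
rewrite (_ : w = x + ((y - x) + ((z - y) + (w - z)))); last by ring.
apply: le_trans (le_normcD _ _) _; apply: lerD => //.
apply: le_trans (le_normcD _ _) _; apply: lerD => //.
apply: le_trans (le_normcD _ _) _; rewrite (normcB_sym z y).
by apply: lerD => //; rewrite (_ : x + _ = w) ?(normcB_sym z w)//; ring.
Qed.

Section no_dominating_function.
Context {R : realType} {n : nat}.
Local Notation V := ('rV[R]_n).
Local Notation leb := (@lebesgue_rV R n).
Local Notation leb2 := (leb \X leb)%E.

(** Otherwise bad indices could be chosen beyond every [N], and along them both
    parameters would tend to 0. *)
Lemma tail_sum_uniform (P : V * V -> R) (eta : R) : rintegrable leb2 P ->
  (forall u, 0 <= P u) -> 0 < eta ->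
  exists N, forall k l, (N <= k)%N -> (N <= l)%N ->
    tail_sum P k.+1%:R^-1 l.+1%:R^-1 <= eta.
Proof.
move=> Pi P0 eta0; apply/not_existsP => H.
have {}H N : exists kl : nat * nat, [/\ (N <= kl.1)%N, (N <= kl.2)%N &
    eta < tail_sum P kl.1.+1%:R^-1 kl.2.+1%:R^-1].
  have /existsNP[k /existsNP[l /not_implyP[Nk /not_implyP[Nl /negP]]]] := H N.
  by rewrite -ltNge => h; exists (k, l).
have [h hP] := choice H.
have lim (u : nat -> nat) : (forall N, (N <= u N)%N) ->
    (u N).+1%:R^-1 @[N --> \oo] --> (0 : R).
  move=> uN; apply: (@squeeze_cvgr _ _ _ _ (cst 0) (fun N => N.+1%:R^-1)).
  - apply: nearW => N; rewrite invr_ge0 ler0n/=.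
    by rewrite lef_pV2 ?posrE ?ltr0n// ler_nat ltnS.
  - exact: cvg_cst.
  - exact: cvg_harmonic.
have e0 N : 0 < (h N).2.+1%:R^-1 :> R by rewrite invr_gt0.
have h1 N : (N <= (h N).1)%N by case: (hP N).
have h2 N : (N <= (h N).2)%N by case: (hP N).
have := tail_sum_cvg0 Pi P0 e0 (lim _ h1) (lim _ h2).
move=> /cvgrPdist_lt/(_ _ eta0)[N _ NP].
have := NP N (leqnn N); rewrite /= sub0r normrN => /(le_lt_trans (ler_norm _)).
by have [_ _ /ltW] := hP N; rewrite leNgt => /negP.
Qed.

(** The order of the choices is essential: [N] and [L] depend on [P] only, [m]
    on them, and [l] on [m]. *)
Lemma orthonormal_wigner_not_dominated (g : nat -> V -> R[i]) (P : V * V -> R) :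
  orthonormal leb g -> rintegrable leb2 P -> (forall u, 0 <= P u) ->
  ~ forall m u, normc (wigner (g m) u) ^+ 2 <= P u.
Proof.
move=> og Pi P0 gP; have g2 m : cL2 leb (g m) by case: og.
pose e k : R := k.+1%:R^-1.
have e0 k : 0 < e k by rewrite invr_gt0.
pose J m k l := cutoff_form (g m) (e k) (e l).
pose M : R := (\int[leb]_x (fejer_rV x : R)) ^+ 2.
have M0 : 0 < M by rewrite exprn_gt0// rintegral_fejer_rV_gt0.
have M8 : 0 < M / 8 by rewrite divr_gt0.
have M4 : 0 < M / 4 by rewrite divr_gt0.
have [N NP] := tail_sum_uniform Pi P0 M8.
have [L LP] : exists L, forall l, (L <= l)%N -> tail_diff P (e N) (e l) <= M / 8.
  have /cvgrPdist_le/(_ _ M8)[L _ LP] := tail_diff_cvg0 Pi P0 (e0 N).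
  exists L => l Ll; have := LP l Ll.
  by rewrite /= sub0r normrN; exact: le_trans (ler_norm _).
have Jm0 : normc (J m N L) @[m --> \oo] --> (0 : R).
  have p1 : 0 < e N / 2 by rewrite divr_gt0.
  have p2 : 0 < e L / 2 by rewrite divr_gt0.
  have p3 : 0 < (2 * e N)^-1 by rewrite invr_gt0 mulr_gt0.
  have p4 : 0 < (2 * e L)^-1 by rewrite invr_gt0 mulr_gt0.
  have lim := quartic_cvg0 og p1 p2 p3 p4.
  pose c := normc ((2 * e N * e L)^-1 ^+ n)%:C%C : R.
  rewrite (_ : (fun m => _) = fun m => c *
    normc (quartic (g m) (e N / 2) (e L / 2) (2 * e N)^-1 (2 * e L)^-1)).
    by rewrite -[X in _ --> X](mulr0 c); apply: cvgM => //; exact: cvg_cst.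
  apply/funext => m; rewrite -Normc.normcM; congr normc.
  have [_ _ h] := wigner_form_quartic (g2 m) (e0 N) (e0 L) (e0 N) (e0 L); exact: h.
have /cvgrPdist_lt/(_ _ M4)[m _ mP] := Jm0.
have {mP} J1 : normc (J m N L) < M / 4.
  have := mP m (leqnn m); rewrite /= sub0r normrN.
  exact: le_lt_trans (ler_norm _).
have N1 : \int[leb]_x (normc (g m x) ^+ 2) = 1.
  have [_ /(_ m m)] := og; rewrite eqxx cinner_norm => h.
  by case: h.
have := wigner_form_diagonal_cvg (g2 m).
rewrite /ccvg N1 expr1n mulr1 -/M => /cvgrPdist_lt/(_ _ M4)[K _ KP].
pose l := maxn K (maxn N L).
have J4 : normc (J m l l - M%:C%C) < M / 4.
  have := KP l (leq_maxl _ _); rewrite /= sub0r normrN.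
  exact: le_lt_trans (ler_norm _).
have Nl : (N <= l)%N by rewrite /l !leq_max leqnn orbT.
have Ll : (L <= l)%N by rewrite /l !leq_max leqnn !orbT.
have J2 : normc (J m N l - J m N L) <= M / 8 + M / 8.
  apply: le_trans (cutoff_form_diff Pi P0 (g2 m) (gP m) (e0 N) (e0 l) (e0 L)) _.
  by apply: lerD; exact: LP.
have J3 : normc (J m N l - J m l l) <= M / 8 + M / 8.
  apply: le_trans (cutoff_form_sum Pi P0 (g2 m) (gP m) (e0 N) (e0 l) (e0 l)) _.
  by apply: lerD; exact: NP.
have : normc M%:C%C <= normc (J m N L) + (normc (J m N l - J m N L) +
    (normc (J m N l - J m l l) + normc (J m l l - M%:C%C))).
  exact: normc_chain.
rewrite normc_real gtr0_norm//.
exact: lt_four_quarters J1 J2 J3 J4.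
Qed.

End no_dominating_function.

Section from_Lp.
Context {R : realType} d (T : measurableType d) (mu : {measure set T -> \bar R}).

Lemma Lnorm2_lty (f : T -> \bar R) : ('N[mu]_2%:E[f] < +oo)%E ->
  (\int[mu]_x (`|f x| `^ 2) < +oo)%E.
Proof.
move=> h; rewrite -poweR_Lnorm ?pnatr_eq0//.
exact: poweR_lty.
Qed.

Lemma cL2_of_cLfun (f : T -> R[i]) : cLfun mu 2%:E f -> cL2 mu f.
Proof.
move=> [rf jf f2]; have mf : cmeasurable f by split.
split => //; apply: rintegrableP.
- by apply: measurable_funX; exact: measurable_normc.
- by move=> x; exact: sqr_ge0.
have := Lnorm2_lty f2; congr (_ < _)%E; apply: eq_integral => x _ /=.
by rewrite powR_mulrn ?normr_ge0// ger0_norm ?normc_ge0.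
Qed.

End from_Lp.

Theorem corollary2p2 (R : realType) (d : nat) (hd : (1 <= d)%N)
    (g : nat -> 'rV[R]_d -> R[i])
    (g_orthonormal : orthonormal_seq (lebesgue_rV d) g)
    (g_L12 : forall n,
       cLfun (lebesgue_rV d) 1%:E (g n) /\ cLfun (lebesgue_rV d) 2%:E (g n))
    (fg_L12 : forall n,
       cLfun (lebesgue_rV d) 1%:E (fourier (g n)) /\
       cLfun (lebesgue_rV d) 2%:E (fourier (g n))) :
  ~ eLfun (lebesgue_rV d \x lebesgue_rV d)%E 2%:E
      (fun z : 'rV[R]_d * 'rV[R]_d =>
         ereal_sup (range (fun n => (Normc.normc (wigner (g n) z))%:E))).
Proof.
set Phi := fun z => _; move=> [mPhi Phi2].
have og : orthonormal (lebesgue_rV d) g.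
  have [gL gE] := g_orthonormal; split => // m.
  exact: cL2_of_cLfun (gL m).
have g2 m : cL2 (lebesgue_rV d) (g m) by case: og.
have le_Phi m z : ((normc (wigner (g m) z))%:E <= Phi z)%E.
  by apply: ereal_sup_ubound; exists m.
have Phi0 z : (0 <= Phi z)%E.
  by apply: le_trans (le_Phi 0%N z); rewrite lee_fin normc_ge0.
have Phi_fin z : Phi z \is a fin_num.
  rewrite ge0_fin_numE//; apply: (@le_lt_trans _ _ (2 * 2 ^+ d)%:E); last exact: ltry.
  apply: ge_ereal_sup => _ [m _ <-]; rewrite lee_fin.
  rewrite (le_trans (normc_wigner_le (g2 m) z))// /wigner_bound.
  have [_ /(_ m m)] := og; rewrite eqxx cinner_norm => h.
  have -> : \int[lebesgue_rV d]_x (normc (g m x) ^+ 2) = 1 by case: h.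
  by rewrite mulr1.
pose P z := fine (Phi z) ^+ 2.
have P0 z : 0 <= P z by exact: sqr_ge0.
apply: (orthonormal_wigner_not_dominated og _ P0) => [|m z]; last first.
  have := le_Phi m z; rewrite -(fineK (Phi_fin z)) lee_fin => h.
  by rewrite ler_sqr ?nnegrE ?normc_ge0// (le_trans _ h)// normc_ge0.
apply: rintegrableP => //.
  by apply: measurable_funX; exact: measurableT_comp mPhi.
have := Lnorm2_lty Phi2; congr (_ < _)%E; apply: eq_integral => z _ /=.
rewrite gee0_abs// -{1}(fineK (Phi_fin z)) poweR_EFin powR_mulrn//.
exact: fine_ge0.
Qed.
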